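(* Let $\Omega\subseteq\mathbb{R}^n$ be open and let $f\in{}^*\mathcal{C}^\infty(\Omega)$. Then $f\in D'(\Omega)$ if and only if for each compact $K\subset\Omega$ there exists $g\in D'(\Omega)$ which is finite-valued and S-continuous on ${}^*K$ and such that $f$ is a finite order derivative of $g$ on ${}^*K$, i.e. there is a (standard) multi-index $\alpha\in\mathbb{N}^n$ with $f(x)=\partial^\alpha g(x)$ for all $x\in{}^*K$.
   Context: We work in Robinson-style nonstandard analysis: ${}^*A$ is the nonstandard extension of $A$. $\mathbb{N}$ contains $0$; $x\approx y$ means that $x-y$ is infinitesimal. $\mathrm{Fin}({}^*\mathbb{C})$ is the set of finite (limited) elements of ${}^*\mathbb{C}$. Integrals of internal functions are $*$-integrals. $K$ ranges over standard compact sets. $g$ is finite-valued on ${}^*K$ iff $g(x)\in\mathrm{Fin}({}^*\mathbb{C})$ for all $x\in{}^*K$; $g$ is S-continuous on ${}^*K$ iff $x\approx y$ implies $g(x)\approx g(y)$ for all $x,y\in{}^*K$. $\mathcal{C}^\infty(\Omega)$ is the space of smooth functions $\Omega\to\mathbb{C}$, $\mathcal{D}(\Omega)$ the test functions (smooth with compact support in $\Omega$). $\mathrm{ns}({}^*\Omega)=\{x\in{}^*\Omega:\exists y\in\Omega,\ x\approx y\}$. $\phi\in{}^*\mathcal{D}(\Omega)$ is a finite element, $\phi\in\mathrm{Fin}({}^*\mathcal{D}(\Omega))$, iff its support is contained in $\mathrm{ns}({}^*\Omega)$ and $\partial^\alpha\phi(x)\in\mathrm{Fin}({}^*\mathbb{C})$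 for all standard multi-indices $\alpha\in\mathbb{N}^n$ and all $x\in{}^*\Omega$. The set of S-distributions (Stroyan–Luxemburg nonstandard representatives of distributions) is $D'(\Omega)=\{f\in{}^*\mathcal{C}^\infty(\Omega):\int_{{}^*\Omega}f\phi\in\mathrm{Fin}({}^*\mathbb{C})\ \forall\phi\in\mathrm{Fin}({}^*\mathcal{D}(\Omega))\}$. *)

(* Defs.v *)
From HB Require Import structures.
From mathcomp Require Import all_boot all_order all_algebra.
From mathcomp Require Import all_classical all_reals all_analysis.
From mathcomp Require Import complex.

Set Implicit Arguments.
Unset Strict Implicit.
Unset Printing Implicit Defensive.

Import Order.TTheory GRing.Theory Num.Theory numFieldNormedType.Exports.

Local Open Scope classical_set_scope.
Local Open Scope ring_scope.

(* [Rcomplex R] is R[i] with the modulus as an R-valued norm. Making it a real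
   normed space lets the library's ['D_v f x] be used for complex-valued f. *)
HB.instance Definition _ (R : realType) := isPointed.Build (Rcomplex R) 0.
HB.instance Definition _ (R : realType) :=
  PseudoMetric.copy (Rcomplex R) (pseudoMetric_normed (Rcomplex R)).
HB.instance Definition _ (R : realType) :=
  NormedZmod_PseudoMetric_eq.Build R (Rcomplex R) erefl.

Lemma Rcomplex_normrZ (R : realType) (l : R) (z : Rcomplex R) :
  `|l *: z| = `|l| * `|z|.
Proof.
case: z => a b; rewrite /Num.norm /= /ComplexField.Normc.normc /=.
by rewrite !exprMn -mulrDr sqrtrM ?sqr_ge0// sqrtr_sqr.
Qed.

HB.instance Definition _ (R : realType) :=
  PseudoMetricNormedZmod_Lmodule_isNormedModule.Build R (Rcomplex R)
    (@Rcomplex_normrZ R).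

(* Nonstandard extensions. [star E A] is *A, [std a] the standard element *a,
   [smap f] the extension *f of a function and [sset P] the extension of a
   subset, viewed as a subset of *A. The axioms say that the extension
   commutes with finite products, inverse images (substitution), complement
   and intersection (negation and conjunction), direct images (existential
   quantification) and equality, hence with every first-order formula built
   from arbitrary relations and functions between arbitrary types: this is the
   transfer principle. Since A may itself be a type of sets or functions,
   *(set A) and *(A -> B) are the internal subsets of *A and the internal
   functions *A -> *B. The last axiom makes the extension a proper one; no
   saturation is required. *)
Record nsExtension := NsExtension {
  star : Type -> Type;
  std : forall A : Type, A -> star A;
  smap : forall A B : Type, (A -> B) -> star A -> star B;
  spair : forall A B : Type, star A -> star B -> star (A * B);
  sset : forall A : Type, set A -> set (star A);

  smap_id : forall (A : Type) (x : star A), smap id x = x;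
  smap_comp : forall (A B C : Type) (g : B -> C) (f : A -> B) (x : star A),
    smap (g \o f) x = smap g (smap f x);
  smap_std : forall (A B : Type) (f : A -> B) (a : A),
    smap f (std a) = std (f a);

  smap_fst : forall (A B : Type) (x : star A) (y : star B),
    smap fst (spair x y) = x;
  smap_snd : forall (A B : Type) (x : star A) (y : star B),
    smap snd (spair x y) = y;
  spair_eta : forall (A B : Type) (p : star (A * B)),
    spair (smap fst p) (smap snd p) = p;

  sset_std : forall (A : Type) (P : set A) (a : A), sset P (std a) <-> P a;
  sset_preimage : forall (A B : Type) (f : A -> B) (P : set B),
    sset (f @^-1` P) = smap f @^-1` sset P;
  sset_image : forall (A B : Type) (f : A -> B) (P : set A),
    sset (f @` P) = smap f @` sset P;
  sset_setC : forall (A : Type) (P : set A), sset (~` P) = ~` sset P;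
  sset_setI : forall (A : Type) (P Q : set A),
    sset (P `&` Q) = sset P `&` sset Q;
  sset_diag : forall (A : Type) (x y : star A),
    sset [set p | p.1 = p.2] (spair x y) <-> x = y;

  star_proper : exists N : star nat, forall k : nat, N <> std k
}.

Section Internal.
Variable E : nsExtension.

Definition smap2 (A B C : Type) (f : A -> B -> C) (x : star E A)
    (y : star E B) : star E C :=
  smap (fun p => f p.1 p.2) (spair x y).

Definition sapp (A B : Type) (f : star E (A -> B)) (x : star E A) : star E B :=
  smap2 (fun (f : A -> B) (x : A) => f x) f x.

Definition smem (A : Type) (x : star E A) (S : star E (set A)) : Prop :=
  sset [set p : A * set A | p.2 p.1] (spair x S).

Variables (R : realType) (V : normedModType R).

Definition limited (x : star E V) : Prop :=
  exists r : R, sset [set v : V | `|v| <= r] x.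

Definition infinitesimal (x : star E V) : Prop :=
  forall e : R, 0 < e -> sset [set v : V | `|v| < e] x.

Definition infclose (x y : star E V) : Prop :=
  infinitesimal (smap2 (fun u v : V => u - v) x y).

End Internal.

Section Smooth.
Variables (R : realType) (n : nat).
Implicit Types (Omega : set 'rV[R]_n) (f : 'rV[R]_n -> Rcomplex R).

Definition pderiv (i : 'I_n) f : 'rV[R]_n -> Rcomplex R :=
  fun x => 'D_(delta_mx 0 i) f x.

Definition mderiv (alpha : 'I_n -> nat) f : 'rV[R]_n -> Rcomplex R :=
  foldr (fun i g => iter (alpha i) (pderiv i) g) f (enum 'I_n).

Definition smooth_on Omega f : Prop :=
  forall (s : seq 'I_n) (x : 'rV[R]_n), Omega x ->
    {for x, continuous (foldr pderiv f s)} /\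
    forall i : 'I_n, derivable (foldr pderiv f s) x (delta_mx 0 i).

(* A function Omega -> C is represented by its extension by 0 to R^n, so that
   equality of representatives is equality on Omega. *)
Definition Cinf Omega : set ('rV[R]_n -> Rcomplex R) :=
  [set f | smooth_on Omega f /\ forall x, ~ Omega x -> f x = 0].

Definition fsupp f : set 'rV[R]_n := closure [set x | f x != 0].

Definition testfun Omega : set ('rV[R]_n -> Rcomplex R) :=
  [set f | [/\ Cinf Omega f, compact (fsupp f) & fsupp f `<=` Omega]].

End Smooth.

(* Iterated integral over R^n, which is the Lebesgue integral for the
   continuous compactly supported functions integrated below. *)
Fixpoint integral_Rn (R : realType) (n : nat) : ('rV[R]_n -> R) -> R :=
  match n with
  | 0 => fun f => f 0
  | m.+1 => fun f =>
      \int[lebesgue_measure]_t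
        integral_Rn (fun y : 'rV[R]_m => f (row_mx (t%:M : 'rV[R]_1) y))
  end.

Definition cintegral (R : realType) (n : nat) (Omega : set 'rV[R]_n)
    (f : 'rV[R]_n -> Rcomplex R) : Rcomplex R :=
  let f0 := patch (fun=> 0) Omega f in
  (integral_Rn (fun x => complex.Re (f0 x)) +i*
   integral_Rn (fun x => complex.Im (f0 x)))%C.

Section Sdistributions.
Variables (E : nsExtension) (R : realType) (n : nat).
Implicit Types (Omega K : set 'rV[R]_n).
Implicit Types (f g phi : star E ('rV[R]_n -> Rcomplex R)).

Definition nearstd Omega : set (star E 'rV[R]_n) :=
  [set x | sset Omega x /\ exists2 y, Omega y & infclose x (std E y)].

Definition finite_testfun Omega phi : Prop :=
  [/\ sset (testfun Omega) phi,
      forall x, smem x (smap (@fsupp R n) phi) -> nearstd Omega x &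
      forall (alpha : 'I_n -> nat) x, sset Omega x ->
        limited (sapp (smap (mderiv alpha) phi) x)].

Definition spairing Omega f phi : star E (Rcomplex R) :=
  smap (cintegral Omega)
    (smap2 (fun (u v : 'rV[R]_n -> Rcomplex R) x => u x * v x) f phi).

Definition Sdistribution Omega : set (star E ('rV[R]_n -> Rcomplex R)) :=
  [set f | sset (Cinf Omega) f /\
           forall phi, finite_testfun Omega phi -> limited (spairing Omega f phi)].

Definition finite_valued K g : Prop :=
  forall x, sset K x -> limited (sapp g x).

Definition Scontinuous K g : Prop :=
  forall x y, sset K x -> sset K y -> infclose x y ->
    infclose (sapp g x) (sapp g y).

End Sdistributions.

(* Main.v *)
Require Import Defs.
From mathcomp Require Import all_boot all_order all_algebra.
From mathcomp Require Import all_classical all_reals all_analysis.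
From mathcomp Require Import complex ring lra zify.

Set Implicit Arguments.
Unset Strict Implicit.
Unset Printing Implicit Defensive.

Import Order.TTheory GRing.Theory Num.Theory numFieldNormedType.Exports.

Local Open Scope classical_set_scope.
Local Open Scope ring_scope.

(** Both directions combine one spill-over argument with one classical fact
    about smooth functions, transferred.

    If [f] is locally a derivative of S-distributions, let [phi] be a finite
    test function. Its support consists of nearstandard points, so it lies in
    every infinite member of an exhaustion of [Omega] by compact sets, and by
    underspill in a standard member [K] ([finite_testfun_support]). On [K] we
    have [f = d^alpha g], so the pairing of [f] with [phi] equals up to sign
    the pairing of [g] with [d^alpha phi] ([cintegral_by_parts]), which is
    limited because [d^alpha phi] is again a finite test function.

    Conversely, let [f] be an S-distribution and [K] compact. On a compact
    neighbourhood [A] of [K], [f] has a standard order: for some standard [m],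
    [|<f, phi>| <= m] for every internal test function [phi] supported in [A]
    whose derivatives of order at most [m] are bounded by 1. Otherwise
    overspill gives such a [phi] for an infinite [m] with
    [|<f, phi>| > m], although this [phi] is a finite test function
    ([Sdistribution_finite_order]).

    The classical fact is a quantitative structure theorem
    ([bounded_antiderivative], and [local_structure] for complex values): if a
    smooth [f] has order [m] on [A] in this sense and [chi] is a cutoff that is
    1 on [K] and 0 outside [A], then the antiderivative [G] of [chi * f] taken
    [m + 2] times in each variable, starting from the region where [chi]
    vanishes, is bounded and Lipschitz on bounded sets by constants that depend
    on [m], [A] and [chi] but not on [f]. To bound [G] at a point, pair it with
    a narrow bump near that point. The bump is the product over the variables
    of derivatives of smooth steps, and its [m + 2]-fold antiderivative in each
    variable is a product of ramps. Integration by parts turns the pairing into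
    that of [f] with [chi] times this product, and the derivatives of the ramps
    of order at most [m + 1] are bounded independently of the width of the bump
    ([smooth_ramp]). One of these [m + 1] derivatives is spare and serves to
    bound the first partial derivatives of [G] in the same way, hence its
    Lipschitz constant.

    By transfer the internal [f] has such an antiderivative [g] with standard
    constants. It is therefore finite-valued and S-continuous, it is an
    S-distribution because its integral against a bounded function supported in
    a standard compact set is limited, and [d^alpha g = chi * f = f] on [K]. *)

(** * Transfer and spill-over *)
Section Transfer.
Variable E : nsExtension.

Lemma sset_setT (A : Type) (x : star E A) : sset [set: A] x.
Proof.
have -> : [set: A] = ~` (setT `&` ~` setT) by rewrite setTI setCT setC0.
by rewrite sset_setC => /=; rewrite sset_setI sset_setC => -[].
Qed.

Lemma sset_mono (A : Type) (P Q : set A) (x : star E A) :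
  P `<=` Q -> sset P x -> sset Q x.
Proof.
by move=> /setIidl PQ; rewrite -{1}PQ sset_setI => -[].
Qed.

Lemma sset_all (A : Type) (P : set A) (x : star E A) :
  (forall a, P a) -> sset P x.
Proof. by move=> h; apply: (@sset_mono _ setT) => //; exact: sset_setT. Qed.

Lemma sset_and (A : Type) (P Q : set A) (x : star E A) :
  sset P x -> sset Q x -> sset (P `&` Q) x.
Proof. by move=> h1 h2; rewrite sset_setI. Qed.

Lemma ssetN (A : Type) (P : set A) (x : star E A) : sset (~` P) x <-> ~ sset P x.
Proof. by rewrite sset_setC. Qed.

Lemma sset_smap (A B : Type) (f : A -> B) (P : set B) (x : star E A) :
  sset P (smap f x) <-> sset (f @^-1` P) x.
Proof. by rewrite sset_preimage. Qed.

(** The existential step of transfer: direct images under a projection are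
    projections of the extension. *)
Lemma sset_exists (A B : Type) (P : set (A * B)) (x : star E A) :
  sset [set a | exists b, P (a, b)] x <-> exists y, sset P (spair x y).
Proof.
have -> : [set a | exists b, P (a, b)] = fst @` P.
  apply/seteqP; split=> [a [b Pab]|_ [[a b] Pab <-]]; last by exists b.
  by exists (a, b).
rewrite sset_image; split=> [[q Pq <-]|[y Pxy]].
  by exists (smap snd q); rewrite spair_eta.
by exists (spair x y) => //; rewrite smap_fst.
Qed.

Lemma star_unit (x y : star E unit) : x = y.
Proof. by apply/sset_diag; apply: sset_all => -[[] []]. Qed.

Lemma smap_cst (A B : Type) (b : B) (x : star E A) :
  smap (fun=> b) x = std E b.
Proof.
rewrite [LHS](_ : _ = smap ((fun=> b) \o (fun=> tt)) x)// smap_comp.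
by rewrite (star_unit (smap _ x) (std E tt)) smap_std.
Qed.

Lemma spair_smap (A B C : Type) (f : A -> B) (g : A -> C) (x : star E A) :
  spair (smap f x) (smap g x) = smap (fun a => (f a, g a)) x.
Proof.
rewrite -[RHS]spair_eta; congr spair; by rewrite -smap_comp.
Qed.

Lemma spair_smap2 (A B C D : Type) (f : A -> C) (g : B -> D) (x : star E A)
    (y : star E B) :
  spair (smap f x) (smap g y) = smap (fun p => (f p.1, g p.2)) (spair x y).
Proof.
set q := spair x y; rewrite -(spair_smap (fun p => f p.1) (fun p => g p.2)).
by congr spair; rewrite (smap_comp _ fst, smap_comp _ snd) /q ?smap_fst ?smap_snd.
Qed.

Lemma spair_smapr (A B : Type) (f : A -> B) (x : star E A) :
  spair x (smap f x) = smap (fun a => (a, f a)) x.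
Proof. by have := spair_smap id f x; rewrite smap_id. Qed.

Lemma spair_std (A B : Type) (x : star E A) (b : B) :
  spair x (std E b) = smap (fun a => (a, b)) x.
Proof. by rewrite -spair_smapr smap_cst. Qed.

Lemma sset_fst (A B : Type) (P : set A) (x : star E A) (y : star E B) :
  sset [set p : A * B | P p.1] (spair x y) <-> sset P x.
Proof. by rewrite -[in X in _ <-> X](smap_fst x y) sset_smap. Qed.

Lemma sset_snd (A B : Type) (P : set B) (x : star E A) (y : star E B) :
  sset [set p : A * B | P p.2] (spair x y) <-> sset P y.
Proof. by rewrite -[in X in _ <-> X](smap_snd x y) sset_smap. Qed.

(** The universal step of transfer; together with [sset_exists] it moves a
    quantifier over internal objects in and out of [sset]. *)
Lemma sset_forallP (A B : Type) (P : set (A * B)) (x : star E A) :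
  sset [set a | forall b, P (a, b)] x <-> forall y, sset P (spair x y).
Proof.
split=> [h y|h].
  have := (sset_fst _ x y).2 h.
  by apply: sset_mono => -[a b] /=.
apply: contrapT => /ssetN h1.
have [|y /ssetN] := (sset_exists (~` P) x).1; last by apply; exact: h.
by apply: sset_mono h1 => a /existsNP.
Qed.

Lemma sset_set1 (A : Type) (a : A) (x : star E A) : sset [set a] x -> x = std E a.
Proof.
by move=> h; apply/sset_diag; rewrite spair_std sset_smap.
Qed.

(* The remaining rules serve the following way of transferring a statement
   about several internal objects: pack them into one element [w] of the
   extension of a product and write each as an image [smap f w] of [w]. Every
   hypothesis then reads [sset P w], and for a fixed [w] the sets [P] with
   [sset P w] form an ultrafilter, so a pointwise implication suffices. *)
Lemma smap_smap (A B C : Type) (g : B -> C) (f : A -> B) (x : star E A) :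
  smap g (smap f x) = smap (fun a => g (f a)) x.
Proof. by rewrite -smap_comp. Qed.

Lemma smem_smap (A B : Type) (f : A -> B) (S : A -> set B) (w : star E A) :
  smem (smap f w) (smap S w) <-> sset [set a | S a (f a)] w.
Proof. by rewrite /smem spair_smap sset_smap. Qed.

Lemma smap2_smap (A B C D : Type) (h : B -> C -> D) (f : A -> B) (g : A -> C)
    (w : star E A) : smap2 h (smap f w) (smap g w) = smap (fun a => h (f a) (g a)) w.
Proof. by rewrite /smap2 spair_smap smap_smap. Qed.

Lemma sapp_smap (A B C : Type) (F : A -> B -> C) (f : A -> B) (w : star E A) :
  sapp (smap F w) (smap f w) = smap (fun a => F a (f a)) w.
Proof. exact: smap2_smap. Qed.

Lemma sset_eq (A B : Type) (f g : A -> B) (w : star E A) :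
  sset [set a | f a = g a] w <-> smap f w = smap g w.
Proof. by rewrite -(sset_diag (smap f w)) spair_smap sset_smap. Qed.

Lemma sset_imp (A : Type) (P Q : set A) (w : star E A) :
  sset [set a | P a -> Q a] w <-> (sset P w -> sset Q w).
Proof.
split=> [h hP|h]; first by apply: sset_mono (sset_and h hP) => a [].
have [hP|hP] := pselect (sset P w).
  by apply: sset_mono (h hP) => a Qa /= _.
by move/ssetN: hP; apply: sset_mono => a nP /nP.
Qed.

Lemma sset_false (A : Type) (P : set A) (w : star E A) :
  (forall a, ~ P a) -> ~ sset P w.
Proof. by move=> h; apply/ssetN; exact: sset_all. Qed.

Definition infinite (N : star E nat) := forall k, N <> std E k.

Lemma infinite_gt N k : infinite N -> sset [set m | (k < m)%N] N.
Proof.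
move=> Ninf; elim: k => [|k IH].
  apply: contrapT => /ssetN h; apply: (Ninf 0%N); apply: sset_set1.
  by apply: sset_mono h => m /= /negP; case: m.
apply: contrapT => /ssetN h; apply: (Ninf k.+1); apply: sset_set1.
apply: (sset_mono _ (sset_and h IH)) => m /= [/negP]; rewrite -leqNgt => h1 h2.
by apply/eqP; rewrite eqn_leq h1 h2.
Qed.

Lemma infinite_pred N : infinite N -> infinite (smap predn N).
Proof.
move=> Ninf k h; have := infinite_gt k.+1 Ninf.
have : sset [set m | m = k] (smap predn N) by rewrite h; exact/sset_std.
move/sset_smap => h1 h2; have := sset_and h1 h2.
have /ssetN : ~ sset set0 N by rewrite -setCT => /ssetN; apply; exact: sset_setT.
move=> h0 h3; have /ssetN := h0; apply; apply: sset_mono h3 => m /= [? ?]; lia.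
Qed.

(** A property of [k] that holds for all infinite [k] holds for some standard
    [k]: the least [k] with the property exists by transfer, and it cannot be
    infinite because its predecessor would be infinite too. *)
Lemma underspill (A : Type) (P : set (nat * A)) (x : star E A) :
  (forall N, infinite N -> sset P (spair N x)) ->
  exists k, sset [set a | P (k, a)] x.
Proof.
(* [Q (x, k)] is the part of the minimality of [k] that is used below: the
   property fails at the predecessor of [k]. *)
move=> h; pose Q := [set p : A * nat | P (p.2, p.1) /\
   (p.2 = 0%N \/ ~ P (p.2.-1, p.1))].
have swap (N : star E nat) (S : set (nat * A)) :
    sset S (spair N x) <-> sset [set p | S (p.2, p.1)] (spair x N).
  have -> : spair N x = smap (fun p => (p.2, p.1)) (spair x N).
    by rewrite -spair_smap smap_fst smap_snd.
  exact: sset_smap.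
have [|N] := (sset_exists Q x).1; last first.
  have [[k ->]|Ninf] := pselect (exists k, N = std E k).
    rewrite spair_std => /sset_smap /= hk; exists k.
    by apply: sset_mono hk => a [].
  move=> hN; exfalso.
  have {}Ninf : infinite N by move=> k hk; apply: Ninf; exists k.
  have /swap := h _ (infinite_pred Ninf).
  rewrite -{1}[x]smap_id spair_smap2 sset_smap => h1.
  have h2 := (sset_snd _ x N).2 (infinite_gt 0 Ninf).
  have : sset set0 (spair x N).
    apply: sset_mono (sset_and h1 (sset_and h2 hN)) => -[a k] /= [h3 [h4 [h5 [h6|//]]]].
    by rewrite /= in h6; rewrite h6 in h4.
  by rewrite -setCT => /ssetN; apply; exact: sset_setT.
(* Some [k] has the property, namely any infinite one, so a least [k] exists. *)
have [N Ninf] := star_proper E.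
have : sset [set a | exists k, P (k, a)] x.
  by apply/(sset_exists [set p | P (p.2, p.1)]); exists N; apply/swap/h.
apply: sset_mono => a /= exk.
have exk' : exists k, `[< P (k, a) >] by case: exk => k /asboolP; exists k.
have [k /asboolP Pk mink] := ex_minnP exk'.
exists k; split => //=; case: k Pk mink => [|k] Pk mink; [by left|right => /= hP].
by have := mink k; rewrite ltnn => h'; have := h' (asboolT hP).
Qed.

Lemma overspill (A : Type) (P : set (nat * A)) (x : star E A) :
  (forall k, sset [set a | P (k, a)] x) ->
  exists2 N, infinite N & sset P (spair N x).
Proof.
move=> h; apply: contrapT => h1.
have [|k /ssetN] := @underspill _ (~` P) x; last by apply; exact: h.
by move=> N Ninf; apply/ssetN => h2; apply: h1; exists N.
Qed.

End Transfer.

(** * Partial derivatives and smooth functions *)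
Section EpsilonDelta.
Context {R : realType} {V W : normedModType R}.
Implicit Types (f : V -> W).

Lemma is_derive_epsP f x v (l : W) : is_derive x v f l <->
  (forall e, 0 < e -> exists2 d, 0 < d & forall h, h != 0 -> `|h| < d ->
     `|h^-1 *: (f (h *: v + x) - f x) - l| <= e).
Proof.
split=> [[df dl] e e0|H].
  have hl : h^-1 *: (f (h *: v + x) - f x) @[h --> 0^'] --> l by rewrite -dl.
  have /cvgrPdist_le/(_ e e0)/nbhs_ballP[d /= d0 hd] := hl.
  exists d => // h h0 hdd; rewrite distrC; apply: hd => //.
  by rewrite -ball_normE /= sub0r normrN.
have hl : h^-1 *: (f (h *: v + x) - f x) @[h --> 0^'] --> l.
  apply/cvgrPdist_le => e /H[d d0 hd]; near=> h.
  rewrite distrC; apply: hd; first by near: h; exact: nbhs_dnbhs_neq.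
  near: h; apply: dnbhs0_lt; exact: d0.
by apply: DeriveDef; [apply/cvg_ex; exists l|exact: cvg_lim hl].
Unshelve. all: end_near. Qed.

Lemma continuous_epsP f x : {for x, continuous f} <->
  (forall e, 0 < e -> exists2 d, 0 < d & forall y, `|x - y| < d -> `|f x - f y| <= e).
Proof.
split=> [cf e e0|H].
  have /cvgrPdist_le/(_ e e0)/nbhs_ballP[d /= d0 hd] := cf.
  by exists d => // y xy; apply: hd; rewrite -ball_normE.
apply/cvgrPdist_le => e /H[d d0 hd]; near=> y.
by apply: hd; near: y; exact: cvgr_dist_lt.
Unshelve. all: end_near. Qed.

End EpsilonDelta.

Lemma near_continuous (T U : topologicalType) (f g : T -> U) (x : T) :
  (\near x, f x = g x) -> {for x, continuous f} -> {for x, continuous g}.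
Proof.
move=> fg cf; have fgx : f x = g x := nbhs_singleton fg.
change (g @ x --> g x); rewrite -fgx; apply: cvg_trans cf.
exact: near_eq_cvg.
Qed.

Lemma open_near (T : topologicalType) (U : set T) (P : T -> Prop) x :
  open U -> U x -> (forall y, U y -> P y) -> \near x, P x.
Proof. by move=> oU Ux UP; apply: filterS (open_nbhs_nbhs (conj oU Ux)). Qed.

Section PartialDerivatives.
Context {R : realType} {n : nat}.
Local Notation X := 'rV[R]_n.

Section General.
Context {V : normedModType R}.
Implicit Types (f g : X -> V) (U W : set X) (s : seq 'I_n) (x : X).

Definition pd (i : 'I_n) f : X -> V := fun x => 'D_(delta_mx 0 i) f x.

(** Iterated partial derivatives are indexed by words of coordinates, because
    the smoothness predicate below quantifies over such words and induction on
    words is simpler than induction on multi-indices. The shape of [pds] makes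
    [smooth] at complex-valued functions convertible to [smooth_on]. *)
Definition pds s f : X -> V := foldr pd f s.

Definition smooth U f := forall s x, U x ->
  {for x, continuous (pds s f)} /\
  forall i, derivable (pds s f) x (delta_mx 0 i).

Lemma pds_rcons s i f : pds (rcons s i) f = pds s (pd i f).
Proof. by rewrite /pds foldr_rcons. Qed.

Lemma pds_cat s t f : pds (s ++ t) f = pds s (pds t f).
Proof. by rewrite /pds foldr_cat. Qed.

Lemma smooth_pds U f s : smooth U f -> smooth U (pds s f).
Proof. by move=> h t x Ux; rewrite -pds_cat; exact: h. Qed.

Lemma smooth_pd U f i : smooth U f -> smooth U (pd i f).
Proof. exact: (@smooth_pds U f [:: i]). Qed.

Lemma smooth_continuous U f x : smooth U f -> U x -> {for x, continuous f}.
Proof. by move=> h Ux; have [] := h [::] x Ux. Qed.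

Lemma smooth_derivable U f x (i : 'I_n) : smooth U f -> U x ->
  derivable f x (delta_mx 0 i).
Proof. by move=> h Ux; have [_] := h [::] x Ux; apply. Qed.

Lemma smooth_setU U W f : smooth U f -> smooth W f -> smooth (U `|` W) f.
Proof. by move=> h1 h2 s x [Ux|Ux]; [exact: h1|exact: h2]. Qed.

Lemma smoothS U W f : U `<=` W -> smooth W f -> smooth U f.
Proof. by move=> UW h s x Ux; exact: h (UW _ Ux). Qed.

Lemma near_pd f g x i : (\near x, f x = g x) -> pd i f x = pd i g x.
Proof. exact: near_eq_derive. Qed.

Lemma near_pds f g s x : (\near x, f x = g x) -> pds s f x = pds s g x.
Proof.
elim: s x => [|i s IH] x /= fg; first by have := nbhs_singleton fg.
apply: near_pd; apply: filterS (near_join fg) => y; exact: IH.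
Qed.

Lemma eq_smooth U f g : open U -> (forall x, U x -> f x = g x) ->
  smooth U f -> smooth U g.
Proof.
move=> oU fg h s x Ux; have [c d] := h s x Ux.
have e : \near x, pds s f x = pds s g x.
  apply: (open_near oU Ux) => y Uy; apply: near_pds.
  exact: (open_near oU Uy).
split=> [|i]; last exact: near_eq_derivable (d i).
exact: near_continuous c.
Qed.

(** Coinduction: a class of functions stable under partial derivatives, all of
    whose members are continuous and have partial derivatives, consists of
    smooth functions. *)
Lemma smooth_coind U (C : set (X -> V)) : open U ->
  (forall f, C f -> forall x, U x ->
     {for x, continuous f} /\ forall i, derivable f x (delta_mx 0 i)) ->
  (forall f i, C f -> exists2 g, C g & forall x, U x -> pd i f x = g x) ->
  forall f, C f -> smooth U f.
Proof.
move=> oU C1 C2 f Cf s; elim/last_ind: s f Cf => [|s i IH] f Cf x Ux.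
  exact: C1.
rewrite pds_rcons; have [g Cg fg] := C2 _ i Cf.
have gf y : U y -> pds s g y = pds s (pd i f) y.
  move=> Uy; apply: near_pds; apply: (open_near oU Uy) => z Uz.
  by rewrite fg.
have [c d] := IH _ Cg x Ux.
have e := open_near oU Ux gf.
split=> [|j]; last exact: near_eq_derivable (d j).
exact: near_continuous c.
Qed.

Lemma smooth_cst U (a : V) : open U -> smooth U (fun=> a).
Proof.
move=> oU.
apply: (@smooth_coind U [set f | exists a, f = (fun=> a)] oU); last by exists a.
  move=> _ [b ->] x _; split=> [|i]; first exact: (@cst_continuous X V b x).
  exact: derivable_cst.
move=> _ i [b ->]; exists (fun=> 0); first by exists 0.
by move=> x _; rewrite /pd derive_cst.
Qed.

Lemma pd_cst i (a : V) : pd i (fun=> a) = fun=> 0.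
Proof. by apply/funext => x; rewrite /pd derive_cst. Qed.

Lemma pds_cst0 s : pds s (fun=> 0 : V) = fun=> 0.
Proof. by elim: s => //= i s ->; rewrite pd_cst. Qed.

End General.
Arguments smooth_derivable {V U f x} i _ _.

Implicit Types (f g : X -> R) (U W : set X) (x : X).

Section Algebra.
Variables (U : set X) (oU : open U).

Lemma pdD f g i x : smooth U f -> smooth U g -> U x ->
  pd i (fun x => f x + g x) x = pd i f x + pd i g x.
Proof.
move=> sf sg Ux.
have h := deriveD (smooth_derivable i sf Ux) (smooth_derivable i sg Ux).
exact: h.
Qed.

Lemma pdM f g i x : smooth U f -> smooth U g -> U x ->
  pd i (fun x => f x * g x) x = pd i f x * g x + f x * pd i g x.
Proof.
move=> sf sg Ux; rewrite /pd (@deriveM _ _ f g); last 2 first.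
- exact: (smooth_derivable i sf Ux).
- exact: (smooth_derivable i sg Ux).
by rewrite addrC [X in X + _]mulrC.
Qed.

(** Sums of products of smooth functions form a class stable under partial
    derivatives, by the Leibniz rule, so that [smooth_coind] applies to it. *)
Inductive polynomial_in_smooth : (X -> R) -> Prop :=
| PolMul f g : smooth U f -> smooth U g ->
    polynomial_in_smooth (fun x => f x * g x)
| PolAdd f g : polynomial_in_smooth f -> polynomial_in_smooth g ->
    polynomial_in_smooth (fun x => f x + g x).

Lemma smooth_polynomial f : polynomial_in_smooth f -> smooth U f.
Proof.
have C1 : forall f, polynomial_in_smooth f -> forall x, U x ->
     {for x, continuous f} /\ forall i, derivable f x (delta_mx 0 i).
  move=> {}f; elim=> {f} [f g sf sg x Ux|f g _ IHf _ IHg x Ux].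
    split=> [|i].
      exact: continuousM (smooth_continuous sf Ux) (smooth_continuous sg Ux).
    exact: (derivableM (smooth_derivable i sf Ux) (smooth_derivable i sg Ux)).
  have [[cf df] [cg dg]] := (IHf x Ux, IHg x Ux).
  split=> [|i]; first exact: continuousD.
  exact: (derivableD (df i) (dg i)).
apply: (smooth_coind oU C1) => {}f i pf.
elim: pf => {f} [f g sf sg|f g pf [f' pf' ff'] pg [g' pg' gg']].
  exists (fun x => pd i f x * g x + f x * pd i g x).
    exact: (PolAdd (PolMul (smooth_pd i sf) sg) (PolMul sf (smooth_pd i sg))).
  by move=> x Ux; rewrite (pdM i sf sg Ux).
exists (fun x => f' x + g' x); first exact: (PolAdd pf' pg').
move=> x Ux; rewrite -ff'// -gg'//.
have [[_ df] [_ dg]] := (C1 _ pf x Ux, C1 _ pg x Ux).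
have h := deriveD (df i) (dg i); exact: h.
Qed.

Lemma smoothM f g : smooth U f -> smooth U g -> smooth U (fun x => f x * g x).
Proof. by move=> sf sg; exact: (smooth_polynomial (PolMul sf sg)). Qed.

Lemma smoothD f g : smooth U f -> smooth U g -> smooth U (fun x => f x + g x).
Proof.
move=> sf sg.
have -> : (fun x => f x + g x) = (fun x => f x * 1 + g x * 1).
  by apply/funext => x; rewrite !mulr1.
have s1 := smooth_cst (1 : R) oU.
exact: (smooth_polynomial (PolAdd (PolMul sf s1) (PolMul sg s1))).
Qed.

Lemma smoothZ (a : R) f : smooth U f -> smooth U (fun x => a * f x).
Proof. by move=> sf; exact: (smoothM (smooth_cst a oU) sf). Qed.

Lemma smoothB f g : smooth U f -> smooth U g -> smooth U (fun x => f x - g x).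
Proof.
move=> sf sg.
have -> : (fun x => f x - g x) = (fun x => f x + (-1) * g x).
  by apply/funext => x; rewrite mulN1r.
exact: (smoothD sf (smoothZ (-1) sg)).
Qed.

Lemma pds_eq f g s x : (forall x, U x -> f x = g x) -> U x -> pds s f x = pds s g x.
Proof. by move=> fg Ux; apply: near_pds; exact: (open_near oU Ux). Qed.

Lemma pdsD f g s x : smooth U f -> smooth U g -> U x ->
  pds s (fun x => f x + g x) x = pds s f x + pds s g x.
Proof.
elim/last_ind: s f g => //= s i IH f g sf sg Ux.
rewrite !pds_rcons -(IH _ _ (smooth_pd i sf) (smooth_pd i sg) Ux).
by apply: pds_eq => // y Uy; rewrite (pdD i sf sg Uy).
Qed.

Lemma pdZ f (a : R) i x : smooth U f -> U x ->
  pd i (fun x => a * f x) x = a * pd i f x.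
Proof.
by move=> sf Ux; rewrite (pdM i (smooth_cst a oU) sf Ux) pd_cst mul0r add0r.
Qed.

Lemma pdsZ f (a : R) s x : smooth U f -> U x ->
  pds s (fun x => a * f x) x = a * pds s f x.
Proof.
elim/last_ind: s f => //= s i IH f sf Ux.
rewrite !pds_rcons -(IH _ (smooth_pd i sf) Ux).
by apply: pds_eq => // y Uy; rewrite (pdZ _ i sf Uy).
Qed.

End Algebra.
End PartialDerivatives.
Arguments smooth_derivable {R n V U f x} i _ _.

(** * Smooth functions of one variable *)
Section OneVariable.
Context {R : realType}.
Implicit Types (F G : nat -> R -> R) (p q : {poly R}).

(** A smooth function of one variable is handled together with the sequence of
    its derivatives, so that formulas for the derivatives are data and no
    iterated differentiation operator has to be computed. *)
Definition tower F := forall k (t : R), is_derive t 1 (F k) (F k.+1 t).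

Lemma tower_continuous F k : tower F -> continuous (F k).
Proof.
move=> tF t; apply/differentiable_continuous/derivable1_diffP.
by have [] := tF k t.
Qed.

(** The derivatives of a product, by the Leibniz rule applied recursively and
    without binomial coefficients. *)
Fixpoint tower_mul F G k : R -> R :=
  if k is k'.+1 then
    fun t => tower_mul (fun j => F j.+1) G k' t + tower_mul F (fun j => G j.+1) k' t
  else fun t => F 0%N t * G 0%N t.

Lemma towerM F G : tower F -> tower G -> tower (tower_mul F G).
Proof.
move=> tF tG k; elim: k F G tF tG => [|k IH] F G tF tG t.
  have h1 := tF 0%N t; have h2 := tG 0%N t.
  apply: (@is_derive_eq _ _ _ (F 0%N * G 0%N)).
  by rewrite /= addrC; congr (_ + _); rewrite mulrC.
have h1 := IH (fun j => F j.+1) G (fun j => tF j.+1) tG t.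
have h2 := IH F (fun j => G j.+1) tF (fun j => tG j.+1) t.
exact: (@is_deriveD _ _ _ _ _ t 1 _ _ h1 h2).
Qed.

Lemma tower_affine F a b : tower F ->
  tower (fun k t => a ^+ k * F k (a * t + b)).
Proof.
move=> tF k t.
have h1 : is_derive t (1 : R) (fun t => a * t + b) a.
  apply: (@is_derive_eq _ _ _ (a \*: (id : R -> R) + cst b)).
  by rewrite addr0 [LHS]mulr1.
have h2 := tF k (a * t + b).
have h3 := @is_derive1_comp _ (F k) (fun t => a * t + b) t _ _ h2 h1.
apply: (@is_derive_eq _ _ _ (a ^+ k \*: (F k \o (fun t => a * t + b)))).
by rewrite exprSr -mulrA; congr (_ * _); rewrite mulrC.
Qed.

(** The functions [p (1 / t) * exp (- 1 / t)] for [t > 0], extended by 0: a class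
    closed under differentiation that contains the standard flat function. *)
Definition pexp p (t : R) : R := if 0 < t then p.[t^-1] * expR (- t^-1) else 0.

(** Bound [exp (- s)], at [s = 1 / t], by a multiple of [s] to the power
    [- (size p + 1)], whereas [p.[s]] grows at most like [s] to the power
    [size p]; the quotient leaves a factor [t], which gives continuity at 0. *)
Lemma pexp_le p : exists C : R, forall t, `|t| <= 1 -> `|pexp p t| <= C * `|t|.
Proof.
set N := size p.
pose C := (\sum_(i < N) `|p`_i|) * (N.+1)`!%:R : R.
have C0 : 0 <= C by apply: mulr_ge0 => //; exact: sumr_ge0.
exists C => t t1; rewrite /pexp; case: ifPn => t0; last first.
  by rewrite normr0; apply: mulr_ge0.
rewrite (gtr0_norm t0) in t1 *.
set s := t^-1; have s0 : 0 < s by rewrite invr_gt0.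
have s1 : 1 <= s by rewrite invf_ge1.
rewrite normrM (gtr0_norm (expR_gt0 _)) expRN.
have hp : `|p.[s]| <= (\sum_(i < N) `|p`_i|) * s ^+ N.
  rewrite horner_coef mulr_suml; apply: le_trans (ler_norm_sum _ _ _) _.
  apply: ler_sum => i _; rewrite normrM; apply: ler_wpM2l => //.
  by rewrite ger0_norm ?exprn_ge0 ?(ltW s0)//; apply: ler_weXn2l => //; exact: ltnW.
have he : s ^+ N.+1 / (N.+1)`!%:R <= expR s.
  by apply: le_trans (expR_ge1Dxn N (ltW s0)); rewrite lerDr.
have f0 : 0 < (N.+1)`!%:R :> R by rewrite ltr0n fact_gt0.
have hi : (expR s)^-1 <= (s ^+ N.+1 / (N.+1)`!%:R)^-1.
  by rewrite lef_pV2 ?posrE ?expR_gt0// divr_gt0// exprn_gt0.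
have i0 : 0 <= (expR s)^-1 by rewrite invr_ge0 expR_ge0.
apply: le_trans (ler_pM (normr_ge0 _) i0 hp hi) _.
rewrite le_eqVlt; apply/orP; left; apply/eqP.
have -> : t = s^-1 by rewrite invrK.
rewrite /C exprS; field.
by rewrite expf_neq0 ?gt_eqF.
Qed.

(** From [d/dt (p (1/t) exp (- 1/t)) = (1/t)^2 (p - p') (1/t) exp (- 1/t)]. *)
Definition pexp_step p : {poly R} := 'X^2 * (p - p^`()).

Lemma pexp_derive p (t : R) : is_derive t 1 (pexp p) (pexp (pexp_step p) t).
Proof.
have [t0|t0|->] := ltgtP t 0.
- have e : \near t, (cst 0 : R -> R) t = pexp p t.
    near=> y; rewrite /pexp ifN// -leNgt; near: y; exact: lt_le_nbhsl.
  have -> : pexp (pexp_step p) t = 0 by rewrite /pexp lt_gtF.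
  exact: (near_eq_is_derive e (is_derive_cst (0 : R) t 1)).
- have tn0 : t != 0 by rewrite gt_eqF.
  have h1 : is_derive t (1 : R) (fun x => x^-1) (- t ^- 2 * 1).
    exact: (@is_deriveV R id t 1 1 tn0 (is_derive_id _ _)).
  have h2 : is_derive t (1 : R) (fun x => - x^-1) (- (- t ^- 2 * 1)).
    exact: is_deriveN.
  have h3 := @is_derive1_comp _ (horner p) (fun x => x^-1) t _ _ (is_derive_poly p _) h1.
  have h4 := @is_derive1_comp _ expR (fun x => - x^-1) t _ _ (is_derive_expR _) h2.
  have h5 := is_deriveM h3 h4.
  have e : \near t, (((horner p) \o (fun x => x^-1)) *
     (expR \o (fun x => - x^-1)) : R -> R) t = pexp p t.
    by near=> y; rewrite /pexp ifT//; near: y; exact: lt_nbhsr.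
  apply: (is_derive_eq (near_eq_is_derive e h5)).
  rewrite /pexp t0 /pexp_step !hornerE /= /GRing.scale /= exprVn; ring.
(* At 0 the difference quotient of [pexp p] is [pexp ('X * p)], which tends
   to 0. *)
- rewrite {2}/pexp ltxx; apply/is_derive1_caratheodory.
  exists (pexp ('X * p)); split.
  + move=> z; rewrite {2}/pexp ltxx !subr0 /pexp; case: ifPn => z0; last by rewrite mul0r.
    by rewrite hornerM hornerX [RHS]mulrC !mulrA divff ?gt_eqF// mul1r.
  + have [C hC] := pexp_le ('X * p).
    have e0 : pexp ('X * p) 0 = 0 by rewrite /pexp ltxx.
    change (pexp ('X * p) @ (0 : R) --> pexp ('X * p) 0); rewrite e0.
    apply: norm_cvg0.
    apply: (@squeeze_cvgr _ _ _ _ (cst 0) (fun t => C * `|t|)).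
    * apply: filterS (@nbhsx_ballx _ R 0 1 ltr01) => y.
      by rewrite /ball /= sub0r normrN => /ltW y1; rewrite normr_ge0 /= hC.
    * exact: cvg_cst.
    * have : C * `|t| @[t --> (0 : R)] --> C * `|0 : R|.
        by apply: cvgM; [exact: cvg_cst | apply: cvg_norm; exact: cvg_id].
      by rewrite normr0 mulr0.
  + by rewrite /pexp ltxx.
Unshelve. all: end_near. Qed.

Lemma tower_pexp : tower (fun k => pexp (iter k pexp_step 1)).
Proof. by move=> k t; exact: pexp_derive. Qed.

End OneVariable.

(** * Primitives, smooth steps and ramps *)
Section Primitive.
Context {R : realType}.
Implicit Types (F G : nat -> R -> R) (f : R -> R).
Local Notation mu := (@lebesgue_measure R).

Lemma continuous_segment_integrable f (a b : R) : continuous f ->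
  mu.-integrable `[a, b] (EFin \o f).
Proof.
move=> cf; apply: continuous_compact_integrable; first exact: segment_compact.
exact: continuous_subspaceT.
Qed.

Lemma eq0_Rintegral (A : set R) f : (forall t, A t -> f t = 0) ->
  \int[mu]_(t in A) f t = 0.
Proof.
move=> f0; rewrite (@eq_Rintegral _ _ _ mu A (cst 0)) => [|t /set_mem/f0//].
by rewrite /Rintegral integral0.
Qed.

(** For functions that vanish on the negative half-line this is the primitive
    that vanishes there. The base point is [-1] rather than 0 so that 0 is
    interior to the interval of integration, where the fundamental theorem
    applies. *)
Definition prim f (u : R) := \int[mu]_(t in `[-1, u]) f t.

Section Prim.
Variables (f : R -> R) (cf : continuous f) (f0 : forall u : R, u <= 0 -> f u = 0).

Lemma prim0 (u : R) : u <= 0 -> prim f u = 0.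
Proof.
move=> u0; apply: eq0_Rintegral => t /=; rewrite in_itv/= => /andP[_ tu].
by apply: f0; exact: le_trans u0.
Qed.

Lemma prim_derive (u : R) : is_derive u 1 (prim f) (f u).
Proof.
have [u0|u0] := ltP u 0.
  have e : \near u, (cst 0 : R -> R) u = prim f u.
    by near=> y; rewrite prim0//; near: y; exact: lt_le_nbhsl.
  have -> : f u = 0 by rewrite f0 ?ltW.
  exact: (near_eq_is_derive e (is_derive_cst (0 : R) u 1)).
have uu : u < u + 1 by rewrite ltrDl.
have u1 : -1 < u by apply: lt_le_trans u0; rewrite ltrN10.
have cu : {for u, continuous f} by exact: cf.
have [d e] := continuous_FTC1_closed uu (continuous_segment_integrable _ _ cf) u1 cu.
have d' : derivable (prim f) u 1 := d.
apply: (DeriveDef d'); rewrite -derive1E; exact: e.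
Unshelve. all: end_near. Qed.

Lemma prim_bounds (D B u : R) : 0 <= D -> 0 <= B -> u <= D ->
  (forall t, t <= D -> 0 <= f t <= B) -> 0 <= prim f u <= B * (D + 1).
Proof.
move=> D0 B0 uD fB; have fge t : t <= u -> 0 <= f t <= B.
  by move=> tu; apply: fB; exact: le_trans uD.
rewrite Rintegral_ge0/=; last first.
  by move=> t; rewrite /= in_itv/= => /andP[_ /fge/andP[]].
have [u1|u1] := ltP u (-1).
  by rewrite prim0 ?mulr_ge0 ?addr_ge0// (ltW (lt_trans u1 _))// ltrN10.
have mm : measurable (`[-1, u] : set R) by exact: measurable_itv.
have ic : mu.-integrable `[-1, u] (EFin \o cst B).
  by apply: continuous_segment_integrable => t; exact: cvg_cst.
have h : prim f u <= \int[mu]_(t in `[-1, u]) B.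
  apply: (@le_Rintegral _ _ _ mu _ f (cst B)) => //; first exact: continuous_segment_integrable.
  by move=> t; rewrite /= in_itv/= => /andP[_ /fge/andP[]].
apply: (le_trans h); rewrite Rintegral_cst// [X in fine X]lebesgue_measure_itv/= lte_fin.
apply: ler_wpM2l => //; case: ifPn => _ /=; last by rewrite addr_ge0.
by rewrite opprK lerD2r.
Qed.

Lemma prim_le (u v : R) : (forall t, 0 <= f t) -> u <= v -> prim f u <= prim f v.
Proof.
move=> fge uv.
have [u1|u1] := leP u (-1).
  by rewrite prim0 ?Rintegral_ge0// (le_trans u1)// lerN10.
rewrite -subr_ge0 /prim Rintegral_itvB ?Rintegral_ge0//.
- exact: continuous_segment_integrable.
- by rewrite bnd_simp ltW.
Qed.

Lemma prim_const (u v : R) : (forall t, u <= t -> f t = 0) -> u <= v ->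
  prim f v = prim f u.
Proof.
move=> fge uv; apply/eqP; rewrite -subr_eq0.
have [u1|u1] := leP u (-1).
  have z t : f t = 0.
    by have [/f0//|t0] := leP t 0; apply: fge; rewrite (le_trans u1)// (le_trans _ (ltW t0))// lerN10.
  by rewrite /prim !eq0_Rintegral// subrr.
rewrite /prim Rintegral_itvB ?eq0_Rintegral//.
- by move=> t /=; rewrite in_itv /= => /andP[/ltW ut _]; exact: fge.
- exact: continuous_segment_integrable.
- by rewrite bnd_simp ltW.
Qed.

End Prim.

Lemma tower_prim F : tower F -> (forall u : R, u <= 0 -> F 0%N u = 0) ->
  tower (fun k => if k is k'.+1 then F k' else prim (F 0%N)).
Proof.
move=> tF F0 [|k] t; last exact: tF.
exact: (prim_derive (@tower_continuous _ _ 0%N tF) F0 t).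
Qed.

Lemma tower_locally_const F k (U : set R) (c : R) : tower F -> open U ->
  (forall t, U t -> F k t = c) -> forall t, U t -> F k.+1 t = 0.
Proof.
move=> tF oU Fc t Ut; have [_ <-] := tF k t.
have e : \near t, F k t = (cst c : R -> R) t := open_near oU Ut Fc.
by rewrite (near_eq_derive (1 : R) e) derive_cst.
Qed.

(** The normalised primitive of the bump [exp (- 1 / t) * exp (- 1 / (1 - t))]
    on the unit interval. *)
Lemma smooth_step : exists S : nat -> R -> R,
  [/\ tower S, forall u : R, u <= 0 -> S 0%N u = 0, forall u, 1 <= u -> S 0%N u = 1,
      forall u, 0 <= S 0%N u <= 1 & forall u, 0 <= S 1%N u].
Proof.
pose e := fun k => pexp (iter k (@pexp_step R) 1).
have te : tower e := tower_pexp.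
have te' : tower (fun k t => (-1) ^+ k * e k (-1 * t + 1)) by exact: tower_affine.
pose b := tower_mul e (fun k t => (-1) ^+ k * e k (-1 * t + 1)).
have tb : tower b by exact: towerM.
have bE t : b 0%N t = pexp 1 t * pexp 1 (1 - t).
  by rewrite /b /= expr0 mul1r mulN1r addrC.
have pe0 t : 0 <= pexp 1 t :> R.
  by rewrite /pexp; case: ifP => // _; rewrite hornerC mul1r expR_ge0.
have b0 t : 0 <= b 0%N t by rewrite bE mulr_ge0.
have bl t : t <= 0 -> b 0%N t = 0.
  by move=> t0; rewrite bE {1}/pexp ltNge t0 mul0r.
have br t : 1 <= t -> b 0%N t = 0.
  by move=> t0; rewrite bE {2}/pexp subr_gt0 ltNge t0 mulr0.
have cb := @tower_continuous _ _ 0%N tb.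
(* If the integral were 0, the primitive would be constant on the unit interval
   and its derivative, the bump, would vanish at 1/2. *)
have c0 : 0 < prim (b 0%N) 1.
  rewrite lt_neqAle [X in _ && X]Rintegral_ge0// andbT eq_sym.
  apply/eqP => c0.
  have z t : `]0, 1[%classic t -> prim (b 0%N) t = 0.
    rewrite /= in_itv/= => /andP[t0 t1]; apply/eqP; rewrite eq_le Rintegral_ge0// andbT.
    by rewrite -[leRHS]c0 prim_le// ltW.
  have h : `]0, 1[%classic (2^-1 : R).
    by rewrite /= in_itv/= invr_gt0 ltr0n invf_lt1 ?ltr1n.
  have := tower_locally_const (k := 0%N) (tower_prim tb bl) (itv_open (0 : R) 1) z h.
  rewrite /= bE => /eqP; rewrite mulf_eq0 /pexp.
  have -> : 1 - 2^-1 = 2^-1 :> R by field.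
  by rewrite !invr_gt0 !ltr0n !hornerC !mul1r orbb gt_eqF// expR_gt0.
pose P k : R -> R := if k is k'.+1 then b k' else prim (b 0%N).
have tP : tower P by exact: tower_prim.
pose c := prim (b 0%N) 1.
exists (fun k t => c^-1 * P k t); split.
- move=> k t; have h := tP k t.
  exact: (@is_deriveZ _ _ _ _ c^-1 t 1 _ h).
- by move=> u u0; rewrite /= prim0// mulr0.
- by move=> u u1; rewrite /= (prim_const cb bl br)// mulVf// gt_eqF.
- move=> u; rewrite /= mulr_ge0 ?invr_ge0 ?(ltW c0) ?Rintegral_ge0//=.
  rewrite mulrC ler_pdivrMr// mul1r.
  by have [u1|/ltW u1] := leP u 1; [exact: prim_le|rewrite (prim_const cb bl br u1)].
- by move=> u; apply: mulr_ge0 (b0 u); rewrite invr_ge0; exact: ltW c0.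
Qed.

(** The [k]-fold primitive of a step of width [e]. As [e] goes to 0 the
    derivative of order [k + 1] becomes a Dirac mass, whereas those of order at
    most [k] stay below the constant [B], which is chosen before [e]: each
    primitive multiplies the bound by the length of the interval. *)
Lemma smooth_ramp k (D : R) : 0 <= D -> exists2 B : R, 0 <= B &
  forall e, 0 < e -> exists F, [/\ tower F,
    forall j u, (j <= k)%N -> u <= 0 -> F j u = 0,
    forall j u, (j <= k)%N -> u <= D -> 0 <= F j u <= B,
    forall u, e <= u -> F k u = 1 & forall u, 0 <= F k.+1 u].
Proof.
move=> D0; elim: k => [|k [B B0 IH]].
  exists 1 => // e e0; have [S [tS S0 S1 Sb S']] := smooth_step.
  exists (fun k t => e^-1 ^+ k * S k (e^-1 * t + 0)); split.
  - exact: tower_affine.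
  - move=> [|//] u _ u0; rewrite expr0 mul1r addr0 S0//.
    by rewrite mulr_ge0_le0// invr_ge0 ltW.
  - by move=> [|//] u _ uD; rewrite expr0 mul1r.
  - move=> u eu; rewrite expr0 mul1r addr0 S1// mulrC ler_pdivlMr// mul1r//.
  - by move=> u; rewrite mulr_ge0 ?exprn_ge0 ?invr_ge0// ltW.
exists (B * (D + 1)); first by rewrite mulr_ge0// addr_ge0.
move=> e /IH[F [tF F0 FB F1 F']].
have F00 u : u <= 0 -> F 0%N u = 0 by exact: F0.
exists (fun j => if j is j'.+1 then F j' else prim (F 0%N)); split => //.
- exact: tower_prim.
- by move=> [|j] u jk u0; [exact: prim0|exact: F0].
- move=> [|j] u jk uD.
    apply: prim_bounds => //; first exact: (@tower_continuous _ _ 0%N tF).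
    by move=> t tD; exact: FB.
  have /andP[-> /le_trans->//] := FB _ _ jk uD.
  by rewrite ler_peMr// lerDr.
Qed.

End Primitive.

(** * Functions on row vectors *)
Section RowVectors.
Context {R : realType} {n : nat}.
Local Notation X := 'rV[R]_n.
Implicit Types (x y v : X) (u w : X -> R) (M : R).

Lemma coord_le_norm x i : `|x 0 i| <= `|x|.
Proof.
rewrite [leRHS](_ : _ = mx_norm x)// mx_normrE.
exact: (@le_bigmax _ _ _ _ (fun i : 'I_1 * 'I_n => `|x i.1 i.2|) (0, i)).
Qed.

Lemma norm_le_coord x M : 0 <= M -> (forall i, `|x 0 i| <= M) -> `|x| <= M.
Proof.
move=> M0 h; rewrite [leLHS](_ : _ = mx_norm x)// mx_normrE.
apply: bigmax_le => // -[i j] _ /=.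
by rewrite ord1.
Qed.

Lemma norm_delta_mx i : `|delta_mx 0 i : X| <= 1.
Proof.
apply: norm_le_coord => // j; rewrite mxE eqxx /=.
by case: (j == i); rewrite ?normr1 ?normr0.
Qed.

Definition box M : set X := [set x | forall i, `|x 0 i| <= M].

Lemma compact_box M : compact (box M).
Proof.
have := @rV_compact R n (fun=> `[- M, M]%classic) (fun=> @segment_compact R _ _).
by congr compact; apply/seteqP; split=> x h i; have := h i; rewrite /= in_itv/= ler_norml.
Qed.

Lemma box_norm x M : `|x| <= M -> box M x.
Proof. by move=> xM i; apply: le_trans xM; exact: coord_le_norm. Qed.

(** Uniform continuity on a compact set where only one of the two points has to
    lie in the set. *)
Lemma compact_uniform_continuous (A : set X) w : compact A -> continuous w ->
  forall e, 0 < e -> exists2 d, 0 < d &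
    forall x y, A x -> `|x - y| < d -> `|w x - w y| < e.
Proof.
move=> /compact_near_coveringP cA cw e e0.
pose P (d : R) x := forall y, `|x - y| < d -> `|w x - w y| < e.
have [] := cA R (0^'+) P _.
  move=> x Ax.
  have e2 : 0 < e / 2 by rewrite divr_gt0.
  have /cvgrPdist_lt/(_ _ e2)/nbhs_ballP[r /= r0 hr] := cw x.
  exists (ball x (r / 2), [set d | 0 < d < r / 2]); first split => /=.
  - by apply: nbhsx_ballx; rewrite divr_gt0.
  - near=> d; apply/andP; split => //; near: d; apply: nbhs_right_lt; exact: divr_gt0.
  move=> [z d] [/= xz /andP[d0 dr]] y zy.
  have xy : ball x r y.
    rewrite -ball_normE /= (_ : x - y = (x - z) + (z - y)); last by rewrite addrA subrK.
    apply: le_lt_trans (ler_normD _ _) _; rewrite (splitr r) ltrD//; last exact: lt_trans dr.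
    by move: xz; rewrite -ball_normE.
  have xz' : ball x r z.
    by apply: le_ball xz; lra.
  have h1 := hr _ xy; have h2 := hr _ xz'.
  rewrite (_ : w z - w y = (w x - w y) - (w x - w z)); last by ring.
  by apply: le_lt_trans (ler_normB _ _) _; rewrite (splitr e) ltrD.
move=> d /= d0 hd.
have d2 : 0 < d / 2 by rewrite divr_gt0.
exists (d / 2) => // x y Ax; apply: (hd (d / 2)) => //=.
by rewrite sub0r normrN gtr0_norm//; lra.
Unshelve. all: end_near. Qed.

(** Directional derivatives are derivatives of restrictions to lines, which
    makes one-variable calculus available. *)
Lemma line_is_derive u v x (t df : R) :
  is_derive (t *: v + x) v u df <-> is_derive t 1 (fun h => u (h *: v + x)) df.
Proof.
have E : (fun h => h^-1 *: (u (h *: v + (t *: v + x)) - u (t *: v + x))) =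
    (fun h : R => h^-1 *: ((fun h => u (h *: v + x)) (h *: (1 : R) + t) -
                       (fun h => u (h *: v + x)) t)).
  by apply/funext => h /=; rewrite addrA -scalerDl [h *: 1]mulr1.
have dE : derivable u (t *: v + x) v =
    derivable (fun h : R => u (h *: v + x)) t 1 by rewrite /derivable E.
have DE : 'D_v u (t *: v + x) = 'D_1 (fun h : R => u (h *: v + x)) t.
  by rewrite /derive E.
split=> -[d1 d2].
  by rewrite dE in d1; rewrite DE in d2; exact: (DeriveDef d1 d2).
by rewrite -dE in d1; rewrite -DE in d2; exact: (DeriveDef d1 d2).
Qed.

Lemma line_is_derive0 u v x (df : R) :
  is_derive x v u df <-> is_derive (0 : R) 1 (fun h => u (h *: v + x)) df.
Proof. by rewrite -line_is_derive scale0r add0r. Qed.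

Lemma line_MVT u w v x (s : R) : (forall x, is_derive x v u (w x)) ->
  exists2 c, `|c| <= `|s| & u (s *: v + x) - u x = s * w (c *: v + x).
Proof.
move=> uw; have dl t := (line_is_derive u v x t _).1 (uw _).
have cl : continuous (fun h : R => u (h *: v + x)).
  by move=> t; apply/differentiable_continuous/derivable1_diffP; have [] := dl t.
have [s0|s0] := leP 0 s.
  have [c] := MVT_segment s0 (fun t _ => dl t) (continuous_subspaceT cl).
  rewrite in_itv/= scale0r add0r subr0 => /andP[c0 cs] ->.
  by exists c; rewrite ?ger0_norm// mulrC.
have [c] := MVT_segment (ltW s0) (fun t _ => dl t) (continuous_subspaceT cl).
rewrite in_itv/= scale0r add0r sub0r => /andP[cs c0] e.
exists c; first by rewrite (ler0_norm c0) (ltr0_norm s0) lerN2.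
by apply: oppr_inj; rewrite opprB e mulrN mulrC.
Qed.

(** Difference quotients converge uniformly on compact sets, by the mean value
    theorem and uniform continuity of the derivative; this is what allows
    differentiation under the integral sign below. *)
Lemma compact_uniform_derive (A : set X) u w v : compact A -> continuous w ->
  (forall x, is_derive x v u (w x)) ->
  forall e, 0 < e -> exists2 d, 0 < d & forall s x, s != 0 -> `|s| < d -> A x ->
    `|s^-1 * (u (s *: v + x) - u x) - w x| <= e.
Proof.
move=> cA cw uw e e0.
have [d d0 hd] := compact_uniform_continuous cA cw e0.
have v0 : 0 < `|v| + 1 by rewrite ltr_wpDl.
exists (d / (`|v| + 1)); first by rewrite divr_gt0.
move=> s x s0 sd Ax; have [c cs ->] := line_MVT x s uw.
rewrite mulrA mulVf// mul1r distrC ltW// hd//.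
rewrite opprD addrCA subrr addr0 normrN normrZ.
move: sd; rewrite ltr_pdivlMr//; apply: le_lt_trans.
by rewrite ler_pM// lerDl.
Qed.

Lemma compact_bound (A : set X) w : compact A -> continuous w ->
  exists2 B : R, 0 <= B & forall x, A x -> `|w x| <= B.
Proof.
move=> cA cw; have [d d0 hd] := compact_uniform_continuous cA cw ltr01.
have /compact_bounded[B [_ hB]] : compact (w @` A).
  by apply: continuous_compact => //; exact: continuous_subspaceT.
exists (`|B| + 1); first by rewrite addr_ge0.
by move=> x Ax; apply: hB; [rewrite (le_lt_trans (ler_norm B))// ltrDl|exists x].
Qed.

Lemma coord_continuous_rV i : continuous (fun x : X => x 0 i).
Proof. exact: coord_continuous. Qed.

Section Tensor.
Variables (F : 'I_n -> nat -> R -> R) (tF : forall i, tower (F i)).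

(** Products of functions of one coordinate each. Indexing by the orders [k] of
    differentiation makes the family closed under partial derivatives. *)
Definition tensor (k : 'I_n -> nat) : X -> R :=
  fun x => \prod_i F i (k i) (x 0 i).

Lemma tensor_is_derive k j x :
  is_derive x (delta_mx 0 j) (tensor k) (tensor (fun i => k i + (i == j))%N x).
Proof.
apply/line_is_derive0.
pose c := \prod_(i | i != j) F i (k i) (x 0 i).
pose f (t : R) := F j (k j) (t + x 0 j).
have h : is_derive (0 : R) 1 f (F j (k j).+1 (x 0 j)).
  have h1 := @tower_affine _ _ 1 (x 0 j) (tF j) (k j) 0.
  rewrite !expr1n mulr0 add0r mul1r in h1.
  by rewrite [f](_ : _ = fun t => 1 * F j (k j) (1 * t + x 0 j))//; apply/funext => t; rewrite !mul1r.
have cE i : i != j -> (k i + (i == j))%N = k i by move=> /negPf ->; rewrite addn0.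
have -> : tensor (fun i => (k i + (i == j))%N) x = c *: F j (k j).+1 (x 0 j).
  rewrite /tensor (bigD1 j)//= eqxx addn1 mulrC; congr (_ * _).
  by apply: eq_bigr => i /cE ->.
have -> : (fun t : R => tensor k (t *: delta_mx 0 j + x)) = c \*: f.
  apply/funext => t; rewrite /tensor (bigD1 j)//= !mxE !eqxx mulr1 mulrC.
  congr (_ * _); apply: eq_bigr => i ij.
  by rewrite !mxE eqxx (negPf ij) mulr0 add0r.
exact: is_deriveZ.
Qed.

Lemma tensor_continuous k : continuous (tensor k).
Proof.
rewrite /tensor; elim: (index_enum _) => [|i r IH] x.
  by under eq_fun do rewrite big_nil; exact: cst_continuous.
under eq_fun do rewrite big_cons.
apply: continuousM; last exact: IH.
apply: (@continuous_comp _ _ _ (fun x : X => x 0 i) (F i (k i))).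
  exact: coord_continuous_rV.
exact: tower_continuous.
Qed.

Lemma pd_tensor k j : pd j (tensor k) = tensor (fun i => k i + (i == j))%N.
Proof. by apply/funext => x; have [_] := tensor_is_derive k j x. Qed.

Lemma smooth_tensor k : smooth setT (tensor k).
Proof.
apply: (@smooth_coind _ _ _ setT [set f | exists k, f = tensor k]); last by exists k.
- exact: openT.
- move=> _ [l ->] x _; split=> [|i]; first exact: tensor_continuous.
  by have [] := tensor_is_derive l i x.
- move=> _ i [l ->]; exists (tensor (fun j => l j + (j == i))%N); first by eexists.
  by move=> x _; rewrite pd_tensor.
Qed.

End Tensor.
End RowVectors.

(** * Integrals of continuous compactly supported functions *)

(** In this form linearity of the integral rewrites the difference quotient of
    an integral as an integral. *)
Lemma is_derive_eps (R : realType) (V : normedModType R) (f : V -> R) (x v : V)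
    (l : R) :
  (forall e, 0 < e -> exists2 d, 0 < d & forall h, h != 0 -> `|h| < d ->
     `|h^-1 * (f (h *: v + x) - f x) - l| <= e) -> is_derive x v f l.
Proof. by move=> H; apply/is_derive_epsP. Qed.

Lemma nonexpansive_continuous (R : realType) (V W : normedModType R) (g : V -> W) :
  (forall x y, `|g x - g y| <= `|x - y|) -> continuous g.
Proof.
move=> h x; apply/cvgrPdist_lt => e e0; near=> y.
by apply: le_lt_trans (h x y) _; near: y; exact: cvgr_dist_lt.
Unshelve. all: end_near. Qed.

Section CompactlySupportedLine.
Context {R : realType}.
Local Notation mu := (@lebesgue_measure R).
Implicit Types (f g : R -> R) (M B : R).

Lemma Rintegral_support f M : (forall t, M < `|t| -> f t = 0) ->
  \int[mu]_t f t = \int[mu]_(t in `[- M, M]) f t.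
Proof.
move=> f0; rewrite [RHS]Rintegral_mkcond; congr Rintegral; apply/funext => t.
rewrite patchE; case: ifPn => // /negP tM; apply: f0.
rewrite ltNge; apply/negP => h; apply: tM; rewrite inE /= in_itv/=.
by rewrite -ler_norml.
Qed.

Lemma Rintegral_lin f g M (a : R) : continuous f -> continuous g ->
  (forall t, M < `|t| -> f t = 0) -> (forall t, M < `|t| -> g t = 0) ->
  \int[mu]_t (a * f t + g t) = a * \int[mu]_t f t + \int[mu]_t g t.
Proof.
move=> cf cg f0 g0.
rewrite (Rintegral_support f0) (Rintegral_support g0) (@Rintegral_support _ M); last first.
  by move=> t tM; rewrite f0// g0// mulr0 addr0.
have mm : measurable (`[- M, M] : set R) by exact: measurable_itv.
have If := continuous_segment_integrable (- M) M cf.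
have Ig := continuous_segment_integrable (- M) M cg.
rewrite -RintegralZl// -RintegralD//.
by apply: continuous_segment_integrable => t; apply: continuousM (cf t); exact: cst_continuous.
Qed.

Lemma RintegralZ_support f M (a : R) : continuous f ->
  (forall t, M < `|t| -> f t = 0) -> \int[mu]_t (a * f t) = a * \int[mu]_t f t.
Proof.
move=> cf f0; rewrite (Rintegral_support f0) (@Rintegral_support _ M).
  by rewrite RintegralZl//; exact: continuous_segment_integrable.
by move=> t tM; rewrite f0// mulr0.
Qed.

Lemma Rintegral_segment_bound f (a b B : R) : continuous f -> a <= b ->
  (forall t, `|f t| <= B) -> `|\int[mu]_(t in `[a, b]) f t| <= B * (b - a).
Proof.
move=> cf ab fB.
have mm : measurable (`[a, b] : set R) by exact: measurable_itv.
have If := continuous_segment_integrable a b cf.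
apply: (le_trans (@le_normr_Rintegral _ _ _ mu _ f mm If)).
have h : \int[mu]_(t in `[a, b]) `|f t| <= \int[mu]_(t in `[a, b]) B.
  apply: (@le_Rintegral _ _ _ mu _ (fun t => `|f t|) (cst B)) => //.
    by apply: continuous_segment_integrable => t; apply: continuous_comp (cf t) _; exact: norm_continuous.
  by apply: continuous_segment_integrable => t; exact: cst_continuous.
apply: (le_trans h); rewrite Rintegral_cst// [X in fine X]lebesgue_measure_itv/= lte_fin.
case: ifPn => //=; rewrite -leNgt => ba.
have -> : b = a by apply/eqP; rewrite eq_le ab ba.
by rewrite subrr.
Qed.

Lemma Rintegral_bound f M B : continuous f -> 0 <= M ->
  (forall t, M < `|t| -> f t = 0) -> (forall t, `|f t| <= B) ->
  `|\int[mu]_t f t| <= B * (2 * M).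
Proof.
move=> cf M0 f0 fB; rewrite (Rintegral_support f0).
apply: le_trans (@Rintegral_segment_bound f (- M) M B cf _ fB) _.
  by lra.
by rewrite opprK mulr2n mulrDl !mul1r.
Qed.

Lemma Rintegral_FTC2 f g (a b : R) : a < b -> continuous g ->
  (forall t : R, is_derive t 1 f (g t)) ->
  \int[mu]_(t in `[a, b]) g t = f b - f a.
Proof.
move=> ab cg df.
have cf : continuous f.
  by move=> t; apply/differentiable_continuous/derivable1_diffP; have [] := df t.
rewrite /Rintegral (@continuous_FTC2 _ g f)//.
- exact: continuous_subspaceT.
- split=> [t _||]; first by have [] := df t.
  + apply: cvg_at_right_filter; exact: cf.
  + apply: cvg_at_left_filter; exact: cf.
- by move=> t _; rewrite derive1E; have [] := df t.
Qed.

Lemma Rintegral_derive f g M : continuous g -> 0 <= M ->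
  (forall t : R, is_derive t 1 f (g t)) -> (forall t, M < `|t| -> f t = 0) ->
  (forall t, M < `|t| -> g t = 0) -> \int[mu]_t g t = 0.
Proof.
move=> cg M0 df f0 g0.
rewrite (@Rintegral_support _ (M + 1)); last first.
  by move=> t tM; apply: g0; apply: lt_trans tM; rewrite ltrDl.
have M1 : 0 < M + 1 by rewrite ltr_wpDl.
rewrite (Rintegral_FTC2 _ cg df); last by rewrite lt_neqAle; apply/andP; split; lra.
by rewrite !f0 ?subrr// ?normrN gtr0_norm// ltrDl.
Qed.

End CompactlySupportedLine.

Section Slices.
Context {R : realType} {m : nat}.
Implicit Types (t s : R) (y z : 'rV[R]_m).

(** The inclusion of a slice of dimension [m] used by [integral_Rn]. *)
Definition cons_row t y : 'rV[R]_m.+1 := row_mx (t%:M : 'rV[R]_1) y.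

Lemma cons_row0 t y : cons_row t y 0 ord0 = t.
Proof.
have := row_mxEl (t%:M : 'rV[R]_1) y 0 0.
rewrite [LHS](_ : _ = cons_row t y 0 ord0) => [->|]; first by rewrite mxE eqxx mulr1n.
by congr (row_mx _ _ _ _); apply: val_inj.
Qed.

Lemma cons_rowS t y j : cons_row t y 0 (lift ord0 j) = y 0 j.
Proof.
have := row_mxEr (t%:M : 'rV[R]_1) y 0 j.
rewrite [LHS](_ : _ = cons_row t y 0 (lift ord0 j)) => [->//|].
by congr (row_mx _ _ _ _); apply: val_inj.
Qed.

Lemma cons_row_forall (P : R -> Prop) t y :
  (forall i, P (cons_row t y 0 i)) <-> P t /\ forall j, P (y 0 j).
Proof.
split=> [h|[h1 h2] i].
  by split=> [|j]; [have := h ord0; rewrite cons_row0|have := h (lift ord0 j); rewrite cons_rowS].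
by case: (unliftP ord0 i) => [j ->|->]; rewrite ?cons_row0 ?cons_rowS.
Qed.

Lemma cons_rowD t s y z : cons_row t y + cons_row s z = cons_row (t + s) (y + z).
Proof.
apply/rowP => i; rewrite mxE.
by case: (unliftP ord0 i) => [j ->|->]; rewrite ?cons_row0 ?cons_rowS ?mxE.
Qed.

Lemma cons_rowZ (a : R) t y : a *: cons_row t y = cons_row (a * t) (a *: y).
Proof.
apply/rowP => i; rewrite mxE.
by case: (unliftP ord0 i) => [j ->|->]; rewrite ?cons_row0 ?cons_rowS ?mxE.
Qed.

Lemma cons_rowB t s y z : cons_row t y - cons_row s z = cons_row (t - s) (y - z).
Proof. by rewrite -[- cons_row _ _]scaleN1r cons_rowZ cons_rowD mulN1r scaleN1r. Qed.

Lemma norm_cons_row t y M : 0 <= M -> `|t| <= M -> `|y| <= M -> `|cons_row t y| <= M.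
Proof.
move=> M0 tM yM; apply: norm_le_coord => //.
apply/(cons_row_forall (fun a => `|a| <= M)); split=> // j.
by apply: le_trans yM; exact: coord_le_norm.
Qed.

Lemma delta_mx_ord0 : delta_mx 0 ord0 = cons_row 1 0 :> 'rV[R]_m.+1.
Proof.
apply/rowP => i; case: (unliftP ord0 i) => [j ->|->].
  by rewrite cons_rowS !mxE.
by rewrite cons_row0 !mxE !eqxx.
Qed.

Lemma delta_mx_lift j : delta_mx 0 (lift ord0 j) = cons_row 0 (delta_mx 0 j) :> 'rV[R]_m.+1.
Proof.
apply/rowP => i; case: (unliftP ord0 i) => [k ->|->].
  by rewrite cons_rowS !mxE (inj_eq lift_inj).
by rewrite cons_row0 !mxE eqxx.
Qed.

Lemma slice_continuous (u : 'rV[R]_m.+1 -> R) t :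
  continuous u -> continuous (fun y => u (cons_row t y)).
Proof.
move=> cu y.
apply: (@continuous_comp _ _ _ (cons_row t) u); last exact: cu.
apply: nonexpansive_continuous => {}y z; rewrite cons_rowB subrr.
by apply: norm_cons_row; rewrite ?normr0.
Qed.

End Slices.

Section IteratedIntegral.
Context {R : realType}.
Local Notation mu := (@lebesgue_measure R).

(** The class of functions on which the iterated integral is manipulated. The
    support is bounded by an explicit box because that bound enters all the
    estimates. *)
Definition Cc n (M : R) (u : 'rV[R]_n -> R) :=
  continuous u /\ forall x, ~ box M x -> u x = 0.

Lemma Cc_le n (M M' : R) (u : 'rV[R]_n -> R) : M <= M' -> Cc M u -> Cc M' u.
Proof.
move=> MM' [cu u0]; split=> // x xM; apply: u0 => h; apply: xM => i.
exact: le_trans MM'.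
Qed.

Lemma box_cons_row m (M : R) t (y : 'rV[R]_m) :
  box M (cons_row t y) <-> `|t| <= M /\ box M y.
Proof. exact: (cons_row_forall (fun a => `|a| <= M)). Qed.

Lemma Cc_lin n (M a : R) (u v : 'rV[R]_n -> R) : Cc M u -> Cc M v ->
  Cc M (fun x => a * u x + v x).
Proof.
move=> [cu u0] [cv v0]; split=> [x|x xM].
  apply: continuousD (cv x); apply: continuousM (cu x).
  exact: cst_continuous.
by rewrite u0// v0// mulr0 addr0.
Qed.

Section Slice.
Variables (m : nat) (M : R) (u : 'rV[R]_m.+1 -> R) (Cu : Cc M u).

Lemma Cc_slice t : Cc M (fun y => u (cons_row t y)).
Proof.
split=> [|y yM]; first by apply: slice_continuous; exact: Cu.1.
by apply: Cu.2 => /box_cons_row[].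
Qed.

Lemma slice0 t y : M < `|t| -> u (cons_row t y) = 0.
Proof. by move=> tM; apply: Cu.2 => /box_cons_row[]; rewrite leNgt tM. Qed.

End Slice.

Lemma integral_RnS m (u : 'rV[R]_m.+1 -> R) :
  integral_Rn u = \int[mu]_t integral_Rn (fun y => u (cons_row t y)).
Proof. by []. Qed.

(** The partial integral over the last variables is continuous in the first
    one by uniform continuity, provided integration in dimension [m] is Lipschitz
    for the supremum norm. The proviso is a hypothesis so that this step can be
    used inside the induction on the dimension in [integral_Rn_lin_bound]. *)
Lemma slice_integral_continuous m (M K : R) (u : 'rV[R]_m.+1 -> R) : 0 <= K ->
  (forall (u v : 'rV[R]_m -> R) B, Cc M u -> Cc M v ->
    (forall y, `|u y - v y| <= B) -> `|integral_Rn u - integral_Rn v| <= B * K) ->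
  Cc M u -> continuous (fun t => integral_Rn (fun y => u (cons_row t y))).
Proof.
move=> K0 IHB Cu t; apply/cvgrPdist_le => e e0.
have K1 : 0 < K + 1 by rewrite ltr_wpDl.
have e1 : 0 < e / (K + 1) by rewrite divr_gt0.
have [d d0 hd] := compact_uniform_continuous (@compact_box R m.+1 (Num.max M `|t|)) Cu.1 e1.
near=> s.
have ts : `|t - s| < d by near: s; exact: cvgr_dist_lt.
apply: (@le_trans _ _ (e / (K + 1) * K)).
  apply: IHB; [exact: Cc_slice|exact: Cc_slice|move=> y].
  have [yM|yM] := pselect (box M y); last first.
    rewrite !(Cu.2 (cons_row _ y)); try by move=> /box_cons_row[].
    by rewrite subrr normr0 ltW.
  apply/ltW/hd; first (apply/box_cons_row; split).
  - by rewrite le_max lexx orbT.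
  - by move=> i; rewrite le_max yM.
  - rewrite cons_rowB subrr; apply: le_lt_trans ts.
    by apply: norm_cons_row; rewrite ?normr0.
by rewrite mulrAC ler_pdivrMr// ler_wpM2l ?ltW// ltrDl.
Unshelve. all: end_near. Qed.

(** Linearity and the bound are proved together: linearity in dimension [m + 1]
    needs continuity of the partial integrals, which comes from the bound in
    dimension [m]. *)
Lemma integral_Rn_lin_bound n (M : R) : 0 <= M ->
  (forall (a : R) (u v : 'rV[R]_n -> R), Cc M u -> Cc M v ->
     integral_Rn (fun x => a * u x + v x) = a * integral_Rn u + integral_Rn v) /\
  (forall (B : R) (u : 'rV[R]_n -> R), Cc M u -> (forall x, `|u x| <= B) ->
     `|integral_Rn u| <= B * (2 * M) ^+ n).
Proof.
move=> M0; elim: n => [|m [IHl IHb]].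
  by split=> [a u v _ _ //|B u _ uB]; rewrite expr0 mulr1 /=.
have IHB (u v : 'rV[R]_m -> R) B : Cc M u -> Cc M v ->
    (forall y, `|u y - v y| <= B) ->
    `|integral_Rn u - integral_Rn v| <= B * (2 * M) ^+ m.
  move=> Cu Cv uvB; rewrite -mulN1r addrC -IHl//; apply: IHb; first exact: Cc_lin.
  by move=> y; rewrite mulN1r addrC.
pose I (u : 'rV[R]_m.+1 -> R) t := integral_Rn (fun y => u (cons_row t y)).
have I0 u t : Cc M u -> M < `|t| -> I u t = 0.
  move=> Cu tM; apply/eqP; rewrite -normr_le0.
  rewrite -(mul0r ((2 * M) ^+ m)); apply: IHb; first exact: Cc_slice.
  by move=> y; rewrite (slice0 Cu)// normr0.
have Icont u : Cc M u -> continuous (I u).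
  by apply: slice_integral_continuous IHB; rewrite exprn_ge0// mulr_ge0.
have cl a u v : Cc M u -> Cc M v ->
    integral_Rn (fun x : 'rV[R]_m.+1 => a * u x + v x) = a * integral_Rn u + integral_Rn v.
  move=> Cu Cv; rewrite !integral_RnS.
  have E : (fun t => integral_Rn (fun y => a * u (cons_row t y) + v (cons_row t y)))
      = (fun t => a * I u t + I v t).
    by apply/funext => t; rewrite IHl//; exact: Cc_slice.
  rewrite E.
  apply: (@Rintegral_lin _ (I u) (I v) M a); try exact: Icont.
  - by move=> t; exact: I0.
  - by move=> t; exact: I0.
split=> // B u Cu uB; rewrite integral_RnS exprSr mulrA.
apply: (@Rintegral_bound _ (I u)) => //; first exact: Icont.
- by move=> t; exact: I0.
- by move=> t; apply: IHb => //; exact: Cc_slice.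
Qed.

Section Properties.
Variables (n : nat) (M : R).
Implicit Types (u v : 'rV[R]_n -> R).

Lemma integral_Rn_lin (a : R) u v : Cc M u -> Cc M v ->
  integral_Rn (fun x => a * u x + v x) = a * integral_Rn u + integral_Rn v.
Proof.
move=> Cu Cv; have M0 : 0 <= Num.max M 0 by rewrite le_max lexx orbT.
have MM : M <= Num.max M 0 by rewrite le_max lexx.
have [h _] := @integral_Rn_lin_bound n _ M0.
by apply: h; exact: Cc_le MM _.
Qed.

Lemma integral_Rn_bound (B : R) u : 0 <= M -> Cc M u -> (forall x, `|u x| <= B) ->
  `|integral_Rn u| <= B * (2 * M) ^+ n.
Proof. by move=> M0; have [_ h] := @integral_Rn_lin_bound n _ M0; exact: h. Qed.

Lemma integral_Rn_ge0 u : (forall x, 0 <= u x) -> 0 <= integral_Rn u.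
Proof.
elim: (n) u => [|m IH] u u0; first exact: u0.
by rewrite integral_RnS; apply: Rintegral_ge0 => t _; exact: IH.
Qed.

Lemma Cc0 : Cc M (fun _ : 'rV[R]_n => 0 : R).
Proof. by split=> // x; exact: cst_continuous. Qed.

Lemma integral_Rn0 : integral_Rn (fun _ : 'rV[R]_n => 0 : R) = 0 :> R.
Proof.
have := integral_Rn_lin 1 Cc0 Cc0; under eq_fun do rewrite mulr0 addr0.
by rewrite mul1r -[LHS]addr0 => /addrI <-.
Qed.

Lemma integral_RnZ (a : R) u : Cc M u ->
  integral_Rn (fun x => a * u x) = a * integral_Rn u.
Proof.
move=> Cu; rewrite -[RHS]addr0 -integral_Rn0 -integral_Rn_lin//; last exact: Cc0.
by congr integral_Rn; apply/funext => x; rewrite addr0.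
Qed.

Lemma integral_RnD u v : Cc M u -> Cc M v ->
  integral_Rn (fun x => u x + v x) = integral_Rn u + integral_Rn v.
Proof.
move=> Cu Cv; rewrite -[X in X + _]mul1r -integral_Rn_lin//.
by congr integral_Rn; apply/funext => x; rewrite mul1r.
Qed.

Lemma integral_RnB u v : Cc M u -> Cc M v ->
  integral_Rn (fun x => u x - v x) = integral_Rn u - integral_Rn v.
Proof.
move=> Cu Cv; rewrite addrC -mulN1r -integral_Rn_lin//.
by congr integral_Rn; apply/funext => x; rewrite mulN1r addrC.
Qed.

Lemma le_integral_Rn u v : Cc M u -> Cc M v -> (forall x, u x <= v x) ->
  integral_Rn u <= integral_Rn v.
Proof.
move=> Cu Cv uv; rewrite -subr_ge0 -integral_RnB//; apply: integral_Rn_ge0 => x.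
by rewrite subr_ge0.
Qed.

Lemma integral_Rn_dist B u v : 0 <= M -> Cc M u -> Cc M v ->
  (forall x, `|u x - v x| <= B) ->
  `|integral_Rn u - integral_Rn v| <= B * (2 * M) ^+ n.
Proof.
move=> M0 Cu Cv uvB; rewrite -integral_RnB//; apply: integral_Rn_bound => //.
have := Cc_lin (-1) Cv Cu; congr Cc; apply/funext => x.
by rewrite mulN1r addrC.
Qed.

End Properties.

Lemma line_slice m (u : 'rV[R]_m.+1 -> R) t (y v : 'rV[R]_m) (l : R) :
  is_derive (cons_row t y) (cons_row 0 v) u l ->
  is_derive y v (fun y => u (cons_row t y)) l.
Proof.
move=> /line_is_derive0 h; apply/line_is_derive0.
rewrite [X in is_derive _ _ X _](_ : _ = (fun h => u (h *: cons_row 0 v + cons_row t y)))//.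
by apply/funext => h'; rewrite cons_rowZ mulr0 cons_rowD add0r.
Qed.

(** In the direction of the first coordinate one differentiates under the
    integral sign and uses the fundamental theorem; in the other directions every
    slice has integral 0 by induction. *)
Lemma integral_Rn_derive n (M : R) (u w : 'rV[R]_n -> R) (i : 'I_n) :
  0 <= M -> Cc M u -> Cc M w ->
  (forall x, is_derive x (delta_mx 0 i) u (w x)) -> integral_Rn w = 0.
Proof.
move=> M0; elim: n u w i => [|m IH] u w i Cu Cw uw; first by case: i uw.
rewrite integral_RnS; case: (unliftP ord0 i) uw => [j ->|->] uw.
  apply: eq0_Rintegral => t _.
  apply: (IH (fun y => u (cons_row t y)) _ j); try exact: Cc_slice.
  by move=> y; apply: line_slice; rewrite -delta_mx_lift.
pose I (u : 'rV[R]_m.+1 -> R) t := integral_Rn (fun y => u (cons_row t y)).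
apply: (@Rintegral_derive _ (I u) (I w) M) => //.
- have K0 : 0 <= (2 * M) ^+ m by rewrite exprn_ge0// mulr_ge0.
  exact: (slice_integral_continuous K0 (fun u v B => @integral_Rn_dist m M B u v M0) Cw).
- move=> t; apply: is_derive_eps => e e0.
  have M20 : 0 < (2 * M) ^+ m + 1 by rewrite ltr_wpDl// exprn_ge0// mulr_ge0.
  have e1 : 0 < e / ((2 * M) ^+ m + 1) by rewrite divr_gt0.
  have [d d0 hd] := compact_uniform_derive (@compact_box R m.+1 (Num.max M `|t|)) Cw.1 uw e1.
  exists d => // h h0 hdd.
  have Ct s : Cc M (fun y => u (cons_row s y)) by exact: Cc_slice.
  rewrite /I -(integral_RnB (Ct _) (Ct _)) -(integral_RnZ _ (M := M)); last first.
    have := Cc_lin (-1) (Ct t) (Ct (h *: 1 + t)); congr Cc; apply/funext => y.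
    by rewrite mulN1r addrC.
  apply: (@le_trans _ _ (e / ((2 * M) ^+ m + 1) * (2 * M) ^+ m)).
    apply: (integral_Rn_dist M0).
    + have := Cc_lin (- h^-1) (Ct t) (Cc_lin h^-1 (Ct (h *: 1 + t)) (@Cc0 m M)).
      by congr Cc; apply/funext => y; rewrite addr0 mulNr mulrBr addrC.
    + exact: Cc_slice.
    move=> y; have [yM|yM] := pselect (box M y); last first.
      rewrite (Cu.2 (cons_row (_ *: _ + _) y)) ?(Cu.2 (cons_row t y)) ?(Cw.2 (cons_row t y));
        try by move=> /box_cons_row[].
      by rewrite subrr mulr0 subrr normr0 ltW.
    have := hd h (cons_row t y) h0 hdd.
    rewrite delta_mx_ord0 cons_rowZ cons_rowD mulr1 scaler0 add0r.
    rewrite [h *: 1]mulr1; apply; apply/box_cons_row; split.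
      by rewrite le_max lexx orbT.
    by move=> j; rewrite le_max yM.
  by rewrite mulrAC ler_pdivrMr// ler_wpM2l ?ltW// ltrDl.
- move=> t tM; rewrite -(@integral_Rn0 m M); congr integral_Rn; apply/funext => y.
  exact: slice0 Cu _ _ tM.
- move=> t tM; rewrite -(@integral_Rn0 m M); congr integral_Rn; apply/funext => y.
  exact: slice0 Cw _ _ tM.
Qed.

Lemma Cc_prod n (M : R) (f : 'I_n -> R -> R) : (forall i, continuous (f i)) ->
  (forall i t, M < `|t| -> f i t = 0) ->
  Cc M (fun x : 'rV[R]_n => \prod_i f i (x 0 i)).
Proof.
move=> cf f0; split; last first.
  move=> x /existsNP[i /negP]; rewrite -ltNge => xM.
  by rewrite (bigD1 i)//= f0// mul0r.
elim: (index_enum _) => [|i r IH] x.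
  by under eq_fun do rewrite big_nil; exact: cst_continuous.
under eq_fun do rewrite big_cons.
apply: continuousM; last exact: IH.
apply: (@continuous_comp _ _ _ (fun x : 'rV_n => x 0 i) (f i)).
  exact: coord_continuous_rV.
exact: cf.
Qed.

(** Fubini for products of functions of one coordinate, used to see that product
    bumps have integral 1. *)
Lemma integral_Rn_prod n (M : R) (f : 'I_n -> R -> R) :
  (forall i, continuous (f i)) -> (forall i t, M < `|t| -> f i t = 0) ->
  integral_Rn (fun x : 'rV[R]_n => \prod_i f i (x 0 i)) = \prod_i \int[mu]_t f i t.
Proof.
elim: n f => [|m IH] f cf f0; first by rewrite /= !big_ord0.
rewrite integral_RnS big_ord_recl.
pose g j := f (lift ord0 j).
have cg j : continuous (g j) by exact: cf.
have g0 j t : M < `|t| -> g j t = 0 by exact: f0.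
rewrite -(IH g cg g0) mulrC -(RintegralZ_support _ (cf ord0) (f0 ord0)).
  apply: eq_Rintegral => t _; rewrite mulrC.
  rewrite -(integral_RnZ _ (Cc_prod cg g0)); congr integral_Rn; apply/funext => y.
  rewrite big_ord_recl cons_row0; congr (_ * _); apply: eq_bigr => j _.
  by rewrite cons_rowS.
Qed.

End IteratedIntegral.

(** * Antiderivatives in several variables *)
Lemma continuousZr (R : realType) (T : topologicalType) (a : R) (f : T -> R) :
  continuous f -> continuous (fun x => a * f x).
Proof. by move=> cf x; apply: continuousM (cf x); exact: cst_continuous. Qed.

Section DirectionalPrimitive.
Context {R : realType} {n : nat}.
Local Notation X := 'rV[R]_n.
Local Notation mu := (@lebesgue_measure R).
Local Notation e_ i := (delta_mx 0 i : X).
Implicit Types (h w f g : X -> R) (i j : 'I_n) (L M : R) (x : X).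

(** Integration along the segment of length [L] that ends at [x]. With a fixed
    length the operator commutes with translations, hence with all partial
    derivatives, including the one in direction [i]. *)
Definition dprim L i h x : R := \int[mu]_(t in `[0, L]) h (x - t *: e_ i).

Lemma line_continuous h i x : continuous h ->
  continuous (fun t : R => h (x - t *: e_ i)).
Proof.
move=> ch t; apply: (@continuous_comp _ _ _ (fun t : R => x - t *: e_ i) h); last exact: ch.
apply: nonexpansive_continuous => s u.
rewrite opprD opprK addrACA subrr add0r addrC -scalerBl normrZ distrC.
by rewrite ler_piMr// norm_delta_mx.
Qed.

Lemma dprim_dist L i h w B x y : 0 <= L -> continuous h -> continuous w ->
  (forall t, 0 <= t <= L -> `|h (x - t *: e_ i) - w (y - t *: e_ i)| <= B) ->
  `|dprim L i h x - dprim L i w y| <= B * L.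
Proof.
move=> L0 ch cw hB.
have ci z u : continuous u -> mu.-integrable `[0, L] (EFin \o (fun t => u (z - t *: e_ i))).
  by move=> cu; apply: continuous_segment_integrable; exact: line_continuous.
have mm : measurable (`[0, L] : set R) by exact: measurable_itv.
rewrite /dprim -RintegralB//; try exact: ci.
have B0 : 0 <= B by apply: le_trans (hB 0 _); rewrite ?lexx.
pose f t := h (x - t *: e_ i) - w (y - t *: e_ i).
have cf : continuous f by move=> t; apply: continuousB; exact: line_continuous.
apply: (le_trans (@le_normr_Rintegral _ _ _ mu _ f mm _)).
  exact: continuous_segment_integrable.
have hle : \int[mu]_(t in `[0, L]) `|f t| <= \int[mu]_(t in `[0, L]) B.
  apply: (@le_Rintegral _ _ _ mu _ (fun t => `|f t|) (cst B)) => //.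
  - apply: continuous_segment_integrable => t.
    by apply: continuous_comp (cf t) _; exact: norm_continuous.
  - by apply: continuous_segment_integrable => t; exact: cst_continuous.
apply: (le_trans hle); rewrite Rintegral_cst// [X in fine X]lebesgue_measure_itv/= lte_fin.
by case: ifPn => //= _; rewrite ?subr0// mulr0 mulr_ge0.
Qed.

Lemma line_in_box L i x t : 0 <= t <= L -> box (`|x| + L) (x - t *: e_ i).
Proof.
move=> /andP[t0 tL]; apply: box_norm; apply: le_trans (ler_normB _ _) _.
by rewrite lerD2l normrZ ger0_norm// (le_trans _ tL)// ler_piMr// norm_delta_mx.
Qed.

Lemma dprim_continuous L i h : 0 <= L -> continuous h -> continuous (dprim L i h).
Proof.
move=> L0 ch x.
have L1 : 0 < L + 1 by rewrite ltr_wpDl.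
apply/continuous_epsP => e e0; have e1 : 0 < e / (L + 1) by rewrite divr_gt0.
have [d d0 hd] := compact_uniform_continuous (@compact_box R n (`|x| + L)) ch e1.
exists d => // y xy; apply: (@le_trans _ _ (e / (L + 1) * L)); last first.
  by rewrite mulrAC ler_pdivrMr// ler_wpM2l ?ltW// ltrDl.
apply: dprim_dist => // t tL; apply/ltW/hd; first exact: line_in_box.
by rewrite opprD addrACA subrr addr0.
Qed.

Lemma dprimB L i h w x y : continuous h -> continuous w ->
  dprim L i h x - dprim L i w y = \int[mu]_(t in `[0, L]) (h (x - t *: e_ i) - w (y - t *: e_ i)).
Proof.
move=> ch cw; rewrite /dprim RintegralB//;
  by apply: continuous_segment_integrable; exact: line_continuous.
Qed.

Lemma dprim_is_derive L i h w j : 0 <= L -> continuous h -> continuous w ->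
  (forall x, is_derive x (e_ j) h (w x)) ->
  forall x, is_derive x (e_ j) (dprim L i h) (dprim L i w x).
Proof.
move=> L0 ch cw hw x; apply: is_derive_eps => e e0.
have L1 : 0 < L + 1 by rewrite ltr_wpDl.
have e1 : 0 < e / (L + 1) by rewrite divr_gt0.
have [d d0 hd] := compact_uniform_derive (@compact_box R n (`|x| + L)) cw hw e1.
exists d => // s s0 sd.
have E : s^-1 * (dprim L i h (s *: e_ j + x) - dprim L i h x) =
    dprim L i (fun y => s^-1 * (h (s *: e_ j + y) - h y)) x.
  rewrite dprimB// -RintegralZl//.
    by apply: eq_Rintegral => t _; rewrite addrA.
  apply: continuous_segment_integrable => t.
  by apply: continuousB; exact: line_continuous.
rewrite E; apply: (@le_trans _ _ (e / (L + 1) * L)); last first.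
  by rewrite mulrAC ler_pdivrMr// ler_wpM2l ?ltW// ltrDl.
apply: dprim_dist => //; last first.
  by move=> t tL; apply: hd => //; exact: line_in_box.
apply: continuousZr => y; apply: continuousB (ch y).
apply: (@continuous_comp _ _ _ (fun y => s *: e_ j + y) h); last exact: ch.
by apply: nonexpansive_continuous => u v; rewrite opprD addrACA subrr add0r.
Qed.

Lemma dprim_FTC L i h w x : 0 < L -> continuous w ->
  (forall x, is_derive x (e_ i) h (w x)) ->
  dprim L i w x = h x - h (x - L *: e_ i).
Proof.
move=> L0 cw hw.
pose f (t : R) := - h (x - t *: e_ i).
have df (t : R) : is_derive t 1 f (w (x - t *: e_ i)).
  have h1 := (line_is_derive h (e_ i) x (- t) _).1 (hw _).
  have h2 : is_derive t (1 : R) (fun t : R => - t) (- 1) by exact: is_deriveN.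
  have h3 := is_deriveN (@is_derive1_comp _ (fun s => h (s *: e_ i + x)) (fun t => - t) t _ _ h1 h2).
  have -> : f = \- ((fun s => h (s *: e_ i + x)) \o (fun t => - t)).
    by apply/funext => s; rewrite /f /= scaleNr addrC.
  by apply: (is_derive_eq h3); rewrite mulrN1 opprK scaleNr addrC.
rewrite /dprim (Rintegral_FTC2 L0 (line_continuous (i:=i) (x:=x) cw) df) /f.
by rewrite scale0r subr0 opprK addrC.
Qed.

Lemma smooth_is_derive h x i : smooth setT h -> is_derive x (e_ i) h (pd i h x).
Proof.
move=> sh; have d : derivable h x (e_ i) := smooth_derivable i sh Logic.I.
exact: (derivableP d).
Qed.

Lemma smoothT_continuous h : smooth setT h -> continuous h.
Proof. by move=> sh x; exact: smooth_continuous sh I. Qed.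

Lemma pd_dprim L i j h : 0 <= L -> smooth setT h ->
  pd j (dprim L i h) = dprim L i (pd j h).
Proof.
move=> L0 sh; apply/funext => x.
have [_] := dprim_is_derive i L0 (smoothT_continuous sh)
  (smoothT_continuous (smooth_pd j sh)) (fun x => smooth_is_derive x j sh) x.
exact.
Qed.

Lemma smooth_dprim L i h : 0 <= L -> smooth setT h -> smooth setT (dprim L i h).
Proof.
move=> L0 sh.
apply: (@smooth_coind _ _ _ setT [set f | exists2 w, smooth setT w & f = dprim L i w]).
- exact: openT.
- move=> _ [w sw ->] x _; split; first exact: dprim_continuous L0 (smoothT_continuous sw) x.
  move=> j; have [] := dprim_is_derive i L0 (smoothT_continuous sw)
    (smoothT_continuous (smooth_pd j sw)) (fun x => smooth_is_derive x j sw) x.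
  by [].
- move=> _ j [w sw ->]; exists (dprim L i (pd j w)).
    exact: (ex_intro2 _ _ (pd j w) (smooth_pd j sw) erefl).
  by move=> x _; rewrite pd_dprim.
- by exists h.
Qed.

Lemma pd_dprim_same L i h x : 0 < L -> smooth setT h ->
  pd i (dprim L i h) x = h x - h (x - L *: e_ i).
Proof.
move=> L0 sh; rewrite pd_dprim ?ltW//.
apply: dprim_FTC => //; first exact: smoothT_continuous (smooth_pd i sh).
by move=> y; exact: smooth_is_derive.
Qed.

Lemma pd_shift j h a x : smooth setT h -> pd j (fun x => h (x - a)) x = pd j h (x - a).
Proof.
move=> sh; have h1 := (line_is_derive0 h (e_ j) (x - a) _).1 (smooth_is_derive (x - a) j sh).
have [_ //] : is_derive x (e_ j) (fun x => h (x - a)) (pd j h (x - a)).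
apply/line_is_derive0; congr (is_derive _ _ _ _) : h1.
by apply/funext => t; rewrite addrA.
Qed.

Lemma smooth_shift h a : smooth setT h -> smooth setT (fun x => h (x - a)).
Proof.
move=> sh.
apply: (@smooth_coind _ _ _ setT [set f | exists2 w, smooth setT w & f = (fun x => w (x - a))]).
- exact: openT.
- move=> _ [w sw ->] x _; split.
    apply: (@continuous_comp _ _ _ (fun x => x - a) w); last exact: smoothT_continuous.
    by apply: nonexpansive_continuous => u v; rewrite opprD opprK addrACA addNr addr0.
  move=> j; have h1 := (line_is_derive0 w (e_ j) (x - a) _).1 (smooth_is_derive (x - a) j sw).
  have [] // : is_derive x (e_ j) (fun x => w (x - a)) (pd j w (x - a)).
  apply/line_is_derive0; congr (is_derive _ _ _ _) : h1.
  by apply/funext => t; rewrite addrA.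
- move=> _ j [w sw ->]; exists (fun x => pd j w (x - a)).
    exact: (ex_intro2 _ _ (pd j w) (smooth_pd j sw) erefl).
  by move=> x _; exact: pd_shift.
- by exists h.
Qed.

(** Symmetry of second derivatives: both sides are continuous and have the same
    integrals along all segments in direction [i], since [dprim] commutes with
    [pd j]. *)
Lemma pdC i j h : smooth setT h -> pd i (pd j h) = pd j (pd i h).
Proof.
move=> sh; apply/funext => x; apply/eqP; rewrite -subr_eq0; apply/eqP.
pose w y := pd i (pd j h) y - pd j (pd i h) y.
have cw1 : continuous (pd i (pd j h)) by apply/smoothT_continuous/smooth_pd/smooth_pd.
have cw2 : continuous (pd j (pd i h)) by apply/smoothT_continuous/smooth_pd/smooth_pd.
have cw : continuous w by move=> y; have := continuousB (cw1 y) (cw2 y); exact.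
(* The base point is one unit ahead of [x], so that [x] is interior to the
   segments considered and can be reached by differentiating in [L]. *)
pose z := x + 1 *: e_ i.
have w0 L : 0 < L -> dprim L i w z = 0.
  move=> L0.
  have -> : dprim L i w z = dprim L i (pd i (pd j h)) z - dprim L i (pd j (pd i h)) z.
    by rewrite (@dprimB L i _ _ z z cw1 cw2).
  have E1 := congr1 (@^~ z) (@pd_dprim L i i _ (ltW L0) (smooth_pd j sh)).
  have E2 := congr1 (@^~ z) (@pd_dprim L i j _ (ltW L0) (smooth_pd i sh)).
  have E3 := @pd_dprim_same L i _ z L0 (smooth_pd j sh).
  apply/eqP; rewrite subr_eq0; apply/eqP.
  apply: (etrans (esym E1)); apply: (etrans E3); apply: etrans E2.
  have -> : dprim L i (pd i h) = fun y => h y - h (y - L *: e_ i).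
    apply/funext => y; rewrite -(@pd_dprim L i i _ (ltW L0) sh).
    exact: pd_dprim_same.
  have -> : pd j (fun y => h y - h (y - L *: e_ i)) z =
      pd j h z - pd j (fun y => h (y - L *: e_ i)) z.
    rewrite /pd -deriveB//.
      by have [] := smooth_is_derive z j sh.
    by have [] := smooth_is_derive z j (smooth_shift (L *: e_ i) sh).
  by rewrite (pd_shift j _ _ sh).
pose f (t : R) := w (z - t *: e_ i).
have cf : continuous f by exact: line_continuous.
have cf1 : {for 1, continuous f} by exact: cf.
have l12 : 1 < 1 + 1 :> R by rewrite ltrDl.
have [d e] := continuous_FTC1_closed l12 (@continuous_segment_integrable _ f 0 (1 + 1) cf) ltr01 cf1.
have f1 : f 1 = 0.
  rewrite -e derive1E.
  have E : \forall u \near (1 : R), (cst 0 : R -> R) u = (fun u => \int[mu]_(t in `[0, u]) f t) u.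
    by apply: filterS (lt_nbhsr (@ltr01 R)) => t t0; exact: esym (w0 t t0).
  by rewrite -(near_eq_derive (1 : R) E) derive_cst.
by move: f1; rewrite /f /z addrK.
Qed.

(** These two conditions play the role of supports bounded below and above in
    all coordinates. An antiderivative of a compactly supported function keeps
    only the first one; a product of a function of each kind has bounded support,
    which is what integration by parts needs. *)
Definition vanish_left M h := forall x, (exists i, x 0 i < - M) -> h x = 0.
Definition vanish_right M h := forall x, (exists i, M < x 0 i) -> h x = 0.

(** The antiderivative that vanishes on the left. The segment is long enough to
    reach the region where [h] vanishes, so locally its length may be taken
    constant ([near_prim_i]) and the facts on [dprim] apply. *)
Definition prim_i M i h x : R := dprim (`|x 0 i| + M + 1) i h x.

Section Primitive.
Variables (M : R) (M0 : 0 <= M) (i : 'I_n) (h : X -> R).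
Hypotheses (sh : smooth setT h) (vh : vanish_left M h).

Lemma dprim_stable (L L' : R) x : 0 <= L -> L <= L' -> x 0 i + M <= L ->
  dprim L i h x = dprim L' i h x.
Proof.
move=> L0 LL' xL; apply/eqP; rewrite eq_sym -subr_eq0; apply/eqP.
have ci : mu.-integrable `[0, L'] (EFin \o (fun t => h (x - t *: e_ i))).
  apply: continuous_segment_integrable.
  by apply: line_continuous; exact: smoothT_continuous.
rewrite /dprim Rintegral_itvB//; try by rewrite bnd_simp.
apply: eq0_Rintegral => t; rewrite /= in_itv/= => /andP[Lt _].
by apply: vh; exists i; rewrite !mxE !eqxx mulr1; lra.
Qed.

Lemma near_prim_i x0 : exists2 L : R, 0 < L /\ x0 0 i - L < - M &
  \near x0, dprim L i h x0 = prim_i M i h x0.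
Proof.
exists (`|x0 0 i| + M + 2).
  have aux (a b m : R) : 0 <= m -> 0 <= b -> a <= b -> 0 < b + m + 2 /\ a - (b + m + 2) < - m.
    by move=> *; split; lra.
  exact: aux M0 (normr_ge0 _) (ler_norm _).
have cc : {for x0, continuous (fun x : X => x 0 i)} by exact: coord_continuous_rV.
have /cvgrPdist_lt/(_ 1 ltr01) := cc.
apply: filterS => x xx0; rewrite /prim_i.
have h1 : `|x 0 i| <= `|x0 0 i| + 1.
  rewrite -[x 0 i](subrK (x0 0 i)) (le_trans (ler_normD _ _))// addrC lerD2l.
  by rewrite distrC ltW.
have aux (a b c m : R) : 0 <= m -> 0 <= b -> a <= b -> b <= c + 1 ->
    [/\ 0 <= b + m + 1, b + m + 1 <= c + m + 2 & a + m <= b + m + 1].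
  by move=> *; split; lra.
have [a1 a2 a3] := aux _ _ _ _ M0 (normr_ge0 (x 0 i)) (ler_norm (x 0 i)) h1.
exact/esym/dprim_stable.
Qed.

Lemma smooth_prim_i : smooth setT (prim_i M i h).
Proof.
move=> s x _; have [L [L0 _] e] := near_prim_i x.
have [c d] := smooth_dprim i (ltW L0) sh s Logic.I (x := x).
have e' : \near x, pds s (dprim L i h) x = pds s (prim_i M i h) x.
  by apply: filterS (near_join e) => y; exact: near_pds.
split=> [|j]; first exact: near_continuous e' c.
exact: near_eq_derivable e' (d j).
Qed.

Lemma pd_prim_i : pd i (prim_i M i h) = h.
Proof.
apply/funext => x; have [L [L0 xL] e] := near_prim_i x.
rewrite -(near_pd i e) (@pd_dprim_same L i _ x L0 sh) (_ : h (x - _) = 0) ?subr0//.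
by apply: vh; exists i; rewrite !mxE !eqxx mulr1.
Qed.

Lemma vanish_prim_i : vanish_left M (prim_i M i h).
Proof.
move=> x [k xk]; apply: eq0_Rintegral => t; rewrite /= in_itv/= => /andP[t0 _].
apply: vh; exists k; rewrite !mxE !eqxx/=.
by apply: le_lt_trans xk; rewrite gerBl mulr_ge0//; case: (_ == _).
Qed.

End Primitive.

Lemma exists_antiderivative M h (s : seq 'I_n) : 0 <= M ->
  smooth setT h -> vanish_left M h ->
  exists G, [/\ smooth setT G, vanish_left M G & pds s G = h].
Proof.
move=> M0; elim: s h => [|i s IH] h sh vh; first by exists h.
have [G [sG vG GE]] := IH _ (smooth_prim_i M0 i sh vh) (@vanish_prim_i M i h vh).
by exists G; split=> //=; rewrite GE pd_prim_i.
Qed.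

Lemma vanish_pds (U : set X) s h : open U -> (forall x, U x -> h x = 0) ->
  forall x, U x -> pds s h x = 0.
Proof.
move=> oU h0 x Ux; have -> : 0 = pds s (fun=> 0 : R) x by rewrite pds_cst0.
apply: near_pds; exact: (open_near oU Ux).
Qed.

Lemma open_coord_lt M i : open [set x : X | x 0 i < M].
Proof. by apply: open_comp (@open_lt R M) => x _; exact: coord_continuous_rV. Qed.

Lemma open_coord_gt M i : open [set x : X | M < x 0 i].
Proof. by apply: open_comp (@open_gt R M) => x _; exact: coord_continuous_rV. Qed.

Lemma vanish_left_pds M s h : vanish_left M h -> vanish_left M (pds s h).
Proof.
move=> vh x [i xi]; apply: (vanish_pds s (@open_coord_lt (- M) i)) => // y yi.
by apply: vh; exists i.
Qed.

Lemma vanish_right_pds M s h : vanish_right M h -> vanish_right M (pds s h).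
Proof.
move=> vh x [i xi]; apply: (vanish_pds s (@open_coord_gt M i)) => // y yi.
by apply: vh; exists i.
Qed.

Lemma Cc_left_right M f g : smooth setT f -> smooth setT g ->
  vanish_left M f -> vanish_right M g -> Cc M (fun x => f x * g x).
Proof.
move=> sf sg vf vg; split=> [x|x /existsNP[i /negP]].
  exact: smoothT_continuous (smoothM openT sf sg) x.
rewrite -ltNge lter_normr => /orP[xi|xi].
  by rewrite vg ?mulr0//; exists i.
by rewrite vf ?mul0r//; exists i; rewrite ltrNr.
Qed.

Lemma integral_Rn_by_parts M i f g : 0 <= M -> smooth setT f -> smooth setT g ->
  Cc M (fun x => f x * g x) -> Cc M (fun x => pd i f x * g x) ->
  Cc M (fun x => f x * pd i g x) ->
  integral_Rn (fun x => pd i f x * g x) = - integral_Rn (fun x => f x * pd i g x).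
Proof.
move=> M0 sf sg c1 c2 c3; apply/eqP; rewrite -addr_eq0; apply/eqP.
rewrite -(integral_RnD c2 c3).
have c4 : Cc M (fun x => pd i f x * g x + f x * pd i g x).
  have := Cc_lin 1 c2 c3; congr Cc; apply/funext => x; by rewrite mul1r.
apply: (integral_Rn_derive (i := i) M0 c1 c4) => x.
have sfg := smoothM openT sf sg.
have := smooth_is_derive x i sfg; rewrite (pdM i sf sg Logic.I).
exact.
Qed.

Lemma integral_Rn_by_parts_seq M s f g : 0 <= M -> smooth setT f -> smooth setT g ->
  vanish_left M f -> vanish_right M g ->
  integral_Rn (fun x => pds s f x * g x) =
  (-1) ^+ size s * integral_Rn (fun x => f x * pds (rev s) g x).
Proof.
move=> M0; elim: s g => [|i s IH] g sf sg vf vg; first by rewrite expr0 mul1r.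
have sfs := smooth_pds s sf; have vfs := vanish_left_pds s vf.
have sgi := smooth_pd i sg.
have vgi : vanish_right M (pd i g) := vanish_right_pds [:: i] vg.
rewrite /= (integral_Rn_by_parts M0 sfs sg); last 3 first.
- exact: Cc_left_right.
- apply: (Cc_left_right (smooth_pd i sfs) sg _ vg).
  exact: (vanish_left_pds [:: i] vfs).
- exact: (Cc_left_right sfs sgi vfs vgi).
by rewrite IH// rev_cons pds_rcons exprS mulN1r mulNr.
Qed.

End DirectionalPrimitive.

(** * Cutoff functions and a Leibniz estimate *)
Section Cutoff.
Context {R : realType} {n : nat}.
Local Notation X := 'rV[R]_n.
Implicit Types (h f g a : X -> R) (i j : 'I_n) (M : R) (x c : X) (A K Omega : set X).

Lemma closed_box M : closed (box M : set X).
Proof. by apply: compact_closed (@norm_hausdorff _ X) _; exact: compact_box. Qed.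

Lemma compact_closed_rV A : compact A -> closed A.
Proof. exact: compact_closed (@norm_hausdorff _ X). Qed.

Lemma compact_in_box A : compact A -> exists2 M, 0 <= M & A `<=` box M.
Proof.
move=> /compact_bounded[B [_ hB]]; exists (`|B| + 1); first by rewrite addr_ge0.
by move=> x /(hB (`|B| + 1)) xB; apply: box_norm; apply: xB; rewrite (le_lt_trans (ler_norm B))// ltrDl.
Qed.

(** A tensor product of the one-variable plateau [S (t + 2) * S (2 - t)], which
    is 1 on [-1, 1] and 0 outside [-2, 2], rescaled; the norm is the maximum
    norm. *)
Lemma smooth_plateau (x0 : X) (r : R) : 0 < r ->
  exists b : X -> R, [/\ smooth setT b,
    forall x, `|x - x0| <= r -> b x = 1 &
    forall x, 2 * r < `|x - x0| -> b x = 0].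
Proof.
move=> r0; have [S [tS S0 S1 _ _]] := @smooth_step R.
pose p := tower_mul (fun k t => 1 ^+ k * S k (1 * t + 2))
                    (fun k t => (-1) ^+ k * S k (-1 * t + 2)).
have tp : tower p by apply: towerM; exact: tower_affine.
have pE t : p 0%N t = S 0%N (t + 2) * S 0%N (2 - t).
  by rewrite /p /= !expr0 !mul1r mulN1r [- t + 2]addrC.
pose F i := fun k t => r^-1 ^+ k * p k (r^-1 * t + - (r^-1 * x0 0 i)).
have tF i : tower (F i) by exact: tower_affine.
have FE i t : F i 0%N t = p 0%N (r^-1 * (t - x0 0 i)) by rewrite /F expr0 mul1r mulrBr.
exists (tensor F (fun=> 0%N)); split.
- exact: smooth_tensor.
- move=> x xr; apply: big1 => i _; rewrite FE pE.
  have : `|r^-1 * (x 0 i - x0 0 i)| <= 1.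
    rewrite normrM normfV (gtr0_norm r0) ler_pdivrMl// mulr1.
    by have := coord_le_norm (x - x0) i; rewrite !mxE => /le_trans; apply.
  rewrite ler_norml => /andP[h1 h2].
  by rewrite !S1 ?mulr1//; lra.
- move=> x xr; have [i xi] : exists i, 2 * r < `|(x - x0) 0 i|.
    apply: contrapT => /forallNP h; move: xr; apply/negP; rewrite -leNgt.
    apply: norm_le_coord; first by rewrite mulr_ge0// ltW.
    by move=> i; rewrite leNgt; apply/negP; exact: h.
  rewrite /tensor (bigD1 i)//= FE pE (_ : S _ _ * _ = 0) ?mul0r//.
  have : 2 < `|r^-1 * (x 0 i - x0 0 i)|.
    rewrite normrM normfV (gtr0_norm r0) ltr_pdivlMl// mulrC.
    by move: xi; rewrite !mxE.
  rewrite lter_normr => /orP[h|h]; last by rewrite S0 ?mul0r//; lra.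
  by rewrite mulrC S0 ?mul0r//; lra.
Qed.

Lemma compact_ball_norm (x0 : X) (r : R) : compact [set x | `|x - x0| <= r].
Proof.
apply: bounded_closed_compact.
  exists (r + `|x0|); split; first exact: num_real.
  move=> B hB x /= xr; rewrite -[x](subrK x0); apply: le_trans (ler_normD _ _) _.
  by apply: le_trans (ltW hB); rewrite lerD2r.
have cc : continuous (fun x : X => `|x - x0|).
  move=> x; apply: (@continuous_comp _ _ _ (fun x : X => x - x0) (fun x => `|x|)).
    by apply: nonexpansive_continuous => u v; rewrite opprD opprK addrACA addNr addr0.
  exact: norm_continuous.
exact: (closed_comp (fun x _ => cc x) (@closed_le R r)).
Qed.

(** Cover [K] by finitely many balls with plateau functions [b_c]; then
    [1 - prod_c (1 - b_c)] is 1 wherever one of them is 1. *)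
Lemma smooth_cutoff K Omega : open Omega -> compact K -> K `<=` Omega ->
  exists (chi : X -> R) A, [/\ smooth setT chi, compact A, A `<=` Omega,
    forall x, ~ A x -> chi x = 0 & forall x, K x -> chi x = 1].
Proof.
move=> oO cK KO.
have /choice[r hr] : forall x : X, exists r : R, 0 < r /\
    (K x -> forall y, `|y - x| <= 2 * r -> Omega y).
  move=> x; have [Kx|nKx] := pselect (K x); last by exists 1.
  have /nbhs_ballP[e /= e0 he] : nbhs x Omega by exact: (open_nbhs_nbhs (conj oO (KO _ Kx))).
  exists (e / 4); split=> [|_ y xy]; first by rewrite divr_gt0.
  apply: he; rewrite -ball_normE /= distrC; apply: le_lt_trans xy _; lra.
have U (s : seq X) : (forall x, x \in s -> K x) ->
    exists (chi : X -> R) A, [/\ smooth setT chi, compact A, A `<=` Omega,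
    forall x, ~ A x -> chi x = 0 &
    forall x, (exists2 c, c \in s & `|x - c| <= r c) -> chi x = 1].
  elim: s => [|c s IH] sK.
    exists (fun=> 0), set0; split => //.
    - exact: (smooth_cst (0 : R) openT).
    - exact: compact0.
    - by move=> x [].
  have [|chi [A [schi cA AO chi0 chi1]]] := IH.
    by move=> x xs; apply: sK; rewrite inE xs orbT.
  have Kc : K c by apply: sK; rewrite inE eqxx.
  have [b [sb b1 b0]] := smooth_plateau c (hr c).1.
  pose one := smooth_cst (1 : R) (@openT X).
  exists (fun x => 1 - (1 - chi x) * (1 - b x)), (A `|` [set x | `|x - c| <= 2 * r c]).
  split.
  - have s1 := smoothB openT one schi; have s2 := smoothB openT one sb.
    exact: (smoothB openT one (smoothM openT s1 s2)).
  - by apply: compactU => //; exact: compact_ball_norm.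
  - by move=> x [/AO//|]; exact: (hr c).2.
  - move=> x /not_orP[/chi0 -> /= xc]; rewrite b0 ?subr0 ?mulr1 ?subrr//.
    by rewrite ltNge; apply/negP.
  - move=> x [d]; rewrite inE => /predU1P[-> xc|ds xd].
      by rewrite (b1 _ xc) subrr mulr0 subr0.
    by rewrite chi1 ?subrr ?mul0r ?subr0//; exists d.
have /(_ _ K (fun x => ball x (r x))) [] : cover_compact K by rewrite -compact_cover.
- by move=> x _; exact: ball_open.
- by move=> x Kx; exists x => //; exact: ballxx (hr x).1.
move=> D DK KD; have [|chi [A [schi cA AO chi0 chi1]]] := U (finmap.enum_fset D).
  by move=> x /DK; rewrite inE.
exists chi, A; split=> // x /KD[c /= cD xc]; apply: chi1; exists c => //.
by move: xc; rewrite -ball_normE /= distrC => /ltW.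
Qed.

End Cutoff.

Section LeibnizBound.
Context {R : realType} {n : nat}.
Local Notation X := 'rV[R]_n.
Implicit Types (a : X -> R) (k : 'I_n -> nat).

Lemma pds_tensor (F : 'I_n -> nat -> R -> R) (tF : forall i, tower (F i)) s k :
  pds s (tensor F k) = tensor F (fun i => k i + count_mem i s)%N.
Proof.
elim: s => [|j s IH] /=; first by congr tensor; apply/funext => i; rewrite addn0.
rewrite IH pd_tensor//; congr tensor; apply/funext => i.
by rewrite -addnA; congr addn; rewrite addnC [j == i]eq_sym.
Qed.

(** The constant depends on the factors [F] only through the bound [B] on their
    derivatives of order at most [K]. This uniformity is what makes the estimate
    usable for bumps of arbitrarily small width. *)
Lemma leibniz_tensor_bound (M B : R) (K p : nat) a : 0 <= B ->
  smooth setT a -> (forall x, ~ box M x -> a x = 0) ->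
  exists2 c : R, 0 <= c & forall F k, (forall i, tower (F i)) ->
    (forall i j t, (j <= K)%N -> `|t| <= M -> `|F i j t| <= B) ->
    (forall i, (k i + p <= K)%N) ->
    forall s, size s = p -> forall x, `|pds s (fun x => a x * tensor F k x) x| <= c.
Proof.
move=> B0; elim: p a => [|p IH] a sa a0.
  have [Ca Ca0 hCa] := compact_bound (@compact_box R n M) (smoothT_continuous sa).
  exists (Ca * \prod_(i < n) B); first by rewrite mulr_ge0// prodr_ge0.
  move=> F k tF FB kK [|//] _ x /=.
  have [xM|xM] := pselect (box M x); last by rewrite a0// mul0r normr0 mulr_ge0// prodr_ge0.
  rewrite normrM; apply: ler_pM => //; first exact: hCa.
  rewrite normr_prod; apply: ler_prod => i _; rewrite normr_ge0 /=.
  by apply: FB (xM i); have := kK i; rewrite addn0.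
have /choice[c hc] : forall j : 'I_n, exists c : R, 0 <= c /\ forall F k,
    (forall i, tower (F i)) ->
    (forall i j t, (j <= K)%N -> `|t| <= M -> `|F i j t| <= B) ->
    (forall i, (k i + p <= K)%N) ->
    forall s, size s = p -> forall x, `|pds s (fun x => pd j a x * tensor F k x) x| <= c.
  move=> j; have [|c c0 h] := IH _ (smooth_pd j sa); last by exists c.
  apply: (vanish_pds [:: j]) => //; exact: closed_openC (@closed_box R n M).
have [c' c'0 hc'] := IH a sa a0.
exists (\sum_j c j + c').
  by rewrite addr_ge0// sumr_ge0// => j _; have [] := hc j.
move=> F k tF FB kK s; case/lastP: s => [//|s j]; rewrite size_rcons => -[sp] x.
have sT l := smooth_tensor tF l.
have e : pds (rcons s j) (fun x => a x * tensor F k x) x =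
  pds s (fun x => pd j a x * tensor F k x) x +
  pds s (fun x => a x * tensor F (fun i => k i + (i == j))%N x) x.
  rewrite pds_rcons -(pdsD openT); last 3 first.
  - exact: (smoothM openT (smooth_pd j sa) (sT _)).
  - exact: (smoothM openT sa (sT _)).
  - by [].
  apply: (pds_eq openT) => // y _.
  by rewrite (pdM j sa (sT k) Logic.I) pd_tensor.
rewrite e; apply: le_trans (ler_normD _ _) _; apply: lerD.
  rewrite (bigD1 j)//= ler_wpDr ?sumr_ge0//.
    by move=> l _; have [] := hc l.
  apply: (hc j).2 => // i; apply: leq_trans (kK i).
  by rewrite leq_add2l.
apply: hc' => // i; apply: leq_trans (kK i).
by rewrite addnS -addSn leq_add2r; case: (i == j); rewrite ?addn1 ?addn0.
Qed.

End LeibnizBound.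

(** * The quantitative structure theorem *)
Section PointBound.
Context {R : realType} {n : nat}.
Local Notation X := 'rV[R]_n.
Local Notation mu := (@lebesgue_measure R).
Implicit Types (g : X -> R) (x : X).

(** A value of a continuous function is a limit of its averages against product
    bumps that concentrate at the point. *)
Lemma approximate_identity_bound g x0 (M b : R) : 0 <= M -> continuous g ->
  (forall e, 0 < e -> exists q : 'I_n -> R -> R,
     [/\ forall i, continuous (q i), forall i t, 0 <= q i t,
         forall i t, M < `|t| \/ e < `|x0 0 i - t| -> q i t = 0,
         forall i, \int[mu]_t q i t = 1 &
         `|integral_Rn (fun x => g x * \prod_i q i (x 0 i))| <= b]) ->
  `|g x0| <= b.
Proof.
move=> M0 cg H; rewrite leNgt; apply/negP => bg.
have e0 : 0 < (`|g x0| - b) / 2 by rewrite divr_gt0// subr_gt0.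
set eta := (`|g x0| - b) / 2 in e0.
have [d d0 hd] := compact_uniform_continuous (A := [set x0]) (@compact_set1 _ x0) cg e0.
have d2 : 0 < d / 2 by rewrite divr_gt0.
have [q [cq q0 qz q1 hq]] := H _ d2.
pose psi (x : X) := \prod_i q i (x 0 i).
have Cpsi : Cc M psi by apply: Cc_prod => // i t tM; apply: qz; left.
have Ipsi : integral_Rn psi = 1.
  rewrite (@integral_Rn_prod _ _ M)//; first by apply: big1 => i _; exact: q1.
  by move=> i t tM; apply: qz; left.
have psi0 x : 0 <= psi x by apply: prodr_ge0.
have Cg : Cc M (fun x => g x * psi x).
  split=> [x|x xM]; last by rewrite Cpsi.2 ?mulr0.
  by have := continuousM (cg x) (Cpsi.1 x); exact.
have near_x0 x : `|g x - g x0| * psi x <= eta * psi x.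
  have [xd|xd] := ltP `|x0 - x| d.
    by apply: ler_wpM2r => //; rewrite distrC ltW// hd.
  suff -> : psi x = 0 by rewrite !mulr0.
  have [i xi] : exists i, d / 2 < `|(x0 - x) 0 i|.
    apply: contrapT => /forallNP h; move: xd; apply/negP; rewrite -ltNge.
    apply: (@le_lt_trans _ _ (d / 2)); last lra.
    by apply: norm_le_coord; [exact: ltW|move=> i; rewrite leNgt; apply/negP; exact: h].
  rewrite /psi (bigD1 i)//= qz ?mul0r//; right.
  by move: xi; rewrite !mxE.
have Cw : Cc M (fun x => g x * psi x + - g x0 * psi x).
  have := Cc_lin (- g x0) Cpsi Cg; congr Cc; apply/funext => x; by rewrite addrC.
have I1 : integral_Rn (fun x => g x * psi x + - g x0 * psi x) =
    integral_Rn (fun x => g x * psi x) - g x0.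
  have := integral_Rn_lin (- g x0) Cpsi Cg; rewrite Ipsi mulr1 addrC => <-.
  by congr integral_Rn; apply/funext => x; rewrite addrC.
have bnd : `|integral_Rn (fun x => g x * psi x) - g x0| <= eta.
  rewrite -I1 ler_norml; apply/andP; split.
    rewrite -[leLHS]mulr1 -Ipsi -(integral_RnZ _ Cpsi).
    apply: (le_integral_Rn _ Cw).
      by have := Cc_lin (- eta) Cpsi (@Cc0 R n M); congr Cc; apply/funext => x; rewrite addr0.
    move=> x; rewrite -mulrDl mulNr lerNl; apply: le_trans (near_x0 x).
    by rewrite -mulNr ler_wpM2r// -normrN ler_norm.
  rewrite -[leRHS]mulr1 -Ipsi -(integral_RnZ _ Cpsi).
  apply: (le_integral_Rn Cw).
    by have := Cc_lin eta Cpsi (@Cc0 R n M); congr Cc; apply/funext => x; rewrite addr0.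
  move=> x; rewrite -mulrDl; apply: le_trans (near_x0 x).
  by rewrite ler_wpM2r// ler_norm.
have : `|g x0| <= b + eta.
  rewrite -[g x0](subKr (integral_Rn (fun x => g x * psi x))).
  by apply: le_trans (ler_normB _ _) _; exact: lerD hq bnd.
rewrite /eta; lra.
Qed.

End PointBound.

Section BumpTower.
Context {R : realType}.
Local Notation mu := (@lebesgue_measure R).

Lemma tower_shift k (F : nat -> R -> R) : tower F -> tower (fun j => F (k + j)%N).
Proof. by move=> tF j t; rewrite addnS; exact: tF. Qed.

(** Reflecting and translating a ramp gives a function [F] that vanishes to the
    right of [c] and whose derivative of order [k + 1] is, up to sign, a bump of
    integral 1 near [c]. Vanishing on the right is what pairs with an
    antiderivative that vanishes on the left. *)
Lemma bump_tower k (N M b e c : R) : `|c| <= N -> N + 1 <= M -> 0 < e ->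
  (forall e, 0 < e -> exists F : nat -> R -> R, [/\ tower F,
    forall j u, (j <= k)%N -> u <= 0 -> F j u = 0,
    forall j u, (j <= k)%N -> u <= 2 * M -> 0 <= F j u <= b,
    forall u, e <= u -> F k u = 1 & forall u, 0 <= F k.+1 u]) ->
  exists F : nat -> R -> R, [/\ tower F,
    forall j t, (j <= k)%N -> `|t| <= M -> `|F j t| <= b,
    forall j t, (j <= k)%N -> M < t -> F j t = 0 &
    exists q : R -> R, [/\ continuous q, forall t, 0 <= q t,
      forall t, M < `|t| \/ e < `|c - t| -> q t = 0,
      \int[mu]_t q t = 1 & forall t, F k.+1 t = (-1) ^+ k.+1 * q t]].
Proof.
move=> cN NM e0 ramp.
(* A width of at most 1 keeps the bump inside the interval of radius [M]. *)
have e'0 : 0 < Num.min e 1 by rewrite lt_min e0 ltr01.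
have [F [tF Fl Fb F1 F'ge0]] := ramp _ e'0.
have e'e : Num.min e 1 <= e by rewrite ge_min lexx.
have e'1 : Num.min e 1 <= 1 by rewrite ge_min lexx orbT.
move: cN; rewrite ler_norml => /andP[cN1 cN2].
have Fneg u : u < 0 -> F k.+1 u = 0.
  apply: (tower_locally_const (c := 0) tF (@open_lt R 0)) => v /= v0.
  by apply: Fl => //; exact: ltW.
have Fpos u : Num.min e 1 < u -> F k.+1 u = 0.
  apply: (tower_locally_const (c := 1) tF (@open_gt R (Num.min e 1))) => v /= v0.
  by apply: F1; exact: ltW.
have sgn j : `|(-1) ^+ j : R| = 1 by rewrite normrX normrN normr1 expr1n.
exists (fun j t => (-1) ^+ j * F j (-1 * t + c)); split.
- exact: tower_affine.
- move=> j t jk; rewrite ler_norml => /andP[t1 t2]; rewrite normrM sgn mul1r.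
  have /andP[h1 h2] : 0 <= F j (-1 * t + c) <= b by apply: Fb => //; lra.
  by rewrite ger0_norm.
- by move=> j t jk tM; rewrite Fl ?mulr0//; lra.
pose q t := F k.+1 (-1 * t + c).
have cq : continuous q.
  have tG := tower_affine (-1) c (tower_shift k.+1 tF).
  have -> : q = (fun t => (-1) ^+ 0 * F (k.+1 + 0)%N (-1 * t + c)).
    by apply/funext => t; rewrite expr0 mul1r addn0.
  exact: (@tower_continuous _ _ 0%N tG).
have q0 t : M < `|t| -> q t = 0.
  rewrite lter_normr => /orP[tM|tM]; first by apply: Fneg; lra.
  by apply: Fpos; apply: le_lt_trans e'1 _; lra.
exists q; split=> //.
- by move=> t; exact: F'ge0.
- move=> t [/q0//|]; rewrite lter_normr => /orP[et|et].
    by apply: Fpos; apply: le_lt_trans e'e _; lra.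
  by apply: Fneg; lra.
- rewrite (Rintegral_support q0).
  have tG := tower_affine (-1) c (tower_shift k tF).
  have dG (t : R) : is_derive t 1 (fun t => - (F k (-1 * t + c))) (q t).
    have h := is_deriveN (tG 0%N t).
    have -> : (fun t => - F k (-1 * t + c)) = \- (fun t => (-1) ^+ 0 * F (k + 0)%N (-1 * t + c)).
      by apply/funext => u /=; rewrite expr0 mul1r addn0.
    by apply: (is_derive_eq h); rewrite expr1 mulN1r opprK addn1.
  rewrite (Rintegral_FTC2 _ cq dG); last by lra.
  rewrite (F1 (-1 * - M + c)); last by apply: le_trans e'1 _; lra.
  by rewrite Fl ?oppr0//; lra.
Qed.

End BumpTower.

Section Structure.
Context {R : realType} {n : nat}.
Local Notation X := 'rV[R]_n.
Local Notation mu := (@lebesgue_measure R).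
Variables (chi : X -> R) (A : set X).
Hypotheses (schi : smooth setT chi) (cA : compact A) (chi0 : forall x, ~ A x -> chi x = 0).

(** The distributional order of [f] on [A], with its constant. *)
Definition order_bound (m : nat) (C : R) (f : X -> R) := forall phi : X -> R,
  smooth setT phi -> (forall x, ~ A x -> phi x = 0) ->
  (forall s x, (size s <= m)%N -> `|pds s phi x| <= 1) ->
  `|integral_Rn (fun x => f x * phi x)| <= C.

Lemma smooth_mul_support (Omega : set X) (f h : X -> R) : open Omega ->
  A `<=` Omega -> smooth Omega f -> smooth setT h -> (forall x, ~ A x -> h x = 0) ->
  smooth setT (fun x => h x * f x).
Proof.
move=> oO AO sf sh h0.
have oA : open (~` A) := closed_openC (compact_closed_rV cA).
have -> : [set: X] = Omega `|` ~` A.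
  apply/seteqP; split => // x _; have [Ax|nAx] := pselect (A x); [left; exact: AO|by right].
apply: smooth_setU.
  exact: (smoothM oO (smoothS (@subsetT _ _) sh) sf).
apply: (eq_smooth (f := fun=> 0) oA); last exact: (smooth_cst (0 : R) oA).
by move=> x nAx; rewrite h0// mul0r.
Qed.

Lemma vanish_right_tensor (M : R) (k : nat) (F : 'I_n -> nat -> R -> R) l :
  (forall i j t, (j <= k)%N -> M < t -> F i j t = 0) -> (forall i, (l i <= k)%N) ->
  vanish_right M (tensor F l).
Proof. by move=> F0 lk x [i xi]; rewrite /tensor (bigD1 i)//= F0 ?mul0r. Qed.

Variables (Omega : set X) (oO : open Omega) (AO : A `<=` Omega).

(** Moves the [m + 2] derivatives in each variable from the tensor product back
    to [G]. What remains is the pairing of [f] with [chi * tensor F l], which is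
    [c] times a function that the order bound of [f] applies to. *)
Lemma tensor_pairing (m : nat) (C c M : R) (s : seq 'I_n) (f G : X -> R)
    (F : 'I_n -> nat -> R -> R) (l : 'I_n -> nat) :
  (forall i, count_mem i s = m.+2) -> 0 <= M -> A `<=` box M -> 0 < c ->
  smooth Omega f -> order_bound m C f ->
  smooth setT G -> vanish_left M G -> (forall x, pds s G x = chi x * f x) ->
  (forall i, tower (F i)) ->
  (forall i j t, (j <= m.+1)%N -> M < t -> F i j t = 0) ->
  (forall i, (l i <= m.+1)%N) ->
  (forall s x, (size s <= m)%N -> `|pds s (fun x => chi x * tensor F l x) x| <= c) ->
  `|integral_Rn (fun x => G x * tensor F (fun i => l i + m.+2)%N x)| <= C * c.
Proof.
move=> sm M0 AM c0 sf fC sG vG GE tF F0 lm hc.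
have sT := smooth_tensor tF l.
have vT := vanish_right_tensor F0 lm.
have h := integral_Rn_by_parts_seq s M0 sG sT vG vT.
have E1 : pds (rev s) (tensor F l) = tensor F (fun i => l i + m.+2)%N.
  by rewrite pds_tensor//; congr tensor; apply/funext => i; rewrite count_rev sm.
rewrite E1 in h.
have sgn : `|(-1) ^+ size s : R| = 1 by rewrite normrX normrN normr1 expr1n.
have -> : `|integral_Rn (fun x => G x * tensor F (fun i => l i + m.+2)%N x)| =
    `|integral_Rn (fun x => pds s G x * tensor F l x)|.
  by rewrite h normrM sgn mul1r.
pose phi x := c^-1 * (chi x * tensor F l x).
have schiT := smoothM openT schi sT.
have sphi : smooth setT phi by exact: (smoothZ openT c^-1 schiT).
have := fC phi sphi _ _.
have -> : (fun x => f x * phi x) = (fun x => c^-1 * (pds s G x * tensor F l x)).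
  by apply/funext => x; rewrite /phi GE; ring.
have Cci : Cc M (fun x => pds s G x * tensor F l x).
  exact: (Cc_left_right (smooth_pds s sG) sT (vanish_left_pds s vG) vT).
rewrite (integral_RnZ _ Cci) normrM (gtr0_norm (x := c^-1)) ?invr_gt0//.
rewrite ler_pdivrMl// mulrC; apply.
  by move=> x Ax; rewrite /phi chi0// mul0r mulr0.
move=> t x tm; rewrite /phi (pdsZ openT _ _ schiT Logic.I) normrM.
by rewrite (gtr0_norm (x := c^-1)) ?invr_gt0// ler_pdivrMl// mulr1 hc.
Qed.

(** The word [s] takes [m + 2] derivatives in each variable: [m] are consumed by
    the order of [f], one by the passage from a bounded step to a bump, and one
    by the bound on the first derivatives of [G]. The function [B] is chosen
    before [f], so that it remains standard when the theorem is transferred. *)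
Theorem bounded_antiderivative (m : nat) (C : R) (s : seq 'I_n) :
  (forall i, count_mem i s = m.+2) ->
  exists B : R -> R, forall f, smooth Omega f -> order_bound m C f ->
    exists G, [/\ smooth setT G, forall x, pds s G x = chi x * f x &
      forall N x, box N x -> `|G x| <= B N /\ forall i, `|pd i G x| <= B N].
Proof.
move=> sm.
have [M0 M00 AM0] := compact_in_box cA.
pose k := m.+1.
have /choice[B hB] : forall N : R, exists B : R, forall f, smooth Omega f ->
    order_bound m C f -> forall G, smooth setT G -> vanish_left M0 G ->
    (forall x, pds s G x = chi x * f x) ->
    forall x, box N x -> `|G x| <= B /\ forall i, `|pd i G x| <= B.
  move=> N; pose M := Num.max M0 (N + 1).
  have M_ge0 : 0 <= M by rewrite le_max M00.
  have D0 : 0 <= 2 * M by rewrite mulr_ge0.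
  have NM : N + 1 <= M by rewrite le_max lexx orbT.
  have M0M : M0 <= M by rewrite le_max lexx.
  have [b b0 ramp] := smooth_ramp k D0.
  have AM : A `<=` box M by move=> x /AM0 xM i; exact: le_trans (xM i) M0M.
  have chiM x : ~ box M x -> chi x = 0.
    by move=> xM; apply: chi0 => /AM.
  have /choice[c hc] : forall p : nat, exists c : R, 0 <= c /\ forall F l,
    (forall i, tower (F i)) ->
    (forall i j t, (j <= k)%N -> `|t| <= M -> `|F i j t| <= b) ->
    (forall i, (l i + p <= k)%N) ->
    forall s, size s = p -> forall x, `|pds s (fun x => chi x * tensor F l x) x| <= c.
    by move=> p; have [c c0 h] := leibniz_tensor_bound k p b0 schi chiM; exists c.
  pose c' := \sum_(p < m.+1) c p + 1.
  have cp0 p : 0 <= c p by have [] := hc p.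
  have c'0 : 0 < c' by rewrite ltr_wpDl// sumr_ge0.
  (* The constants [b] of the ramps and [c'] of the Leibniz estimate are now
     fixed; the width [e] of the bump is introduced only below. *)
  exists (C * c') => f sf fC G sG vG0 GE x0 x0N.
  have vG : vanish_left M G.
    by move=> x [i xi]; apply: vG0; exists i; apply: lt_le_trans xi _; rewrite lerN2.
  have test (e : R) : 0 < e -> exists F : 'I_n -> nat -> R -> R, [/\ forall i, tower (F i),
      forall i j t, (j <= k)%N -> `|t| <= M -> `|F i j t| <= b,
      forall i j t, (j <= k)%N -> M < t -> F i j t = 0 &
      exists q : 'I_n -> R -> R, [/\ forall i, continuous (q i), forall i t, 0 <= q i t,
         forall i t, M < `|t| \/ e < `|x0 0 i - t| -> q i t = 0,
         forall i, \int[mu]_t q i t = 1 &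
         forall i t, F i k.+1 t = (-1) ^+ k.+1 * q i t]].
    move=> e0.
    have /choice[F hF] := fun i => bump_tower (x0N i) NM e0 ramp.
    exists F; split; try by move=> i; have [] := hF i.
    have /choice[q hq] : forall i, exists q, _ := fun i => let: And4 _ _ _ h := hF i in h.
    by exists q; split=> i; have [] := hq i.
  have pair F l : (forall i, tower (F i)) ->
      (forall i j t, (j <= k)%N -> `|t| <= M -> `|F i j t| <= b) ->
      (forall i j t, (j <= k)%N -> M < t -> F i j t = 0) ->
      (forall i, (l i <= 1)%N) ->
      `|integral_Rn (fun x => G x * tensor F (fun i => l i + k.+1)%N x)| <= C * c'.
    move=> tF Fb F0 l1.
    apply: (tensor_pairing sm M_ge0 AM c'0 sf fC sG vG GE tF F0).
      by move=> i; apply: leq_trans (l1 i) _.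
    move=> t x tm; apply: (@le_trans _ _ (c (size t))).
      apply: (hc (size t)).2 => // i; rewrite /k -add1n; exact: leq_add.
    rewrite /c' (bigD1 (Ordinal (tm : (size t < m.+1)%N)))//=.
    by rewrite -addrA lerDl addr_ge0// sumr_ge0.
  have finish (g : X -> R) : continuous g -> (forall F, (forall i, tower (F i)) ->
      (forall i j t, (j <= k)%N -> `|t| <= M -> `|F i j t| <= b) ->
      (forall i j t, (j <= k)%N -> M < t -> F i j t = 0) ->
      `|integral_Rn (fun x => g x * tensor F (fun=> k.+1) x)| <= C * c') ->
      `|g x0| <= C * c'.
    move=> cg hg; apply: (approximate_identity_bound M_ge0 cg) => e /test.
    move=> [F [tF Fb F0 [q [cq q0 qz q1 Fq]]]]; exists q; split=> //.
    pose sg : R := \prod_(i < n) (-1) ^+ k.+1.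
    have sg1 : `|sg| = 1.
      by rewrite normr_prod big1// => i _; rewrite normrX normrN normr1 expr1n.
    have Cq : Cc M (fun x => g x * \prod_i q i (x 0 i)).
      have [cp p0] := @Cc_prod R n M q cq (fun i t tM => qz i t (or_introl tM)).
      split=> [x|x xM]; last by rewrite p0 ?mulr0.
      by have := continuousM (cg x) (cp x); exact.
    have := hg F tF Fb F0.
    have -> : (fun x => g x * tensor F (fun=> k.+1) x) =
        (fun x => sg * (g x * \prod_i q i (x 0 i))).
      apply/funext => x; rewrite mulrCA /tensor; congr (_ * _).
      by rewrite /sg -big_split; apply: eq_bigr => i _; exact: Fq.
    by rewrite (integral_RnZ _ Cq) normrM sg1 mul1r.
  split.
    apply: finish (smoothT_continuous sG) _ => F tF Fb F0.
    exact: (pair F (fun=> 0%N)).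
  move=> i; apply: finish (smoothT_continuous (smooth_pd i sG)) _ => F tF Fb F0.
  have sT := smooth_tensor tF (fun=> k.+1).
  have vT : vanish_right M (tensor F (fun=> k.+1)).
    have -> : tensor F (fun=> k.+1) = pds s (tensor F (fun=> 0%N)).
      by rewrite pds_tensor//; congr tensor; apply/funext => j; rewrite sm.
    by apply: vanish_right_pds; exact: vanish_right_tensor F0 _.
  rewrite (integral_Rn_by_parts M_ge0 sG sT).
  - rewrite normrN pd_tensor//.
    have -> : (fun j => (k.+1 + (j == i))%N) = (fun j => ((j == i) + k.+1)%N).
      by apply/funext => j; rewrite addnC.
    by apply: (pair F (fun j => (j == i) : nat)) => // j; case: (j == i).
  - exact: (Cc_left_right sG sT vG vT).
  - exact: (Cc_left_right (smooth_pd i sG) sT (vanish_left_pds [:: i] vG) vT).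
  - exact: (Cc_left_right sG (smooth_pd i sT) vG (vanish_right_pds [:: i] vT)).
exists B => f sf fC.
have sh := smooth_mul_support oO AO sf schi chi0.
have vh : vanish_left M0 (fun x => chi x * f x).
  move=> x [i xi]; rewrite chi0 ?mul0r// => /AM0/(_ i).
  by rewrite ler_norml => /andP[]; rewrite leNgt xi.
have [G [sG vG GE]] := exists_antiderivative s M00 sh vh.
exists G; split=> // [x|N x xN]; first by rewrite GE.
by apply: hB fC _ sG vG _ _ xN => // y; rewrite GE.
Qed.

End Structure.

(** * Complex-valued functions *)
Section ComplexNorm.
Context {R : realType}.
Local Notation C := (Rcomplex R).
Implicit Types (z w : C).

Definition mkC (a b : R) : C := (a +i* b)%C.
Definition re z : R := complex.Re z.
Definition im z : R := complex.Im z.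

Lemma mkC_eta z : z = mkC (re z) (im z). Proof. by case: z. Qed.
Lemma reB z w : re (z - w) = re z - re w. Proof. by case: z; case: w. Qed.
Lemma imB z w : im (z - w) = im z - im w. Proof. by case: z; case: w. Qed.
Lemma reZ (a : R) z : re (a *: z) = a * re z. Proof. by case: z. Qed.
Lemma imZ (a : R) z : im (a *: z) = a * im z. Proof. by case: z. Qed.
Lemma reM z w : re (z * w) = re z * re w - im z * im w. Proof. by case: z; case: w. Qed.
Lemma imM z w : im (z * w) = re z * im w + im z * re w. Proof. by case: z; case: w. Qed.

Lemma normC_def z : `|z| = Num.sqrt (re z ^+ 2 + im z ^+ 2).
Proof. by case: z. Qed.

Lemma re_le_norm z : `|re z| <= `|z|.
Proof. by rewrite normC_def -sqrtr_sqr ler_wsqrtr// lerDl sqr_ge0. Qed.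

Lemma im_le_norm z : `|im z| <= `|z|.
Proof. by rewrite normC_def -sqrtr_sqr ler_wsqrtr// lerDr sqr_ge0. Qed.

Lemma norm_le_reim z : `|z| <= `|re z| + `|im z|.
Proof.
rewrite normC_def -[leRHS]ger0_norm ?addr_ge0// -sqrtr_sqr ler_wsqrtr//.
rewrite -subr_ge0 (_ : _ - _ = (`|re z| * `|im z|) *+ 2) ?mulrn_wge0 ?mulr_ge0//.
by rewrite sqrrD !real_normK ?num_real//; ring.
Qed.

End ComplexNorm.

Section ComplexSmooth.
Context {R : realType} {n : nat}.
Local Notation X := 'rV[R]_n.
Local Notation C := (Rcomplex R).
Implicit Types (f g phi : X -> C) (u v : X -> R) (Omega : set X) (x : X).

Definition mkCf u v : X -> C := fun x => mkC (u x) (v x).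
Definition ref f : X -> R := fun x => re (f x).
Definition imf f : X -> R := fun x => im (f x).

Lemma is_derive_complex f x y (l : C) : is_derive x y f l <->
  is_derive x y (ref f) (re l) /\ is_derive x y (imf f) (im l).
Proof.
split=> [/is_derive_epsP H|[/is_derive_epsP H1 /is_derive_epsP H2]].
  split; apply/is_derive_epsP => e /H[d d0 hd]; exists d => // h h0 hdd.
    apply: le_trans (hd h h0 hdd); apply: le_trans (re_le_norm _).
    by rewrite reB reZ reB.
  apply: le_trans (hd h h0 hdd); apply: le_trans (im_le_norm _).
  by rewrite imB imZ imB.
apply/is_derive_epsP => e e0; have e2 : 0 < e / 2 by rewrite divr_gt0.
have [d1 d10 h1] := H1 _ e2; have [d2 d20 h2] := H2 _ e2.
exists (Num.min d1 d2); first by rewrite lt_min d10.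
move=> h h0; rewrite lt_min => /andP[hd1 hd2].
apply: le_trans (norm_le_reim _) _; rewrite reB reZ reB imB imZ imB (splitr e).
by apply: lerD; [exact: h1|exact: h2].
Qed.

Lemma continuous_complex f x : {for x, continuous f} <->
  {for x, continuous (ref f)} /\ {for x, continuous (imf f)}.
Proof.
split=> [/continuous_epsP H|[/continuous_epsP H1 /continuous_epsP H2]].
  split; apply/continuous_epsP => e /H[d d0 hd]; exists d => // y xy.
    by apply: le_trans (hd y xy); apply: le_trans (re_le_norm _); rewrite reB.
  by apply: le_trans (hd y xy); apply: le_trans (im_le_norm _); rewrite imB.
apply/continuous_epsP => e e0; have e2 : 0 < e / 2 by rewrite divr_gt0.
have [d1 d10 h1] := H1 _ e2; have [d2 d20 h2] := H2 _ e2.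
exists (Num.min d1 d2); first by rewrite lt_min d10.
move=> y; rewrite lt_min => /andP[hd1 hd2].
apply: le_trans (norm_le_reim _) _; rewrite reB imB (splitr e).
by apply: lerD; [exact: h1|exact: h2].
Qed.

Lemma pd_complex f x i : derivable f x (delta_mx 0 i) ->
  pd i (ref f) x = re (pd i f x) /\ pd i (imf f) x = im (pd i f x).
Proof.
move=> d; have /is_derive_complex[[_ h1] [_ h2]] := derivableP d.
by split.
Qed.

(** Smoothness and derivatives of complex functions reduce to real and imaginary
    parts, since the modulus is equivalent to the maximum of their absolute
    values. *)
Lemma pds_complex Omega f s x : open Omega -> smooth Omega f -> Omega x ->
  pds s (ref f) x = re (pds s f x) /\ pds s (imf f) x = im (pds s f x).
Proof.
move=> oO sf; elim: s x => [//|i s IH] x Ox.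
have [h1 h2] := pd_complex (smooth_derivable i (smooth_pds s sf) Ox).
split.
  rewrite -[RHS]h1; apply: near_pd; apply: (open_near oO Ox) => y Oy.
  by have [] := IH y Oy.
rewrite -[RHS]h2; apply: near_pd; apply: (open_near oO Ox) => y Oy.
by have [] := IH y Oy.
Qed.

Lemma smooth_complex Omega f : open Omega ->
  smooth Omega f <-> smooth Omega (ref f) /\ smooth Omega (imf f).
Proof.
move=> oO; split=> [sf|[su sv]].
  have N s x : Omega x -> (\near x, ref (pds s f) x = pds s (ref f) x) /\
      (\near x, imf (pds s f) x = pds s (imf f) x).
    move=> Ox; split; apply: (open_near oO Ox) => y Oy;
      by have [] := pds_complex s oO sf Oy.
  split=> s x Ox; have [n1 n2] := N s x Ox; have [c d] := sf s x Ox;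
      have [c1 c2] := (continuous_complex _ _).1 c; split=> [|i].
  - exact: near_continuous n1 c1.
  - have /is_derive_complex[[d1 _] _] := derivableP (d i).
    exact: near_eq_derivable n1 d1.
  - exact: near_continuous n2 c2.
  - have /is_derive_complex[_ [d2 _]] := derivableP (d i).
    exact: near_eq_derivable n2 d2.
have D (s : seq 'I_n) x i : Omega x -> is_derive x (delta_mx 0 i)
    (mkCf (pds s (ref f)) (pds s (imf f)))
    (mkC (pds (i :: s) (ref f) x) (pds (i :: s) (imf f) x)).
  move=> Ox; apply/is_derive_complex; split; apply: derivableP.
    exact: (smooth_derivable i (smooth_pds s su) Ox).
  exact: (smooth_derivable i (smooth_pds s sv) Ox).
have E (s : seq 'I_n) x : Omega x -> pds s f x = mkCf (pds s (ref f)) (pds s (imf f)) x.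
  elim: s x => [|i s IH] x Ox; first exact: mkC_eta.
  have [_ h] := D s x i Ox; apply: etrans h.
  by apply: near_pd; exact: (open_near oO Ox IH).
move=> s x Ox.
have e : \near x, mkCf (pds s (ref f)) (pds s (imf f)) x = pds s f x.
  by apply: (open_near oO Ox) => y Oy; rewrite E.
split=> [|i].
  apply: (near_continuous e); apply/continuous_complex; split.
    exact: (smooth_continuous (smooth_pds s su) Ox).
  exact: (smooth_continuous (smooth_pds s sv) Ox).
by have [d _] := D s x i Ox; exact: near_eq_derivable e d.
Qed.

End ComplexSmooth.

Section ComplexPairing.
Context {R : realType} {n : nat}.
Local Notation X := 'rV[R]_n.
Local Notation C := (Rcomplex R).
Implicit Types (f g phi : X -> C) (u v : X -> R) (Omega A : set X) (x : X).

Lemma pds_pd_comm u s i : smooth setT u -> pd i (pds s u) = pds s (pd i u).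
Proof.
move=> su; elim: s => //= j s <-.
exact: (pdC i j (smooth_pds s su)).
Qed.

Lemma pds_perm u (s t : seq 'I_n) : smooth setT u -> perm_eq s t -> pds s u = pds t u.
Proof.
elim: s t => [|i s IH] t su pst.
  by have /perm_nilP-> : perm_eq t [::] by rewrite perm_sym.
have /path.splitPr it : i \in t by rewrite -(perm_mem pst) inE eqxx.
case: it pst => t1 t2 pst.
rewrite -cat1s pds_cat (IH (t1 ++ t2) su); last first.
  by move: pst; rewrite perm_sym -cat1s perm_catCA /= perm_cons perm_sym.
rewrite !pds_cat -cat1s pds_cat.
exact: (pds_pd_comm t1 i (smooth_pds t2 su)).
Qed.

(** A multi-index as a word of coordinates, the link between [mderiv] and
    [pds]. *)
Definition mseq (alpha : 'I_n -> nat) : seq 'I_n :=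
  flatten [seq nseq (alpha i) i | i <- enum 'I_n].

Lemma mderivE alpha f : mderiv alpha f = pds (mseq alpha) f.
Proof.
rewrite /mderiv /mseq; elim: (enum 'I_n) => //= i r ->.
rewrite pds_cat; elim: (alpha i) => //= k ->; reflexivity.
Qed.

Lemma count_mseq alpha i : count_mem i (mseq alpha) = alpha i.
Proof.
rewrite /mseq count_flatten -map_comp sumnE big_map big_enum_cond/=.
rewrite (bigD1 i)//= big1 ?addn0 => [|j /negPf ji]; rewrite count_nseq /=.
  by rewrite eqxx mul1n.
by rewrite ji.
Qed.

Lemma perm_mseq alpha beta :
  perm_eq (mseq alpha ++ mseq beta) (mseq (fun i => alpha i + beta i)%N).
Proof. by apply/allP => i _ /=; rewrite count_cat !count_mseq. Qed.

Lemma fsupp_out f x : ~ fsupp f x -> f x = 0.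
Proof.
by move=> h; apply/eqP; apply: contra_notT h => fx; exact: subset_closure.
Qed.

Lemma open_fsuppC f : open (~` fsupp f).
Proof. exact: closed_openC (@closed_closure _ _). Qed.

Lemma pds_fsupp_out f s x : ~ fsupp f x -> pds s f x = 0.
Proof.
move=> h; have -> : 0 = pds s (fun=> 0 : C) x by rewrite pds_cst0.
have hx : (~` fsupp f) x := h.
apply: near_pds; exact: (open_near (@open_fsuppC f) hx (fun y => @fsupp_out f y)).
Qed.

Lemma fsupp_pds f s : fsupp (pds s f) `<=` fsupp f.
Proof.
move=> x hx; apply: closed_closure; apply: closureS hx => y /= yn.
by apply: contrapT => h; move: yn; rewrite pds_fsupp_out ?eqxx.
Qed.

Lemma testfun_smooth Omega phi : testfun Omega phi -> smooth setT phi.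
Proof.
move=> [[sphi _] _ sub].
have -> : [set: X] = Omega `|` ~` fsupp phi.
  apply/seteqP; split => // x _.
  by have [/sub|] := pselect (fsupp phi x); [left|right].
apply: smooth_setU => //.
have o := @open_fsuppC phi.
have s0 := smooth_cst (0 : C) o.
have h1 := eq_smooth o _ s0.
by apply: h1 => x /fsupp_out.
Qed.

(** This keeps finite test functions stable under [mderiv], together with
    [mderiv_mderiv]. *)
Lemma testfun_mderiv Omega phi alpha : testfun Omega phi ->
  testfun Omega (mderiv alpha phi).
Proof.
move=> tphi; have sphi := testfun_smooth tphi.
case: tphi => [[_ out] cs sub]; rewrite mderivE.
split; [split| |].
- have := smooth_pds (mseq alpha) sphi; exact: smoothS.
- by move=> x xO; apply: pds_fsupp_out => /sub.
- by apply: subclosed_compact cs (@fsupp_pds phi _); exact: closed_closure.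
- by move=> x /fsupp_pds/sub.
Qed.

Lemma complex_ext f g : ref f = ref g -> imf f = imf g -> f = g.
Proof.
move=> h1 h2; apply/funext => x; rewrite (mkC_eta (f x)) (mkC_eta (g x)).
by congr mkC; [have := congr1 (@^~ x) h1|have := congr1 (@^~ x) h2].
Qed.

Lemma ref_pds f s : smooth setT f -> ref (pds s f) = pds s (ref f).
Proof.
by move=> sf; apply/funext => x; have [] := pds_complex s openT sf (x := x) Logic.I.
Qed.

Lemma imf_pds f s : smooth setT f -> imf (pds s f) = pds s (imf f).
Proof.
by move=> sf; apply/funext => x; have [] := pds_complex s openT sf (x := x) Logic.I.
Qed.

Lemma mderiv_mderiv Omega phi alpha beta : testfun Omega phi ->
  mderiv beta (mderiv alpha phi) = mderiv (fun i => beta i + alpha i)%N phi.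
Proof.
move=> /testfun_smooth sphi; rewrite !mderivE -pds_cat.
have [su sv] := (smooth_complex phi openT).1 sphi.
apply: complex_ext; rewrite ?ref_pds ?imf_pds//.
  exact: (pds_perm su (perm_mseq _ _)).
exact: (pds_perm sv (perm_mseq _ _)).
Qed.

End ComplexPairing.

Lemma smooth_mkCf {R : realType} {n : nat} (Omega : set 'rV[R]_n)
    (u v : 'rV[R]_n -> R) : open Omega -> smooth Omega u -> smooth Omega v ->
  smooth Omega (mkCf u v).
Proof.
move=> oO su sv; have h := (smooth_complex (mkCf u v) oO).2.
have ru : ref (mkCf u v) = u by [].
have iv : imf (mkCf u v) = v by [].
by rewrite ru iv in h; exact: h (conj su sv).
Qed.

Section ComplexIntegral.
Context {R : realType} {n : nat}.
Local Notation X := 'rV[R]_n.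
Local Notation C := (Rcomplex R).
Implicit Types (f g phi : X -> C) (u v w : X -> R) (Omega A K : set X) (x : X).

Lemma cintegral_re_im Omega f phi : (forall x, ~ Omega x -> phi x = 0) ->
  re (cintegral Omega (fun x => f x * phi x)) =
    integral_Rn (fun x => ref f x * ref phi x - imf f x * imf phi x) /\
  im (cintegral Omega (fun x => f x * phi x)) =
    integral_Rn (fun x => ref f x * imf phi x + imf f x * ref phi x).
Proof.
move=> phi0.
have E : patch (fun=> 0) Omega (fun x => f x * phi x) = fun x => f x * phi x.
  apply/funext => x; rewrite patchE; case: ifPn => // /negP xO.
  by rewrite phi0 ?mulr0// => Ox; apply: xO; rewrite inE.
by rewrite /cintegral E; split; congr integral_Rn; apply/funext => x;
  [exact: reM|exact: imM].
Qed.

Section OneDomain.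
Variables (Omega A : set X) (M : R).
Hypotheses (oO : open Omega) (cA : compact A) (AO : A `<=` Omega).
Hypotheses (M0 : 0 <= M) (AM : A `<=` box M).

Definition supported u := forall x, ~ A x -> u x = 0.

Lemma supported_pds u s : supported u -> supported (pds s u).
Proof.
by move=> u0 x xA; apply: (vanish_pds s (closed_openC (compact_closed_rV cA))).
Qed.

Lemma supported_Cc u v : smooth Omega v -> smooth setT u -> supported u ->
  Cc M (fun x => u x * v x).
Proof.
move=> sv su u0; split; last by move=> x xM; rewrite u0 ?mul0r// => /AM.
exact: smoothT_continuous (smooth_mul_support cA oO AO sv su u0).
Qed.

(** The function [v] is smooth on [Omega] only. Off [A] the product [u * v]
    vanishes whatever the values of [v] are, so it is smooth everywhere. *)
Lemma integral_by_parts1 u v i : smooth Omega v -> smooth setT u -> supported u ->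
  integral_Rn (fun x => u x * pd i v x) = - integral_Rn (fun x => pd i u x * v x).
Proof.
move=> sv su u0; apply/eqP; rewrite -addr_eq0; apply/eqP.
have c1 := supported_Cc sv su u0.
have c2 := supported_Cc (smooth_pd i sv) su u0.
have c3 := supported_Cc sv (smooth_pd i su) (@supported_pds u [:: i] u0).
rewrite addrC -(integral_RnD c3 c2).
have c4 : Cc M (fun x => pd i u x * v x + u x * pd i v x).
  have := Cc_lin 1 c3 c2; congr Cc; apply/funext => x; by rewrite mul1r.
apply: (integral_Rn_derive (i := i) M0 c1 c4) => x.
have suv := smooth_mul_support cA oO AO sv su u0.
have h := smooth_is_derive x i suv.
apply: (is_derive_eq h).
have [Ox|nOx] := pselect (Omega x).
  by rewrite (pdM i (smoothS (@subsetT _ Omega) su) sv Ox).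
have xA : ~ A x by move=> /AO.
have -> : pd i u x = 0 := @supported_pds u [:: i] u0 x xA.
rewrite u0// !mul0r addr0.
apply: (@supported_pds (fun x => u x * v x) [:: i]) => // y yA.
by rewrite u0// mul0r.
Qed.

Lemma integral_by_parts_seq u v s : smooth Omega v -> smooth setT u -> supported u ->
  integral_Rn (fun x => u x * pds s v x) =
  (-1) ^+ size s * integral_Rn (fun x => pds s u x * v x).
Proof.
move=> sv su u0.
have ps : perm_eq s (rev s) by rewrite perm_sym perm_rev.
rewrite (pds_perm su ps) {ps}.
elim: s u su u0 => [|i s IH] u su u0; first by rewrite expr0 mul1r.
rewrite (integral_by_parts1 i (smooth_pds s sv) su u0).
rewrite (IH _ (smooth_pd i su) (@supported_pds u [:: i] u0)).
by rewrite rev_cons pds_rcons exprS mulN1r mulNr.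
Qed.

End OneDomain.

Lemma testfun_components Omega phi : testfun Omega phi ->
  [/\ smooth setT (ref phi), smooth setT (imf phi), supported (fsupp phi) (ref phi) &
      supported (fsupp phi) (imf phi)].
Proof.
move=> tphi; have [su sv] := (smooth_complex phi openT).1 (testfun_smooth tphi).
have ur : supported (fsupp phi) (ref phi).
  by move=> x xs; rewrite /ref (fsupp_out xs).
have ui : supported (fsupp phi) (imf phi).
  by move=> x xs; rewrite /imf (fsupp_out xs).
exact: (And4 su sv ur ui).
Qed.

Lemma testfun_out Omega phi x : testfun Omega phi -> ~ Omega x -> phi x = 0.
Proof. by move=> [[_ h] _ _]; exact: h. Qed.

(** Only the modulus is compared, which absorbs the sign of the integration by
    parts. *)
Lemma cintegral_by_parts Omega K f g phi alpha : open Omega ->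
  Cinf Omega g -> testfun Omega phi -> fsupp phi `<=` K -> K `<=` Omega ->
  (forall x, K x -> f x = mderiv alpha g x) ->
  `|cintegral Omega (fun x => f x * phi x)| =
  `|cintegral Omega (fun x => g x * mderiv alpha phi x)|.
Proof.
move=> oO [sg _] tphi phiK KO fg.
have [su sv u0 v0] := testfun_components tphi.
have tphi' := testfun_mderiv alpha tphi.
have [cA AO] : compact (fsupp phi) /\ fsupp phi `<=` Omega by case: tphi.
have [M M0 AM] := compact_in_box cA.
have [sgr sgi] := (smooth_complex g oO).1 sg.
set s := mseq alpha.
have fE : (fun x => f x * phi x) = (fun x => pds s g x * phi x).
  apply/funext => x; have [xs|xs] := pselect (fsupp phi x).
    by rewrite fg ?mderivE//; exact: phiK.
  by rewrite (fsupp_out xs) !mulr0.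
have sphi := testfun_smooth tphi.
have rE := ref_pds s sphi; have iE := imf_pds s sphi.
pose sgn : R := (-1) ^+ size s.
have [sgr' sgi'] := (smooth_complex _ oO).1 (smooth_pds s sg).
have gE x : Omega x -> ref (pds s g) x = pds s (ref g) x /\ imf (pds s g) x = pds s (imf g) x.
  by move=> Ox; have [-> ->] := pds_complex s oO sg Ox.
have parts u v : smooth Omega v -> smooth setT u -> supported (fsupp phi) u ->
    integral_Rn (fun x => u x * pds s v x) = sgn * integral_Rn (fun x => pds s u x * v x).
  by move=> sv' su' u0'; exact: (@integral_by_parts_seq Omega (fsupp phi) M oO cA AO M0 AM u v s sv' su' u0').
have CC u v : smooth Omega v -> smooth setT u -> supported (fsupp phi) u ->
    Cc M (fun x => u x * v x).
  by move=> sv' su' u0'; exact: (supported_Cc oO cA AO AM sv' su' u0').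
have sp u : supported (fsupp phi) u -> supported (fsupp phi) (pds s u).
  exact: supported_pds.
have sO := smooth_pds s.
pose P u v := integral_Rn (fun x => u x * v x).
have split_re (u1 u2 v1 v2 : X -> R) : Cc M (fun x => u1 x * v1 x) -> Cc M (fun x => u2 x * v2 x) ->
    integral_Rn (fun x => v1 x * u1 x - v2 x * u2 x) = P u1 v1 - P u2 v2.
  move=> c1 c2; rewrite /P -(integral_RnB c1 c2); congr integral_Rn.
  by apply/funext => x; rewrite mulrC [v2 x * _]mulrC.
have split_im (u1 u2 v1 v2 : X -> R) : Cc M (fun x => u1 x * v1 x) -> Cc M (fun x => u2 x * v2 x) ->
    integral_Rn (fun x => v1 x * u1 x + v2 x * u2 x) = P u1 v1 + P u2 v2.
  move=> c1 c2; rewrite /P -(integral_RnD c1 c2); congr integral_Rn.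
  by apply/funext => x; rewrite mulrC [v2 x * _]mulrC.
have sub (u v v' : X -> R) : supported (fsupp phi) u -> (forall x, Omega x -> v x = v' x) ->
    P u v = P u v'.
  move=> u0' vv'; congr integral_Rn; apply/funext => x.
  have [xs|xs] := pselect (fsupp phi x); first by rewrite vv'//; exact: AO.
  by rewrite u0'// !mul0r.
have E1 x : Omega x -> ref (pds s g) x = pds s (ref g) x by move=> /gE[].
have E2 x : Omega x -> imf (pds s g) x = pds s (imf g) x by move=> /gE[].
have [l1 l2] := @cintegral_re_im Omega (pds s g) phi (fun x => @testfun_out _ _ x tphi).
have [r1 r2] := @cintegral_re_im Omega g _ (fun x => @testfun_out _ _ x tphi').
have suO := smooth_pds s su; have svO := smooth_pds s sv.
(* The bilinear pairing is split into its four real pairings, and the integration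
   by parts is performed on each. *)
have key : cintegral Omega (fun x => pds s g x * phi x) =
    sgn *: cintegral Omega (fun x => g x * mderiv alpha phi x).
  rewrite [LHS]mkC_eta [RHS]mkC_eta reZ imZ l1 l2 r1 r2 mderivE rE iE.
  rewrite !split_re ?split_im; try (by apply: CC => //; exact: sp).
  rewrite !(sub _ _ _ _ E1)// !(sub _ _ _ _ E2)//.
  rewrite /P !parts// -!mulrBr -!mulrDr.
  by congr mkC.
rewrite fE key normrZ.
have -> : `|sgn| = 1 by rewrite normrX normrN normr1 expr1n.
by rewrite mul1r.
Qed.

Lemma cintegral_bound Omega g phi (M B b : R) : open Omega -> 0 <= M ->
  Cinf Omega g -> testfun Omega phi -> fsupp phi `<=` box M -> 0 <= b ->
  (forall x, Omega x -> box M x -> `|g x| <= B) -> (forall x, `|phi x| <= b) ->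
  `|cintegral Omega (fun x => g x * phi x)| <= 4 * (`|B| * b) * (2 * M) ^+ n.
Proof.
move=> oO M0 [sg _] tphi AM b0 gB phib.
have [su sv u0 v0] := testfun_components tphi.
have [cA AO] : compact (fsupp phi) /\ fsupp phi `<=` Omega by case: tphi.
have [sgr sgi] := (smooth_complex g oO).1 sg.
have [l1 l2] := @cintegral_re_im Omega g phi (fun x => @testfun_out _ _ x tphi).
have CC u v : smooth Omega v -> smooth setT u -> supported (fsupp phi) u ->
    Cc M (fun x => u x * v x).
  by move=> sv' su' u0'; exact: (supported_Cc oO cA AO AM sv' su' u0').
have c1 := CC _ _ sgr su u0; have c2 := CC _ _ sgi sv v0.
have c3 := CC _ _ sgr sv v0; have c4 := CC _ _ sgi su u0.
have bnd (u v : X -> R) : supported (fsupp phi) u -> (forall x, `|u x| <= b) ->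
    (forall x, Omega x -> box M x -> `|v x| <= B) -> Cc M (fun x => u x * v x) ->
    `|integral_Rn (fun x => u x * v x)| <= (`|B| * b) * (2 * M) ^+ n.
  move=> u0' ub vB c; apply: (integral_Rn_bound M0 c) => x.
  have [xs|xs] := pselect (fsupp phi x).
    rewrite normrM mulrC; apply: ler_pM => //.
    by apply: le_trans (vB x _ _) (ler_norm _); [exact: AO|exact: AM].
  by rewrite u0'// mul0r normr0 mulr_ge0.
have ub x : `|ref phi x| <= b by apply: le_trans (phib x); exact: re_le_norm.
have vb x : `|imf phi x| <= b by apply: le_trans (phib x); exact: im_le_norm.
have gr x : Omega x -> box M x -> `|ref g x| <= B.
  by move=> Ox xM; apply: le_trans (gB x Ox xM); exact: re_le_norm.
have gi x : Omega x -> box M x -> `|imf g x| <= B.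
  by move=> Ox xM; apply: le_trans (gB x Ox xM); exact: im_le_norm.
have b1 := bnd _ _ u0 ub gr c1; have b2 := bnd _ _ v0 vb gi c2.
have b3 := bnd _ _ v0 vb gr c3; have b4 := bnd _ _ u0 ub gi c4.
apply: (le_trans (norm_le_reim _)); rewrite l1 l2.
have -> : integral_Rn (fun x => ref g x * ref phi x - imf g x * imf phi x) =
    integral_Rn (fun x => ref phi x * ref g x) - integral_Rn (fun x => imf phi x * imf g x).
  rewrite -(integral_RnB c1 c2); congr integral_Rn.
  by apply/funext => x; rewrite mulrC [imf g x * _]mulrC.
have -> : integral_Rn (fun x => ref g x * imf phi x + imf g x * ref phi x) =
    integral_Rn (fun x => imf phi x * ref g x) + integral_Rn (fun x => ref phi x * imf g x).
  rewrite -(integral_RnD c3 c4); congr integral_Rn.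
  by apply/funext => x; rewrite mulrC [imf g x * _]mulrC.
set Q := `|B| * b * (2 * M) ^+ n in b1 b2 b3 b4.
have -> : 4 * (`|B| * b) * (2 * M) ^+ n = (Q + Q) + (Q + Q) by rewrite /Q; ring.
apply: lerD.
  by apply: le_trans (ler_normB _ _) _; exact: lerD.
by apply: le_trans (ler_normD _ _) _; exact: lerD.
Qed.

End ComplexIntegral.

Section ComplexStructure.
Context {R : realType} {n : nat}.
Local Notation X := 'rV[R]_n.
Local Notation C := (Rcomplex R).
Implicit Types (f g phi : X -> C) (u v w G : X -> R) (Omega A K : set X) (x y z : X).

(** Replace the coordinates of [x] by those of [y] one at a time and apply the
    mean value theorem on each segment. The intermediate points given by
    [line_MVT] are only known to be within the length of the segment, at most
    [2 * N], of a point of the box; hence the box of radius [3 * N]. *)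
Lemma coordinatewise_lipschitz G (N B : R) : smooth setT G -> 0 <= N ->
  (forall x i, box (3 * N) x -> `|pd i G x| <= B) ->
  forall x y, box N x -> box N y -> `|G x - G y| <= n%:R * B * `|x - y|.
Proof.
move=> sG N0 GB x y xN yN.
suff P (r : seq 'I_n) (d : R) : 0 <= d -> forall z, box N z -> (forall i, i \notin r -> z 0 i = y 0 i) ->
    (forall i, `|y 0 i - z 0 i| <= d) -> `|G z - G y| <= (size r)%:R * B * d.
  have := P (enum 'I_n) `|x - y| (normr_ge0 _) x xN; rewrite size_enum_ord; apply.
    by move=> i; rewrite mem_enum.
  by move=> i; rewrite distrC; have := coord_le_norm (x - y) i; rewrite !mxE.
elim: r => [|i r IH] d0 z zN zy zd.
  have -> : z = y by apply/rowP => i; exact: zy.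
  by rewrite subrr normr0 !mul0r.
pose z' := (y 0 i - z 0 i) *: delta_mx 0 i + z.
have z'E j : z' 0 j = if j == i then y 0 j else z 0 j.
  by rewrite !mxE eqxx /=; case: eqP => [->|_]; rewrite ?mulr1 ?subrK ?mulr0 ?add0r.
rewrite (_ : G z - G y = (G z - G z') + (G z' - G y)); last by ring.
apply: le_trans (ler_normD _ _) _.
rewrite /= -natr1 mulrDl mulrDl mul1r addrC; apply: lerD; last first.
  have [c hc E] := line_MVT z (y 0 i - z 0 i) (fun x => smooth_is_derive x i sG).
  rewrite distrC E normrM mulrC; apply: ler_pM => //.
  apply: GB => j; rewrite !mxE eqxx /=; apply: le_trans (ler_normD _ _) _.
  have h1 : `|c * (j == i)%:R| <= N + N.
    apply: (@le_trans _ _ `|c|).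
      by case: (j == i); rewrite ?mulr1 ?mulr0 ?normr0.
    by apply: le_trans hc _; apply: le_trans (ler_normB _ _) _; exact: lerD.
  have h2 := zN j; have -> : 3 * N = (N + N) + N by ring.
  exact: lerD.
apply: IH => // [j|j jr|j]; rewrite z'E; case: eqP => // ji.
- by apply: zy; rewrite inE negb_or jr andbT; apply/eqP.
- by rewrite subrr normr0.
Qed.

Lemma testfun_of_real Omega A u : open Omega -> compact A -> A `<=` Omega ->
  smooth setT u -> (forall x, ~ A x -> u x = 0) ->
  [/\ testfun Omega (mkCf u (fun=> 0)), fsupp (mkCf u (fun=> 0)) `<=` A &
    forall s x, `|pds s (mkCf u (fun=> 0)) x| <= `|pds s u x|].
Proof.
move=> oO cA AO su u0.
have s0 := smooth_cst (0 : R) (@openT X).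
have sw := smooth_mkCf openT su s0.
have sub : fsupp (mkCf u (fun=> 0)) `<=` A.
  move=> x hx; apply: (compact_closed_rV cA); apply: closureS hx => y /= yn.
  by apply: contrapT => yA; move: yn; rewrite /mkCf u0// => /eqP; apply.
split=> //.
  split; [split| |].
  - exact: (smoothS (@subsetT _ Omega) sw).
  - by move=> x xO; rewrite /mkCf u0// => /AO.
  - by apply: subclosed_compact cA sub; exact: closed_closure.
  - by move=> x /sub/AO.
move=> s x; apply: le_trans (norm_le_reim _) _.
have [h1 h2] := pds_complex s openT sw (x := x) Logic.I.
rewrite -h1 -h2; have -> : imf (mkCf u (fun=> 0)) = (fun=> 0) by [].
by rewrite pds_cst0 normr0 addr0.
Qed.

(** Order and constant are merged into one natural number, so that the failure
    of the bound is a statement about [m] alone, to which overspill applies. *)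
Definition complex_order_bound (m : nat) A Omega f := forall phi, testfun Omega phi ->
  fsupp phi `<=` A -> (forall s x, (size s <= m)%N -> `|pds s phi x| <= 1) ->
  `|cintegral Omega (fun x => f x * phi x)| <= m%:R.

(** [bounded_antiderivative] for the real and the imaginary part. The multi-index
    and the bounds are chosen before [f], hence remain standard under transfer.
    The estimates hold on every box and not only near [K], because the
    antiderivative has to pair with test functions whose supports are unrelated
    to [K]. *)
Theorem local_structure Omega K : open Omega -> compact K -> K `<=` Omega ->
  exists A, [/\ compact A, A `<=` Omega & forall m, exists alpha, exists B : R -> R,
    forall f, Cinf Omega f -> complex_order_bound m A Omega f ->
    exists g, [/\ Cinf Omega g, forall x, K x -> f x = mderiv alpha g x,
      forall N x, box N x -> `|g x| <= B N &
      forall N x y, Omega x -> Omega y -> box N x -> box N y ->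
        `|g x - g y| <= B N * `|x - y|]].
Proof.
move=> oO cK KO.
have [chi [A [schi cA AO chi0 chi1]]] := smooth_cutoff oO cK KO.
exists A; split=> // m; exists (fun=> m.+2).
have sm i : count_mem i (mseq (fun _ : 'I_n => m.+2)) = m.+2 by rewrite count_mseq.
have [B hB] := bounded_antiderivative schi cA chi0 oO AO m%:R sm.
exists (fun N => (2 * n%:R + 2) * (`|B N| + `|B (3 * N)|)) => f [sf f0] fm.
have [sfr sfi] := (smooth_complex f oO).1 sf.
have obr : order_bound A m m%:R (ref f).
  move=> phi sphi phi0 phi1.
  have [tp sub le1] := testfun_of_real oO cA AO sphi phi0.
  have := fm _ tp sub (fun s x sm => le_trans (le1 s x) (phi1 s x sm)).
  move=> /(le_trans (re_le_norm _)).
  have [-> _] := @cintegral_re_im _ _ Omega f _ (fun x => @testfun_out _ _ _ _ x tp).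
  have -> // : (fun x => ref f x * ref (mkCf phi (fun=> 0)) x - imf f x * imf (mkCf phi (fun=> 0)) x)
     = (fun x => ref f x * phi x).
  by apply/funext => x; rewrite /ref /imf /mkCf /= mulr0 subr0.
have obi : order_bound A m m%:R (imf f).
  move=> phi sphi phi0 phi1.
  have [tp sub le1] := testfun_of_real oO cA AO sphi phi0.
  have := fm _ tp sub (fun s x sm => le_trans (le1 s x) (phi1 s x sm)).
  move=> /(le_trans (im_le_norm _)).
  have [_ ->] := @cintegral_re_im _ _ Omega f _ (fun x => @testfun_out _ _ _ _ x tp).
  have -> // : (fun x => ref f x * imf (mkCf phi (fun=> 0)) x + imf f x * ref (mkCf phi (fun=> 0)) x)
     = (fun x => imf f x * phi x).
  by apply/funext => x; rewrite /ref /imf /mkCf /= mulr0 add0r.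
have [G1 [sG1 GE1 b1]] := hB _ sfr obr.
have [G2 [sG2 GE2 b2]] := hB _ sfi obi.
have sG := smooth_mkCf openT sG1 sG2.
pose g x : C := if x \in Omega then mkCf G1 G2 x else 0.
have gE x : Omega x -> g x = mkCf G1 G2 x by move=> Ox; rewrite /g ifT// inE.
have bN N : `|B N| <= `|B N| + `|B (3 * N)| by rewrite lerDl.
have b3N N : `|B (3 * N)| <= `|B N| + `|B (3 * N)| by rewrite lerDr.
exists g; split.
- split.
    apply: (eq_smooth oO _ (smoothS (@subsetT _ Omega) sG)) => x Ox.
    by rewrite gE.
  by move=> x xO; rewrite /g ifF//; apply/negP; rewrite inE.
- move=> x Kx; have Ox := KO _ Kx; rewrite mderivE.
  rewrite (near_pds (g := mkCf G1 G2) _ (open_near oO Ox gE)).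
  have [h1 h2] := pds_complex (mseq (fun=> m.+2)) openT sG (x := x) Logic.I.
  rewrite [RHS]mkC_eta -h1 -h2.
  have -> : ref (mkCf G1 G2) = G1 by [].
  have -> : imf (mkCf G1 G2) = G2 by [].
  by rewrite GE1 GE2 chi1// !mul1r -mkC_eta.
- move=> N x xN.
  have h1 := (b1 N x xN).1; have h2 := (b2 N x xN).1.
  have h : `|mkCf G1 G2 x| <= `|B N| + `|B N|.
    apply: le_trans (norm_le_reim _) _.
    by apply: lerD; [exact: le_trans h1 (ler_norm _)|exact: le_trans h2 (ler_norm _)].
  have hh : `|B N| + `|B N| <= (2 * n%:R + 2) * (`|B N| + `|B (3 * N)|).
    rewrite mulrDl ler_wpDl ?mulr_ge0 ?addr_ge0//.
    by rewrite mulr2n mulrDl !mul1r lerD.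
  rewrite /g; case: ifPn => _; first exact: le_trans h hh.
  by rewrite normr0; apply: le_trans hh; rewrite addr_ge0.
move=> N x y Ox Oy xN yN; rewrite !gE//.
have [N0|N0] := leP 0 N; last first.
  have -> : x = y.
    apply/rowP => i; have := le_lt_trans (xN i) N0.
    by rewrite ltNge normr_ge0.
  by rewrite !subrr !normr0 mulr0.
have l1 := coordinatewise_lipschitz sG1 N0 (fun x i h => (b1 _ x h).2 i) xN yN.
have l2 := coordinatewise_lipschitz sG2 N0 (fun x i h => (b2 _ x h).2 i) xN yN.
apply: le_trans (norm_le_reim _) _; rewrite reB imB.
have h3 : n%:R * B (3 * N) * `|x - y| <= n%:R * (`|B N| + `|B (3 * N)|) * `|x - y|.
  rewrite ler_wpM2r// ler_wpM2l//; apply: le_trans (b3N N); exact: ler_norm.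
apply: le_trans (lerD (le_trans l1 h3) (le_trans l2 h3)) _.
rewrite -mulrDl ler_wpM2r// -mulrDl ler_wpM2r ?addr_ge0//.
by rewrite mulr2n mulrDl mul1r lerDl.
Qed.

End ComplexStructure.

(** * Finite test functions *)
Section Exhaustion.
Context {R : realType} {n : nat}.
Local Notation X := 'rV[R]_n.
Variable Omega : set X.

Definition exhaust (m : nat) : set X :=
  [set x | `|x| <= m%:R /\ forall z, `|z - x| < m.+1%:R^-1 -> Omega z].

Lemma exhaust_sub m : exhaust m `<=` Omega.
Proof. by move=> x [_ h]; apply: h; rewrite subrr normr0 invr_gt0. Qed.

Lemma exhaust_box m : exhaust m `<=` box m%:R.
Proof. by move=> x [xm _]; exact: box_norm. Qed.

Lemma exhaust_le m k : (m <= k)%N -> exhaust m `<=` exhaust k.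
Proof.
move=> mk x [xm h]; split; first by apply: le_trans xm _; rewrite ler_nat.
move=> z zx; apply: h; apply: lt_le_trans zx _.
by rewrite lef_pV2 ?posrE// ler_nat.
Qed.

Lemma compact_exhaust m : compact (exhaust m).
Proof.
apply: bounded_closed_compact.
  exists m%:R; split; first exact: num_real.
  by move=> B mB x [xm _]; apply: le_trans (ltW mB).
rewrite -[exhaust m]setCK; apply: open_closedC.
rewrite openE => x /= /not_andP[xm|/existsNP[z /not_implyP[zx nz]]].
  move/negP: xm; rewrite -ltNge => xm.
  apply/nbhs_ballP; exists (`|x| - m%:R); first by rewrite /= subr_gt0.
  move=> y; rewrite -ball_normE /= => xy [ym _].
  have := lerB_dist x y; rewrite leNgt => /negP; apply.
  by apply: lt_le_trans xy _; rewrite lerB.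
apply/nbhs_ballP; exists (m.+1%:R^-1 - `|z - x|); first by rewrite /= subr_gt0.
move=> y; rewrite -ball_normE /= ltrBrDl => xy [_ h]; apply: nz; apply: h.
apply: le_lt_trans xy; have := ler_normD (z - x) (x - y).
by rewrite addrA subrK.
Qed.

Hypothesis oO : open Omega.

(** Each point of [Omega] has a neighbourhood inside some member of the
    exhaustion, so infinite members contain all nearstandard points. *)
Lemma near_exhaust y : Omega y -> exists m, exists2 d : R, 0 < d &
  forall x, `|x - y| < d -> exhaust m x.
Proof.
move=> Oy; have /nbhs_ballP[e /= e0 he] : nbhs y Omega by exact: (open_nbhs_nbhs (conj oO Oy)).
(* The first two terms bound the norm near [y], the last one makes
   [1 / (m + 1)] smaller than [e / 2]. *)
pose a := `|y| + 1 + 2 / e.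
exists (Num.bound a), (Num.min 1 (e / 2)); first by rewrite lt_min ltr01 divr_gt0.
have a0 : 0 <= a by rewrite !addr_ge0// divr_ge0// ltW.
have ab : a < (Num.bound a)%:R by exact: archi_boundP.
move=> x; rewrite lt_min => /andP[x1 xe]; split.
  apply: le_trans (ltW ab); rewrite -[x](subrK y).
  apply: le_trans (ler_normD _ _) _; rewrite addrC /a -addrA lerD2l.
  by rewrite ler_wpDr ?divr_ge0 ?ltW.
move=> z zx; apply: he; rewrite -ball_normE /= distrC.
rewrite -[z](subrK x) -addrA; apply: le_lt_trans (ler_normD _ _) _.
rewrite (splitr e) ltrD//; apply: lt_le_trans zx _.
rewrite -[e / 2]invrK lef_pV2 ?posrE ?invr_gt0 ?divr_gt0// invf_div.
apply: (@le_trans _ _ a); first by rewrite /a lerDr addr_ge0.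
by apply: le_trans (ltW ab) _; rewrite ler_nat.
Qed.

End Exhaustion.

Section FiniteElements.
Variables (E : nsExtension) (R : realType) (n : nat).
Local Notation X := 'rV[R]_n.
Local Notation C := (Rcomplex R).
Variables (Omega : set X) (oO : open Omega).
Implicit Types f g phi : star E (X -> C).

Lemma infclose_std (x : star E X) (y : X) :
  infclose x (std E y) <-> forall e : R, 0 < e -> sset [set x | `|x - y| < e] x.
Proof.
by rewrite /infclose /infinitesimal; split=> h e /h;
  rewrite /smap2 spair_std smap_smap sset_smap.
Qed.

Lemma nearstd_exhaust (x : star E X) N : nearstd Omega x -> infinite N ->
  sset [set p | exhaust Omega p.1 p.2] (spair N x).
Proof.
move=> [_ [y Oy /infclose_std xy]] Ninf.
have [m [d d0 hd]] := near_exhaust oO Oy.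
have h1 := (sset_fst _ N x).2 (infinite_gt m Ninf).
have h2 := (sset_snd _ N x).2 (xy d d0).
apply: sset_mono (sset_and h1 h2) => -[k z] /= [mk zy].
exact: exhaust_le (ltnW mk) _ (hd _ zy).
Qed.

(** The standard sets to which [x] belongs form a proper filter that contains
    [A]; a cluster point in [A] is infinitely close to [x]. *)
Lemma compact_nearstd (A : set X) (x : star E X) : compact A -> A `<=` Omega -> sset A x ->
  nearstd Omega x.
Proof.
move=> cA AO Ax; split; first exact: sset_mono AO Ax.
pose F : set_system X := [set P | sset P x].
have FF : ProperFilter F.
  split; first by apply: sset_false => a.
  split; first exact: sset_setT.
    by move=> P Q; exact: sset_and.
  by move=> P Q; exact: sset_mono.
have [y [Ay cy]] := cA F FF Ax.
exists y; first exact: AO.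
apply/infclose_std => e e0; apply: contrapT => /ssetN h.
have [z [/= z1 z2]] := cy _ (ball y e) h (nbhsx_ballx y e e0).
by apply: z1; rewrite distrC; move: z2; rewrite -ball_normE.
Qed.

(** The support is internal and lies in every infinite member of the
    exhaustion. *)
Lemma finite_testfun_support phi : finite_testfun Omega phi ->
  exists m, sset [set h | fsupp h `<=` exhaust Omega m] phi.
Proof.
move=> [tphi ns _].
apply: (@underspill E _ [set p | fsupp p.2 `<=` exhaust Omega p.1]) => N Ninf.
apply/(sset_forallP [set q | fsupp q.1.2 q.2 -> exhaust Omega q.1.1 q.2]) => x.
apply/(sset_imp [set q | fsupp q.1.2 q.2] [set q | exhaust Omega q.1.1 q.2]).
set w := spair (spair N phi) x => hw.
have Ex : x = smap snd w by rewrite smap_snd.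
have Ep : phi = smap (fun q => q.1.2) w.
  by rewrite -(smap_smap snd fst) smap_fst smap_snd.
have EN : N = smap (fun q => q.1.1) w.
  by rewrite -(smap_smap fst fst) !smap_fst.
have hx : smem x (smap (@fsupp R n) phi).
  by rewrite Ep Ex smap_smap; apply/(smem_smap snd (fun q => fsupp q.1.2)).
by have := nearstd_exhaust (ns x hx) Ninf; rewrite EN Ex spair_smap sset_smap.
Qed.

Lemma mderiv0 (h : X -> C) : mderiv (fun=> 0%N) h = h.
Proof. by rewrite /mderiv; elim: (enum 'I_n) => //= i r ->. Qed.

Lemma limited_sset (V : normedModType R) (A : Type) (h : A -> V) (w : star E A) :
  limited (smap h w) <-> exists r : R, sset [set a | `|h a| <= r] w.
Proof. by split=> -[r hr]; exists r; move: hr; rewrite sset_smap. Qed.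

Lemma infinite_gtR (N : star E nat) (r : R) : infinite N -> sset [set m | r < m%:R] N.
Proof.
move=> Ninf; apply: sset_mono (infinite_gt (Num.bound `|r|) Ninf) => m /= rm.
apply: (le_lt_trans (ler_norm r)); apply: lt_trans (archi_boundP _) _ => //.
by rewrite ltr_nat.
Qed.

(** Every value is limited, so every infinite integer is an upper bound, and by
    underspill some standard integer is. *)
Lemma finite_testfun_bounded phi : finite_testfun Omega phi ->
  exists m : nat, sset [set h | forall x, `|h x| <= m%:R] phi.
Proof.
move=> [tphi _ lim].
apply: (@underspill E _ [set p | forall x, `|p.2 x| <= p.1%:R]) => N Ninf.
apply/(sset_forallP [set q | `|q.1.2 q.2| <= q.1.1%:R]) => x.
set w := spair (spair N phi) x.
have Ex : x = smap snd w by rewrite smap_snd.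
have Ep : phi = smap (fun q => q.1.2) w.
  by rewrite -(smap_smap snd fst) smap_fst smap_snd.
have EN : N = smap (fun q => q.1.1) w.
  by rewrite -(smap_smap fst fst) !smap_fst.
have [Ox|nOx] := pselect (sset Omega x).
  have [r] := lim (fun=> 0%N) x Ox.
  rewrite Ep Ex smap_smap sapp_smap sset_smap => h1.
  have := infinite_gtR r Ninf; rewrite EN sset_smap => h2.
  apply: sset_mono (sset_and h1 h2) => -[[k p] z] /=; rewrite mderiv0 => -[h3 h4].
  exact: le_trans h3 (ltW h4).
move/ssetN: nOx; rewrite Ex sset_smap => h1.
move: tphi; rewrite Ep sset_smap => h2.
apply: sset_mono (sset_and h1 h2) => -[[k p] z] /= [h3 h4].
by rewrite (testfun_out h4 h3) normr0.
Qed.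

Lemma finite_testfun_mderiv phi alpha : finite_testfun Omega phi ->
  finite_testfun Omega (smap (mderiv alpha) phi).
Proof.
move=> [tphi ns lim]; split.
- by rewrite sset_smap; apply: sset_mono tphi => p; exact: testfun_mderiv.
- move=> x hx; apply: ns; move: hx.
  pose w := spair x phi.
  have Ex : x = smap fst w by rewrite smap_fst.
  have Ep : phi = smap snd w by rewrite smap_snd.
  rewrite Ep Ex !smap_smap !smem_smap; apply: sset_mono => -[z p] /=.
  by rewrite mderivE => /fsupp_pds.
- move=> beta x Ox.
  have <- : smap (mderiv (fun i => beta i + alpha i)%N) phi =
            smap (mderiv beta) (smap (mderiv alpha) phi).
    rewrite smap_smap; apply/esym/sset_eq; apply: sset_mono tphi => p /=.
    exact: mderiv_mderiv.
  exact: lim.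
Qed.

Lemma limited_spairing f phi : limited (spairing Omega f phi) <->
  exists r : R, sset [set p | `|cintegral Omega (fun x => p.1 x * p.2 x)| <= r] (spair f phi).
Proof. by rewrite /spairing /smap2 smap_smap limited_sset. Qed.

End FiniteElements.

(** * The characterisation of S-distributions *)
Section Main.
Variables (E : nsExtension) (R : realType) (n : nat).
Local Notation X := 'rV[R]_n.
Local Notation C := (Rcomplex R).
Variables (Omega : set X) (oO : open Omega).
Implicit Types f g phi : star E (X -> C).

(** The compact set on which [f] has to be a derivative is a member of the
    exhaustion that contains the support of the test function. *)
Lemma Sdistribution_of_local_derivative f : sset (Cinf Omega) f ->
  (forall K : set X, compact K -> K `<=` Omega ->
    exists g, Sdistribution Omega g /\ exists alpha : 'I_n -> nat,
      forall x, sset K x -> sapp f x = sapp (smap (mderiv alpha) g) x) ->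
  Sdistribution Omega f.
Proof.
move=> Cf H; split=> // phi fphi.
have [m hm] := finite_testfun_support oO fphi.
have [g [[Cg Dg] [alpha fg]]] := H _ (@compact_exhaust _ _ Omega m) (@exhaust_sub _ _ Omega m).
have /limited_spairing[r hr] := Dg _ (finite_testfun_mderiv alpha fphi).
apply/limited_spairing; exists r.
set K := exhaust Omega m in hm fg.
have eqK : sset [set p : (X -> C) * (X -> C) | forall x, K x -> p.1 x = mderiv alpha p.2 x] (spair f g).
  apply/(sset_forallP [set q : ((X -> C) * (X -> C)) * X | K q.2 -> q.1.1 q.2 = mderiv alpha q.1.2 q.2]) => x.
  apply/(sset_imp [set q | K q.2] [set q | q.1.1 q.2 = mderiv alpha q.1.2 q.2]).
  set w := spair (spair f g) x => /sset_snd Kx.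
  have Ex : x = smap snd w by rewrite smap_snd.
  have Eg : g = smap (fun q => q.1.2) w.
    by rewrite -(smap_smap snd fst) smap_fst smap_snd.
  have Ef : f = smap (fun q => q.1.1) w.
    by rewrite -(smap_smap fst fst) !smap_fst.
  have := fg x Kx.
  by rewrite Ef Eg Ex smap_smap !sapp_smap => /sset_eq.
set w := spair (spair f g) phi.
have Ep : phi = smap snd w by rewrite smap_snd.
have Eg : g = smap (fun q => q.1.2) w.
  by rewrite -(smap_smap snd fst) smap_fst smap_snd.
have Ef : f = smap (fun q => q.1.1) w.
  by rewrite -(smap_smap fst fst) !smap_fst.
have tphi : sset (testfun Omega) phi by case: fphi.
have h1 := (sset_fst _ (spair f g) phi).2 eqK; rewrite -/w in h1.
rewrite Ep sset_smap in hm; rewrite Eg Ep smap_smap spair_smap sset_smap in hr.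
rewrite Eg sset_smap in Cg; rewrite Ep sset_smap in tphi.
rewrite Ef Ep spair_smap sset_smap.
apply: sset_mono (sset_and h1 (sset_and hm (sset_and hr (sset_and Cg tphi)))).
move=> -[[f' g'] p] /= [e1 [e2 [e3 [e4 e5]]]].
by rewrite (cintegral_by_parts oO e4 e5 e2 (@exhaust_sub _ _ Omega m) e1).
Qed.

(** If no standard [m] works, overspill yields a test function supported in [A]
    whose pairing with [f] exceeds an infinite [N] while its derivatives of order
    at most [N], in particular all those of standard order, are bounded by 1.
    This is a finite test function with an unlimited pairing. *)
Lemma Sdistribution_finite_order f (A : set X) : compact A -> A `<=` Omega ->
  Sdistribution Omega f ->
  exists m, sset [set h | complex_order_bound m A Omega h] f.
Proof.
move=> cA AO [Cf Df]; apply: contrapT => /forallNP H.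
pose Q (q : (nat * (X -> C)) * (X -> C)) := [/\ testfun Omega q.2, fsupp q.2 `<=` A,
  forall s x, (size s <= q.1.1)%N -> `|pds s q.2 x| <= 1 &
  q.1.1%:R < `|cintegral Omega (fun x => q.1.2 x * q.2 x)|].
have [|N Ninf] := @overspill E _ [set p : nat * (X -> C) | exists h, Q (p, h)] f.
  move=> m; have /ssetN := H m; apply: sset_mono => f' /= h.
  apply: contrapT => /forallNP h1; apply: h => phi t1 t2 t3.
  rewrite leNgt; apply/negP => t4; apply: (h1 phi).
  by split.
move=> /(sset_exists [set q | Q q])[phi hQ].
set w := spair (spair N f) phi in hQ.
have Ep : phi = smap snd w by rewrite smap_snd.
have Ef : f = smap (fun q => q.1.2) w.
  by rewrite -(smap_smap snd fst) smap_fst smap_snd.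
have EN : N = smap (fun q => q.1.1) w.
  by rewrite -(smap_smap fst fst) !smap_fst.
have fphi : finite_testfun Omega phi.
  split.
  - by rewrite Ep sset_smap; apply: sset_mono hQ => q [].
  - move=> x hx; apply: (compact_nearstd cA AO).
    pose v := spair x w.
    have Ex : x = smap fst v by rewrite smap_fst.
    have Ev : w = smap snd v by rewrite smap_snd.
    move: hx hQ; rewrite Ep Ev Ex !smap_smap smem_smap !sset_smap => h1 h2.
    by apply: sset_mono (sset_and h1 h2) => -[z q] /= [h3 [_ h4 _ _]]; exact: h4.
  - move=> alpha x Ox; exists 1.
    pose v := spair x w.
    have Ex : x = smap fst v by rewrite smap_fst.
    have Ev : w = smap snd v by rewrite smap_snd.
    have := infinite_gt (size (mseq alpha)) Ninf.
    move: hQ; rewrite EN Ep Ev Ex !smap_smap sapp_smap !sset_smap => h1 h2.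
    apply: sset_mono (sset_and h1 h2) => -[z q] /= [[_ _ h4 _] h3].
    by rewrite mderivE; apply: h4; exact: ltnW.
have /limited_spairing[r] := Df _ fphi.
have := infinite_gtR r Ninf.
rewrite EN Ef Ep spair_smap !sset_smap => h1 h2.
apply: (sset_false _ (sset_and hQ (sset_and h1 h2))) => q /= [[_ _ _ h3] [h4 h5]].
by have := lt_trans h4 h3; rewrite ltNge h5.
Qed.

(** The three properties of [g] follow from its standard bounds: on the
    points of [K], from the bounds on a box containing [K]; for the pairing with a
    finite test function, from the bound on a standard box containing its
    support. *)
Lemma local_derivative_of_Sdistribution f (K : set X) : compact K -> K `<=` Omega ->
  Sdistribution Omega f ->
  exists g, [/\ Sdistribution Omega g, finite_valued K g, Scontinuous K g &
    exists alpha : 'I_n -> nat,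
      forall x, sset K x -> sapp f x = sapp (smap (mderiv alpha) g) x].
Proof.
move=> cK KO Df; have Cf : sset (Cinf Omega) f by case: Df.
have [A [cA AO HA]] := local_structure oO cK KO.
have [m hm] := Sdistribution_finite_order cA AO Df.
have [alpha [B hB]] := HA m.
pose S (p : (X -> C) * (X -> C)) := [/\ Cinf Omega p.2,
  forall x, K x -> p.1 x = mderiv alpha p.2 x,
  forall N x, box N x -> `|p.2 x| <= B N &
  forall N x y, Omega x -> Omega y -> box N x -> box N y ->
    `|p.2 x - p.2 y| <= B N * `|x - y|].
have /(sset_exists [set p | S p])[g hS] : sset [set f' | exists h, S (f', h)] f.
  by apply: sset_mono (sset_and Cf hm) => f' [h1 h2]; exact: hB.
have [M M0 KM] := compact_in_box cK.
pose w := spair f g; rewrite -/w in hS.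
have Eg : g = smap snd w by rewrite smap_snd.
have Ef : f = smap fst w by rewrite smap_fst.
exists g; split.
- split; first by rewrite Eg sset_smap; apply: sset_mono hS => p [].
  move=> phi fphi; apply/limited_spairing.
  have [k hk] := finite_testfun_support oO fphi.
  have [b hb] := finite_testfun_bounded fphi.
  have tphi : sset (testfun Omega) phi by case: fphi.
  exists (4 * (`|B k%:R| * b%:R) * (2 * k%:R) ^+ n).
  have h1 : sset [set g | Cinf Omega g /\ forall x, box k%:R x -> `|g x| <= B k%:R] g.
    by rewrite Eg sset_smap; apply: sset_mono hS => p [p1 _ p3 _]; split=> //; exact: p3.
  have h2 := (sset_fst _ g phi).2 h1.
  have h3 := (sset_snd _ g phi).2 (sset_and tphi (sset_and hk hb)).
  apply: sset_mono (sset_and h2 h3) => -[g' p] /= [[g1 g2] [p1 [p2 p3]]].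
  apply: (cintegral_bound oO _ g1 p1) => //.
    by move=> x /p2; exact: exhaust_box.
  by move=> x _; exact: g2.
- move=> x Kx; exists (B M).
  pose v := spair x w.
  have Ex : x = smap fst v by rewrite smap_fst.
  have Ev : w = smap snd v by rewrite smap_snd.
  move: Kx hS; rewrite Eg Ev Ex smap_smap sapp_smap !sset_smap => h1 h2.
  by apply: sset_mono (sset_and h1 h2) => -[z p] /= [h3 [_ _ h4 _]]; apply: h4; exact: KM.
- move=> x y Kx Ky xy e e0.
  pose v := spair (spair x y) w.
  have Ex : x = smap (fun q => q.1.1) v by rewrite -(smap_smap fst fst) !smap_fst.
  have Ey : y = smap (fun q => q.1.2) v.
    by rewrite -(smap_smap snd fst) smap_fst smap_snd.
  have Ev : w = smap snd v by rewrite smap_snd.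
  have e1 : 0 < e / (`|B M| + 1) by rewrite divr_gt0// ltr_wpDl.
  have := xy _ e1; move: Kx Ky hS.
  rewrite Eg Ev Ex Ey !smap_smap !sapp_smap !smap2_smap !sset_smap => h1 h2 h3 h4.
  apply: sset_mono (sset_and h1 (sset_and h2 (sset_and h3 h4))).
  move=> -[[a b] p] /= [k1 [k2 [[_ _ _ k3] k4]]].
  apply: le_lt_trans (k3 M a b (KO _ k1) (KO _ k2) (KM _ k1) (KM _ k2)) _.
  move: k4; rewrite ltr_pdivlMr ?ltr_wpDl// mulrC; apply: le_lt_trans.
  by rewrite ler_wpM2r// (le_trans (ler_norm _))// lerDl.
exists alpha => x Kx.
pose v := spair x w.
have Ex : x = smap fst v by rewrite smap_fst.
have Ev : w = smap snd v by rewrite smap_snd.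
move: Kx hS; rewrite Ef Eg Ev Ex !smap_smap !sapp_smap !sset_smap => h1 h2.
apply/sset_eq; apply: sset_mono (sset_and h1 h2) => -[z p] /= [k1 [_ k2 _ _]].
exact: k2.
Qed.

End Main.

Theorem theorem7 (E : nsExtension) (R : realType) (n : nat)
    (Omega : set 'rV[R]_n) (f : star E ('rV[R]_n -> Rcomplex R))
    (openOmega : open Omega) (fCinf : sset (Cinf Omega) f) :
  Sdistribution Omega f <->
  forall K : set 'rV[R]_n, compact K -> K `<=` Omega ->
    exists g : star E ('rV[R]_n -> Rcomplex R),
      [/\ Sdistribution Omega g, finite_valued K g, Scontinuous K g &
          exists alpha : 'I_n -> nat,
            forall x : star E 'rV[R]_n, sset K x ->
              sapp f x = sapp (smap (mderiv alpha) g) x].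
Proof.
split=> [Df K cK KO|H].
  exact: (local_derivative_of_Sdistribution openOmega cK KO Df).
apply: (Sdistribution_of_local_derivative openOmega fCinf) => K cK KO.
have [g [Dg _ _ fg]] := H K cK KO.
by exists g.
Qed.
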